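(* Let $\lambda(n):=\pi\sqrt{24n-1}/6$ and $q(n):=\frac{\log(24n-1)}{|\log(\log(24n-1))-1.1714|}$. Then for all integers $n\geq 1$, $$S(n)=2\sqrt{3}\,e^{\lambda(n)}+E(n),\qquad |E(n)|<(4.30\times 10^{23})\,2^{q(n)}(24n-1)^2e^{\lambda(n)/2}.$$
   Context: Let $E_4(z)=1+240\sum_{m\ge1}\sigma_3(m)e^{2\pi i mz}$ and $\eta(z)=e^{\pi i z/12}\prod_{m\ge1}(1-e^{2\pi i mz})$ on the upper half-plane $\mathbb{H}$. Define the weight-zero weakly holomorphic modular form for $\Gamma_0(6)$ $$f(z):=\frac{1}{24}\frac{E_4(z)-4E_4(2z)-9E_4(3z)+36E_4(6z)}{(\eta(z)\eta(2z)\eta(3z)\eta(6z))^2}.$$ For $n\ge1$ let $\mathcal{Q}_n$ be the set of positive definite integral binary quadratic forms $Q=[a,b,c]=aX^2+bXY+cY^2$ of discriminant $b^2-4ac=-24n+1$ with $6\mid a$ and $b\equiv 1\pmod{12}$; $\Gamma_0(6)$ acts on $\mathcal{Q}_n$ by $Q\mapsto Q\circ\sigma$, $(Q\circ\sigma)(X,Y)=Q(\alpha X+\beta Y,\gamma X+\delta Y)$ for $\sigma=\begin{pmatrix}\alpha&\beta\\\gamma&\delta\end{pmatrix}$. For $Q=[a,b,c]$ let $\tau_Q=\frac{-b+\sqrt{-24n+1}}{2a}\in\mathbb{H}$ be its Heegner point. Define $S(n):=\sum_{[Q]\in\mathcal{Q}_n/\Gamma_0(6)} f(\tau_Q)$,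 the sum over $\Gamma_0(6)$-equivalence classes (well defined since $f$ is $\Gamma_0(6)$-invariant). *)

(* Defs.v *)
(* MathComp-Analysis; the complex numbers are [R[i]] for [R : realType]. *)
From HB Require Import structures.
From mathcomp Require Import all_boot all_order all_algebra.
From mathcomp Require Import all_classical all_reals all_analysis.
From mathcomp Require Import complex ring.
Set Implicit Arguments.
Unset Strict Implicit.
Unset Printing Implicit Defensive.
Import Order.TTheory GRing.Theory Num.Theory.
Import numFieldNormedType.Exports.
Local Open Scope classical_set_scope.
Local Open Scope complex_scope.
Local Open Scope ring_scope.

(* The triple [(a, b, c)] stands for the form aX^2 + bXY + cY^2. *)
Definition bqf := (int * int * int)%type.
Definition qa (Q : bqf) : int := Q.1.1.
Definition qb (Q : bqf) : int := Q.1.2.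
Definition qc (Q : bqf) : int := Q.2.

Definition qeval (Q : bqf) (x y : int) : int :=
  qa Q * x ^+ 2 + qb Q * x * y + qc Q * y ^+ 2.

Definition qdisc (Q : bqf) : int := qb Q ^+ 2 - 4 * qa Q * qc Q.

Definition posdef (Q : bqf) : Prop :=
  forall x y : int, (x, y) <> (0, 0) -> 0 < qeval Q x y.

Definition Gamma0 (N : nat) : set 'M[int]_2 :=
  [set s : 'M[int]_2 | \det s = 1 /\ (N%:Z %| s 1%R 0%R)%Z].

(* The coefficients of Q(alpha X + beta Y, gamma X + delta Y): see [qactE]. *)
Definition qact (Q : bqf) (s : 'M[int]_2) : bqf :=
  (qeval Q (s 0 0) (s 1 0),
   2 * qa Q * s 0 0 * s 0 1
     + qb Q * (s 0 0 * s 1 1 + s 0 1 * s 1 0)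
     + 2 * qc Q * s 1 0 * s 1 1,
   qeval Q (s 0 1) (s 1 1)).

Lemma qactE (Q : bqf) (s : 'M[int]_2) (x y : int) :
  qeval (qact Q s) x y = qeval Q (s 0 0 * x + s 0 1 * y) (s 1 0 * x + s 1 1 * y).
Proof. rewrite /qact /qeval /qa /qb /qc /=; ring. Qed.

Definition Qset (n : nat) : set bqf :=
  [set Q | [/\ posdef Q, qdisc Q = - 24 * n%:Z + 1, (6 %| qa Q)%Z
             & (qb Q = 1 %[mod 12])%Z]].

Definition qclass (Q : bqf) : set bqf := [set qact Q s | s in Gamma0 6].

Definition Qclasses (n : nat) : set (set bqf) := [set qclass Q | Q in Qset n].

Section ModularForms.
Variable R : realType.
Local Notation C := R[i].

Definition cexp (z : C) : C :=
  (expR (complex.Re z))%:C * (cos (complex.Im z) +i* sin (complex.Im z)).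

(* e^{2 pi i m z} *)
Definition qexp (m : nat) (z : C) : C :=
  cexp ((2 * pi)%:C * 'i%C * m%:R * z).

Definition sigma (k m : nat) : nat := (\sum_(d <- divisors m) d ^ k)%N.

(* The limits are taken in [C^o], where [C] carries the topology of its norm. *)
Definition E4 (z : C) : C :=
  1 + 240 * limn (fun N : nat =>
    \sum_(1 <= m < N) (sigma 3 m)%:R * qexp m z : C^o).

Definition eta (z : C) : C :=
  cexp (pi%:C * 'i%C * z / 12) *
  limn (fun N : nat => \prod_(1 <= m < N) (1 - qexp m z) : C^o).

Definition f (z : C) : C :=
  24^-1 * ((E4 z - 4 * E4 (2 * z) - 9 * E4 (3 * z) + 36 * E4 (6 * z))
           / (eta z * eta (2 * z) * eta (3 * z) * eta (6 * z)) ^+ 2).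

Definition Dn (n : nat) : R := 24 * n%:R - 1.

Definition heegner (n : nat) (Q : bqf) : C :=
  (- (qb Q)%:~R + 'i%C * (Num.sqrt (Dn n))%:C) / (2 * (qa Q)%:~R).

(* [xget] picks a form in the class [K]; its default value is never used, as
   classes are nonempty. *)
Definition traceS (n : nat) : C :=
  \sum_(K \in Qclasses n) f (heegner n (xget (0, 0, 0) K)).

Definition lambda (n : nat) : R := pi * Num.sqrt (Dn n) / 6.

Definition qn (n : nat) : R :=
  ln (Dn n) / `| ln (ln (Dn n)) - (1 + 1714 / 10 ^+ 4) |.

End ModularForms.

(* Main.v *)
(* Every class is carried by the generators T, W_6 and W_3 of the Atkin-Lehner
   extension of Gamma_0(6) to a triple (A, b, c), standing for [6A, b, c], with
   |b| <= 6A and A minimal; minimality forces 8A^2 <= D = 24n-1.  Here f is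
   invariant under T and W_6 and changes sign under W_3, and the sign is recorded
   by the character of b mod 12 that is 1 at +-1 and -1 at +-5.  Since b is 1
   mod 12 for the forms in Q_n, the Atkin-Lehner index linking two of them is 1,
   so a class is determined by its reduced triple, and there are O(D^2) classes.
   On reduced triples |f(tau) - e(-tau)| is bounded by an absolute constant and
   |e(-tau)| = e^(lambda/A).  For D > 72 the four triples with A = 1, that is
   b = +-1, +-5, each occur exactly once and contribute
   e^lambda (2 cos(pi/6) - 2 cos(5 pi/6)) = 2 sqrt 3 e^lambda; all others have
   A >= 2.

   The behaviour of f under W_6 and W_3 comes from those of E_4 and eta^2 under
   z |-> -1/z.  For E_4 this is the partial fraction expansion of the cotangent,
   obtained by iterating its duplication formula and Tannery's theorem; for
   eta^2 the quotient of both sides has zero derivative, by the quasi-modularity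
   of the weight two Lambert series. *)
Require Import Defs.
From mathcomp Require Import all_boot all_order all_algebra.
From mathcomp Require Import all_classical all_reals all_analysis.
From mathcomp Require Import complex ring lra zify.
Set Implicit Arguments.
Unset Strict Implicit.
Unset Printing Implicit Defensive.
Import Order.TTheory GRing.Theory Num.Theory.
Import numFieldNormedType.Exports.
Local Open Scope classical_set_scope.
Local Open Scope complex_scope.
Local Open Scope ring_scope.

(** * Norms, limits and absolutely convergent series of complex numbers *)

Section ComplexLimits.
Variable R : realType.
Local Notation C := R[i].
Implicit Types (u v a b : nat -> C) (z w l s : C).

(** Gamma_0(6) has four cusps, its Atkin-Lehner extension only one. Reduction under the extension
    brings every Heegner point to 12 Im tau >= sqrt 8, so one estimate of f near infinity serves all
    classes. The price is that distinct classes may be linked by the extension; the congruence b = 1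
    mod 12 keeps them apart and the character of b keeps track of the sign. The transformation rules
    rest on explicitly dominated double series, and the constancy of the quotient for eta^2 on a
    quadratic remainder bound, uniform on convex regions: a finely subdivided segment then
    accumulates no change. The bound for |f - e(-tau)| is 10^17: a factor 10^8 for dividing by eight
    Euler products of modulus at least 1/10, and 10^9 for the numerator. With at most 13 D^2
    classes, 4.3 * 10^23 leaves a factor 4.3 * 10^6 to spare. It also pays for replacing e^lambda by
    64 e^(lambda/2) when n <= 3, where D <= 71 lies below the threshold of the argument for the four
    main triples. *)

Definition nm (z : C) : R := ComplexField.Normc.normc z.

Lemma norm_nm z : `|z| = (nm z)%:C.
Proof. by []. Qed.
Lemma nm_ge0 z : 0 <= nm z.
Proof. by rewrite -lecR -norm_nm normr_ge0. Qed.
Lemma nm0 : nm 0 = 0.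
Proof. by apply: complexI; rewrite -norm_nm normr0. Qed.
Lemma nm1 : nm 1 = 1.
Proof. by apply: complexI; rewrite -norm_nm normr1. Qed.
Lemma nmN z : nm (- z) = nm z.
Proof. by apply: complexI; rewrite -!norm_nm normrN. Qed.
Lemma nmB z w : nm (z - w) = nm (w - z).
Proof. by apply: complexI; rewrite -!norm_nm distrC. Qed.
Lemma nmM z w : nm (z * w) = nm z * nm w.
Proof. by apply: complexI; rewrite rmorphM /= -!norm_nm normrM. Qed.
Lemma nmV z : nm z^-1 = (nm z)^-1.
Proof. by apply: complexI; rewrite fmorphV /= -!norm_nm normfV. Qed.
Lemma nmX z n : nm (z ^+ n) = nm z ^+ n.
Proof. by apply: complexI; rewrite rmorphXn /= -!norm_nm normrX. Qed.
Lemma nmD z w : nm (z + w) <= nm z + nm w.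
Proof. by rewrite -lecR rmorphD /= -!norm_nm ler_normD. Qed.
Lemma nm_sum (I : Type) (r : seq I) (P : pred I) (F : I -> C) :
  nm (\sum_(i <- r | P i) F i) <= \sum_(i <- r | P i) nm (F i).
Proof.
elim/big_ind2: _ => [|x y x1 y1 h h1|//]; first by rewrite nm0.
exact: le_trans (nmD _ _) (lerD h h1).
Qed.
Lemma nmR (x : R) : nm x%:C = `|x|.
Proof. by rewrite /nm /= expr0n /= addr0 sqrtr_sqr. Qed.
Lemma nm_nat n : nm n%:R = n%:R.
Proof. by have := nmR n%:R; rewrite (rmorph_nat (real_complex R)) normr_nat. Qed.
Lemma nm_eq0 z : (nm z == 0) = (z == 0).
Proof. by apply/eqP/eqP => [/ComplexField.Normc.eq0_normc|->]; rewrite ?nm0. Qed.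
Lemma nm_gt0 z : (0 < nm z) = (z != 0).
Proof. by rewrite lt0r nm_eq0 nm_ge0 andbT. Qed.
Lemma nmi : nm 'i%C = 1.
Proof. by rewrite /nm /= expr0n /= add0r expr1n sqrtr1. Qed.
Lemma nm_sqr z : nm z ^+ 2 = complex.Re z ^+ 2 + complex.Im z ^+ 2.
Proof. by case: z => x y; rewrite /nm /= sqr_sqrtr // addr_ge0 // sqr_ge0. Qed.
Lemma Re_le_nm z : `|complex.Re z| <= nm z.
Proof.
rewrite -(ler_pXn2r (n := 2)) ?nnegrE ?nm_ge0 //.
by rewrite nm_sqr real_normK ?num_real // lerDl sqr_ge0.
Qed.
Lemma Im_le_nm z : `|complex.Im z| <= nm z.
Proof.
rewrite -(ler_pXn2r (n := 2)) ?nnegrE ?nm_ge0 //.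
by rewrite nm_sqr real_normK ?num_real // lerDr sqr_ge0.
Qed.
Lemma nm_le_ReIm z : nm z <= `|complex.Re z| + `|complex.Im z|.
Proof.
rewrite -(ler_pXn2r (n := 2)) ?nnegrE ?nm_ge0 ?addr_ge0 //.
rewrite nm_sqr sqrrD !real_normK ?num_real // addrAC lerDl.
by rewrite mulrn_wge0 // mulr_ge0.
Qed.
Lemma nmBr z w : nm z - nm w <= nm (z - w).
Proof. by rewrite lerBlDr -{1}(subrK w z) nmD. Qed.

(** Boxing the convergence fixes the structure [C^o] once; afterwards limits are handled through
    [climP] and the limit laws. *)
Variant clim u l : Prop := Clim of (u : nat -> C^o) @ \oo --> (l : C^o).

Lemma climP u l : clim u l <->
  forall e : R, 0 < e -> exists N, forall n, (N <= n)%N -> nm (u n - l) < e.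
Proof.
split.
  case=> /cvgrPdist_lt h e e0.
  have /h : (0 : C) < e%:C by rewrite ltcR.
  move=> [N _ hN]; exists N => n /hN /=.
  by rewrite norm_nm ltcR nmB.
move=> h; constructor; apply/cvgrPdist_lt => e e0.
have hI : complex.Im e = 0 by move: e0; rewrite ltcE /= => /andP[/eqP].
have eE : e = (complex.Re e)%:C by rewrite {1}[e]complexE hI mulr0 addr0.
move: e0; rewrite eE ltcR => e0.
have [N hN] := h _ e0; exists N => //= n /= /hN.
by rewrite norm_nm ltcR nmB.
Qed.

Lemma clim_limn u l : clim u l -> limn (u : nat -> C^o) = l.
Proof. by case=> h; apply: (@cvg_lim C^o). Qed.

Lemma clim_cst l : clim (fun=> l) l.
Proof. by constructor; exact: (@cvg_cst C^o). Qed.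
Lemma climD u v l s : clim u l -> clim v s -> clim (fun n => u n + v n) (l + s).
Proof. by case=> h [k]; constructor; exact: (@cvgD C C^o _ _ _ _ _ _ _ h k). Qed.
Lemma climN u l : clim u l -> clim (fun n => - u n) (- l).
Proof. by case=> h; constructor; exact: (@cvgN C C^o _ _ _ _ _ h). Qed.
Lemma climB u v l s : clim u l -> clim v s -> clim (fun n => u n - v n) (l - s).
Proof. by case=> h [k]; constructor; exact: (@cvgB C C^o _ _ _ _ _ _ _ h k). Qed.
Lemma climM u v l s : clim u l -> clim v s -> clim (fun n => u n * v n) (l * s).
Proof. by case=> h [k]; constructor; exact: (@cvgM C _ _ _ _ _ _ _ h k). Qed.
Lemma climZ c u l : clim u l -> clim (fun n => c * u n) (c * l).
Proof. by move=> h; apply: climM h; exact: clim_cst. Qed.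
Lemma climV u l : l != 0 -> clim u l -> clim (fun n => (u n)^-1) l^-1.
Proof. by move=> l0 [h]; constructor; exact: (@cvgV C _ _ _ _ _ l0 h). Qed.
Lemma climX u l k : clim u l -> clim (fun n => u n ^+ k) (l ^+ k).
Proof.
move=> h; elim: k => [|k ih]; first exact: clim_cst.
under eq_fun do rewrite exprS; rewrite exprS; exact: climM.
Qed.
Lemma clim_unique u l s : clim u l -> clim u s -> l = s.
Proof. by move=> /clim_limn <- /clim_limn. Qed.
Lemma clim_ext u v l : (forall n, u n = v n) -> clim u l -> clim v l.
Proof. by move=> /funext ->. Qed.
Lemma clim_near u v l N : (forall n, (N <= n)%N -> u n = v n) -> clim u l -> clim v l.
Proof.
move=> h /climP hu; apply/climP => e /hu [M hM]; exists (maxn N M) => n.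
by rewrite geq_max => /andP[n1 n2]; rewrite -h // hM.
Qed.
Lemma clim_sub u l (k : nat -> nat) : (forall n, (n <= k n)%N) ->
  clim u l -> clim (fun n => u (k n)) l.
Proof.
move=> h /climP hu; apply/climP => e /hu [M hM]; exists M => n nM.
by apply: hM; apply: leq_trans (h n).
Qed.
Lemma clim_shift u l k : clim u l -> clim (fun n => u (n + k)%N) l.
Proof. by apply: clim_sub => n; rewrite leq_addr. Qed.
Lemma clim_unshift u l k : clim (fun n => u (n + k)%N) l -> clim u l.
Proof.
move=> /climP hu; apply/climP => e /hu [M hM]; exists (M + k)%N => n nM.
have -> : n = (n - k + k)%N by rewrite subnK // (leq_trans _ nM) // leq_addl.
by apply: hM; lia.
Qed.
Lemma clim_sum (I : Type) (r : seq I) (F : I -> nat -> C) (L : I -> C) :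
  (forall i, clim (F i) (L i)) ->
  clim (fun n => \sum_(i <- r) F i n) (\sum_(i <- r) L i).
Proof.
move=> h; elim: r => [|i r ih].
  by rewrite big_nil; under eq_fun do rewrite big_nil; exact: clim_cst.
by rewrite big_cons; under eq_fun do rewrite big_cons; apply: climD.
Qed.
Lemma clim_le u l (B : R) : clim u l -> (exists N, forall n, (N <= n)%N -> nm (u n) <= B) -> nm l <= B.
Proof.
move=> /climP h [N hB]; apply/ler_addgt0Pr => e e0.
have [M hM] := h _ e0.
have {}hB := hB _ (leq_maxl N M); have {}hM := hM _ (leq_maxr N M).
rewrite -[l](subrK (u (maxn N M))) (le_trans (nmD _ _)) // addrC lerD //.
by rewrite nmB ltW.
Qed.
(** Most concrete limits below are established by such an explicit rate. *)
Lemma clim_inv (K : R) u l : (forall n, nm (u n - l) <= K / n.+1%:R) -> clim u l.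
Proof.
move=> h; apply/climP => e e0.
have K0 : 0 <= K by have := le_trans (nm_ge0 _) (h 0%N); rewrite divr1.
have [N hN] : exists N : nat, K / e < N%:R.
  by exists (Num.bound (K / e)); rewrite archi_boundP // divr_ge0 // ltW.
exists N => n Nn; apply: le_lt_trans (h n) _.
rewrite ltr_pdivrMr ?ltr0n // mulrC -ltr_pdivrMr //.
by apply: lt_le_trans hN _; rewrite ler_nat leqW.
Qed.

Lemma real_clim (x : nat -> R) (B : R) :
  (forall n, x n <= x n.+1) -> (forall n, x n <= B) ->
  exists l : R, x @ \oo --> l /\ l <= B /\ forall n, x n <= l.
Proof.
move=> h1 h2.
have nd : {homo x : n m / (n <= m)%N >-> n <= m} by apply/nondecreasing_seqP.
have ub : has_ubound (range x) by exists B => _ [n _ <-].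
have c := nondecreasing_is_cvgn nd ub.
exists (limn x); split=> //; split; last exact: nondecreasing_cvgn_le.
by apply: limr_le => //; apply: nearW.
Qed.

Lemma tail_small (b : nat -> R) (B : R) : (forall i, 0 <= b i) ->
  (forall n, \sum_(i < n) b i <= B) ->
  forall e, 0 < e -> exists N, forall n m, (N <= n)%N -> (n <= m)%N ->
    \sum_(n <= i < m) b i < e.
Proof.
move=> b0 hB e e0.
have [|l [hl [_ lb]]] := @real_clim (fun n => \sum_(i < n) b i) B _ hB.
  by move=> n; rewrite big_ord_recr lerDl.
have /cvgrPdist_lt /(_ _ e0) [N _ hN] := hl.
exists N => n m Nn nm_; have := hN n Nn; rewrite /= ger0_norm ?subr_ge0 ?lb //.
have := lb m; rewrite -!(big_mkord xpredT) (@big_cat_nat _ _ _ n 0%N m) //=; lra.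
Qed.

(** * Series as limits of partial sums: domination and interchange *)

Definition csum a s := clim (fun n => \sum_(i < n) a i) s.

Lemma csum_unique a s t : csum a s -> csum a t -> s = t.
Proof. exact: clim_unique. Qed.
Lemma csum_ext a b s : (forall i, a i = b i) -> csum a s -> csum b s.
Proof. by move=> /funext ->. Qed.
Lemma csumD a b s t : csum a s -> csum b t -> csum (fun i => a i + b i) (s + t).
Proof. by move=> h1 h2; have := climD h1 h2; apply: clim_ext => n; rewrite big_split. Qed.
Lemma csumZ c a s : csum a s -> csum (fun i => c * a i) (c * s).
Proof. by move=> h1; have := @climZ c _ _ h1; apply: clim_ext => n; rewrite mulr_sumr. Qed.
Lemma csumN a s : csum a s -> csum (fun i => - a i) (- s).
Proof. by move=> h1; have := climN h1; apply: clim_ext => n; rewrite sumrN. Qed.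
Lemma csumB a b s t : csum a s -> csum b t -> csum (fun i => a i - b i) (s - t).
Proof. by move=> h1 /csumN; apply: csumD. Qed.
Lemma csum_finite a N : (forall i, (N <= i)%N -> a i = 0) -> csum a (\sum_(i < N) a i).
Proof.
move=> h; apply: (@clim_near (fun=> \sum_(i < N) a i) _ _ N); last exact: clim_cst.
move=> n Nn; rewrite -!(big_mkord xpredT) [RHS](@big_cat_nat _ _ _ N) //=.
by rewrite [X in _ + X]big_nat [X in _ + X]big1 ?addr0 // => i /andP[/h].
Qed.
Lemma csum_le a s (b : nat -> R) B : csum a s -> (forall i, nm (a i) <= b i) ->
  (forall n, \sum_(i < n) b i <= B) -> nm s <= B.
Proof.
move=> h ab bB; apply: clim_le h _; exists 0%N => n _.
by apply: le_trans (nm_sum _ _ _) _; apply: le_trans (bB n); apply: ler_sum.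
Qed.

Lemma clim_ReIm u l : (fun n => complex.Re (u n)) @ \oo --> complex.Re l ->
  (fun n => complex.Im (u n)) @ \oo --> complex.Im l -> clim u l.
Proof.
move=> /cvgrPdist_lt h1 /cvgrPdist_lt h2; apply/climP => e e0.
have e2 : 0 < e / 2 by rewrite divr_gt0.
have [N _ hN] := h1 _ e2; have [M _ hM] := h2 _ e2.
exists (maxn N M) => n; rewrite geq_max => /andP[/hN /= k1 /hM /= k2].
apply: le_lt_trans (nm_le_ReIm _) _; rewrite [e]splitr ltrD //.
  by move: k1; rewrite distrC; rewrite raddfB.
by move: k2; rewrite distrC; rewrite raddfB.
Qed.

Lemma Re_sum (I : Type) (r : seq I) (P : pred I) (F : I -> C) :
  complex.Re (\sum_(i <- r | P i) F i) = \sum_(i <- r | P i) complex.Re (F i).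
Proof. by apply: (big_morph (@complex.Re R)) => // -[? ?] []. Qed.
Lemma Im_sum (I : Type) (r : seq I) (P : pred I) (F : I -> C) :
  complex.Im (\sum_(i <- r | P i) F i) = \sum_(i <- r | P i) complex.Im (F i).
Proof. by apply: (big_morph (@complex.Im R)) => // -[? ?] []. Qed.

Lemma real_series_cvg (x b : nat -> R) (B : R) : (forall i, `|x i| <= b i) ->
  (forall n, \sum_(i < n) b i <= B) -> exists l : R, (fun n => \sum_(i < n) x i) @ \oo --> l.
Proof.
move=> xb hB.
(* The terms [x + b] are nonnegative, so their partial sums increase; subtracting those of [b]
   recovers the series of [x]. *)
have [|n|l [hl _]] := @real_clim (fun n => \sum_(i < n) (x i + b i)) (B + B).
- move=> n; rewrite big_ord_recr lerDl.
  by have := xb n; rewrite ler_norml => /andP[]; lra.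
- rewrite big_split lerD // (le_trans _ (hB n)) //; apply: ler_sum => i _.
  by apply: le_trans (xb i); rewrite ler_norm.
have [|l' [hl' _]] := @real_clim (fun n => \sum_(i < n) b i) B _ hB.
  by move=> n; rewrite big_ord_recr lerDl (le_trans _ (xb n)).
exists (l - l').
rewrite (_ : (fun n => _) = (fun n => \sum_(i < n) (x i + b i)) - (fun n => \sum_(i < n) b i)).
  exact: cvgB.
by apply/funext => n; rewrite fctE big_split addrK.
Qed.

Lemma csum_abs a (b : nat -> R) B : (forall i, nm (a i) <= b i) ->
  (forall n, \sum_(i < n) b i <= B) -> exists s, csum a s.
Proof.
move=> ab hB.
have [i|l hl] := @real_series_cvg (fun i => complex.Re (a i)) b B _ hB.
  exact: le_trans (Re_le_nm _) (ab i).
have [i|l' hl'] := @real_series_cvg (fun i => complex.Im (a i)) b B _ hB.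
  exact: le_trans (Im_le_nm _) (ab i).
exists (l +i* l'); apply: clim_ReIm => /=.
  by under eq_cvg => n do rewrite /= Re_sum.
by under eq_cvg => n do rewrite /= Im_sum.
Qed.

Lemma csum_tail a s (b : nat -> R) (e : R) N : csum a s -> (forall i, nm (a i) <= b i) ->
  (forall m, (N <= m)%N -> \sum_(N <= i < m) b i <= e) -> nm (s - \sum_(i < N) a i) <= e.
Proof.
move=> h ab hb.
have h2 := climB h (@clim_cst (\sum_(i < N) a i)).
apply: clim_le h2 _; exists N => m Nm.
rewrite -!(big_mkord xpredT) (@big_cat_nat _ _ _ N) //= addrAC subrr add0r.
by apply: le_trans (nm_sum _ _ _) _; apply: le_trans (hb m Nm); apply: ler_sum.
Qed.

(** Dominated convergence for series: past some [N] all tails are below e/3 uniformly in n because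
    [b] dominates, and the remaining head is a finite sum of limits. *)
Lemma tannery (a : nat -> nat -> C) (l S : nat -> C) s (b : nat -> R) B :
  (forall n i, nm (a n i) <= b i) -> (forall n, \sum_(i < n) b i <= B) ->
  (forall i, clim (fun n => a n i) (l i)) ->
  (forall n, csum (a n) (S n)) -> csum l s -> clim S s.
Proof.
move=> ab hB al aS ls; apply/climP => e e0.
have lb i : nm (l i) <= b i.
  by apply: clim_le (al i) _; exists 0%N => n _; exact: ab.
have b0 i : 0 <= b i by apply: le_trans (lb i); exact: nm_ge0.
have e3 : 0 < e / 3 by rewrite divr_gt0.
have [N hN] := tail_small b0 hB e3.
have {}hN m : (N <= m)%N -> \sum_(N <= i < m) b i <= e / 3 by move=> ?; rewrite ltW // hN.
have t1 := csum_tail ls lb hN.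
have t2 n := csum_tail (aS n) (ab n) hN.
have : clim (fun n => \sum_(i < N) a n i) (\sum_(i < N) l i) by exact: clim_sum.
move=> /climP /(_ _ e3) [M hM]; exists M => n /hM hn.
rewrite (_ : S n - s = (S n - \sum_(i < N) a n i) + (\sum_(i < N) a n i - \sum_(i < N) l i)
   - (s - \sum_(i < N) l i)); last by ring.
apply: le_lt_trans (nmD _ _) _; rewrite nmN.
apply: le_lt_trans (lerD (nmD _ _) (lexx _)) _.
have := t2 n; lra.
Qed.

(** The sums over the first n columns tend, row by row, to [r i] and are dominated by [b i];
    Tannery's theorem with n as parameter gives the interchange. *)
Lemma fubini (a : nat -> nat -> C) (r c : nat -> C) (b : nat -> R) B :
  (forall i n, \sum_(j < n) nm (a i j) <= b i) -> (forall n, \sum_(i < n) b i <= B) ->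
  (forall i, csum (a i) (r i)) -> (forall j, csum (a ^~ j) (c j)) ->
  exists s, csum r s /\ csum c s.
Proof.
move=> ab hB ar ac.
have rb i : nm (r i) <= b i by apply: csum_le (ar i) (fun j => lexx _) (ab i).
have [s hs] := csum_abs rb hB; exists s; split=> //.
apply: (@tannery (fun n i => \sum_(j < n) a i j) r _ s b B _ hB ar _ hs).
  by move=> n i; apply: le_trans (ab i n); exact: nm_sum.
move=> n; apply: (@clim_ext (fun m => \sum_(j < n) \sum_(i < m) a i j)).
  by move=> m; rewrite exchange_big.
by apply: clim_sum => j; exact: ac.
Qed.

End ComplexLimits.

(** * The exponential e(z) *)

Section Trig.
Variable R : realType.
Local Notation C := R[i].
Implicit Types (x y : R) (z w : C).

Lemma sin_mvt x : 0 <= x -> exists2 xi, 0 <= xi <= x & sin x = x * cos xi.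
Proof.
rewrite le_eqVlt => /predU1P[<-|x0]; first by exists 0; rewrite ?lexx // sin0 mul0r.
have [|xi] := @MVT R sin cos 0 x x0 (fun y _ => is_derive_sin y).
  by apply: continuous_subspaceT => y; exact: continuous_sin.
rewrite in_itv /= => /andP[h1 h2]; rewrite sin0 !subr0 => h; exists xi; last by rewrite h mulrC.
by rewrite !ltW.
Qed.

Lemma norm_sin_le x : `|sin x| <= `|x|.
Proof.
wlog x0 : x / 0 <= x => [hw|].
  have [/hw//|/ltW h] := leP 0 x.
  by rewrite -normrN -sinN -[`|x|]normrN hw // oppr_ge0.
have [xi _ ->] := sin_mvt x0; rewrite normrM ler_piMr //.
exact: cos_max.
Qed.

Lemma cos_ge_sqr x : 1 - cos x <= x ^+ 2 / 2.
Proof.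
have -> : cos x = 1 - 2 * sin (x / 2) ^+ 2.
  by rewrite {1}[x](_ : x = (x / 2) *+ 2) ?cos_mulr2n ?cos2sin2; [ring|rewrite mulr2n -splitr].
have : sin (x / 2) ^+ 2 <= (x / 2) ^+ 2.
  rewrite -[X in X <= _]real_normK ?num_real // -[leRHS]real_normK ?num_real //.
  by rewrite lerXn2r ?nnegrE // norm_sin_le.
lra.
Qed.

Lemma sin_approx x : `|sin x - x| <= `|x| * x ^+ 2.
Proof.
wlog x0 : x / 0 <= x => [hw|].
  have [/hw//|/ltW h] := leP 0 x.
  by have := hw (- x); rewrite sinN oppr_ge0 -opprD !normrN sqrrN => ->.
have [xi /andP[xi0 xix] ->] := sin_mvt x0.
rewrite -[X in _ - X]mulr1 -mulrBr normrM ler_wpM2l // distrC ger0_norm ?subr_ge0 ?cos_le1 //.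
apply: le_trans (cos_ge_sqr _) _.
have : xi ^+ 2 <= x ^+ 2 by rewrite lerXn2r ?nnegrE.
have := sqr_ge0 xi; lra.
Qed.

Lemma expR_approx x : `|x| <= 2^-1 -> `|expR x - 1 - x| <= 2 * x ^+ 2.
Proof.
rewrite ler_norml => /andP[h1 h2].
have e1 := expR_ge1Dx x; have e2 := expR_ge1Dx (- x).
rewrite ger0_norm; last by lra.
have := ler_wpM2l (expR_ge0 x) e2; rewrite expRxMexpNx_1.
nra.
Qed.

Lemma expR_le2 x : x <= 2^-1 -> expR x <= 2.
Proof.
move=> h; have e2 := expR_ge1Dx (- x).
have := ler_wpM2l (expR_ge0 x) e2; rewrite expRxMexpNx_1.
have := expR_gt0 x; nra.
Qed.

Lemma cexp0 : cexp (0 : C) = 1.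
Proof. by rewrite /cexp /= expR0 cos0 sin0 mul1r. Qed.

Lemma cexpD z w : cexp (z + w) = cexp z * cexp w.
Proof.
case: z w => [a b] [c d]; rewrite /cexp /= expRD cosD sinD; simpc.
by congr (_ +i* _); ring.
Qed.

Lemma cexpN z : cexp (- z) = (cexp z)^-1.
Proof.
have h : cexp z * cexp (- z) = 1 by rewrite -cexpD subrr cexp0.
apply: (@mulfI _ (cexp z)); first by apply/eqP => h0; move/eqP: h; rewrite h0 mul0r eq_sym oner_eq0.
rewrite h divff //; apply/eqP => h0; move/eqP: h; rewrite h0 mul0r eq_sym oner_eq0 //.
Qed.

Lemma nm_cexp z : nm (cexp z) = expR (complex.Re z).
Proof.
rewrite /cexp nmM nmR ger0_norm ?expR_ge0 // /nm /= cos2Dsin2 sqrtr1 mulr1 //.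
Qed.

Lemma cexp_neq0 z : cexp z != 0.
Proof. by rewrite -nm_gt0 nm_cexp expR_gt0. Qed.

Lemma cexp_approx z : nm z <= 2^-1 -> nm (cexp z - 1 - z) <= 4 * nm z ^+ 2.
Proof.
move=> hz; rewrite nm_sqr; apply: le_trans (nm_le_ReIm _) _.
have hx := le_trans (Re_le_nm z) hz; have hy := le_trans (Im_le_nm z) hz.
have := hx; have := hy; have := expR_approx hx; have := sin_approx (complex.Im z).
have := cos_ge_sqr (complex.Im z); have := cos_le1 (complex.Im z).
have := @expR_le2 (complex.Re z) (le_trans (ler_norm _) hx).
have := expR_ge0 (complex.Re z).
move: {hx hy hz} z => [x y]; rewrite /cexp /= !mul0r !subr0 !addr0.
set E := expR x => E0 E2 c1 c2 s1 e1 ny nx.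
(* Each part is split into the error of the real exponential and that of cosine or sine, all of them
   quadratic in x and y. *)
have -> : E * cos y - 1 - x = (E - 1 - x) + E * (cos y - 1) by ring.
have -> : E * sin y - y = E * (sin y - y) + (E - 1) * y by ring.
have hE : `|E - 1| <= 2 * `|x|.
  rewrite -[E - 1](subrK x); apply: le_trans (ler_normD _ _) _.
  have : 2 * x ^+ 2 <= `|x| by rewrite -(@real_normK _ x) ?num_real //; have := normr_ge0 x; nra.
  move: e1; lra.
have b1 : `|E * (cos y - 1)| <= y ^+ 2.
  rewrite normrM (ger0_norm E0) distrC ger0_norm ?subr_ge0 //; nra.
have b2 : `|E * (sin y - y)| <= y ^+ 2.
  rewrite normrM (ger0_norm E0).
  have : `|y| * y ^+ 2 <= y ^+ 2 / 2 by rewrite mulrC ler_wpM2l ?sqr_ge0.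
  have := normr_ge0 (sin y - y); nra.
have b3 : `|(E - 1) * y| <= x ^+ 2 + y ^+ 2.
  rewrite normrM -[x ^+ 2]real_normK ?num_real // -[y ^+ 2]real_normK ?num_real //.
  have := normr_ge0 x; have := normr_ge0 y; have := normr_ge0 (E - 1).
  have := sqr_ge0 (`|x| - `|y|); nra.
have := ler_normD (E - 1 - x) (E * (cos y - 1)); have := ler_normD (E * (sin y - y)) ((E - 1) * y).
have := sqr_ge0 x; have := sqr_ge0 y; lra.
Qed.

Definition qe z : C := qexp 1 z.

Lemma qexpE m z : qexp m z = qe z ^+ m.
Proof.
rewrite /qe /qexp; elim: m => [|m ih]; first by rewrite mulr0 mul0r cexp0 expr0.
by rewrite exprS -ih -cexpD; congr cexp; rewrite -addn1 natrD; ring.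
Qed.
Lemma qeE z : qe z = cexp ((2 * pi)%:C * 'i%C * z).
Proof. by rewrite /qe /qexp mulr1. Qed.
Lemma qeD z w : qe (z + w) = qe z * qe w.
Proof. by rewrite !qeE -cexpD mulrDr. Qed.
Lemma qe0 : qe 0 = 1.
Proof. by rewrite qeE mulr0 cexp0. Qed.
Lemma qe1 : qe 1 = 1.
Proof.
rewrite qeE mulr1 /cexp; simpc; rewrite /= expR0 mul1r.
by rewrite (_ : 2 * pi = pi *+ 2) ?mulr_natl // cos2pi sin2pi mulr0.
Qed.
Lemma qeD1 z : qe (z + 1) = qe z.
Proof. by rewrite qeD qe1 mulr1. Qed.
Lemma qeMn (n : nat) z : qe (n%:R * z) = qe z ^+ n.
Proof. by rewrite -qexpE /qe /qexp; congr cexp; ring. Qed.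
Lemma qe_neq0 z : qe z != 0.
Proof. by rewrite qeE cexp_neq0. Qed.
Lemma nm_qe z : nm (qe z) = expR (- (2 * pi * complex.Im z)).
Proof. by rewrite qeE nm_cexp; case: z => x y; simpc; congr expR; rewrite /=; ring. Qed.
Lemma nm_qe_lt1 z : 0 < complex.Im z -> nm (qe z) < 1.
Proof. by move=> h; rewrite nm_qe expR_lt1 oppr_lt0 !mulr_gt0 // pi_gt0. Qed.
Lemma nm_qe_le1 z : 0 <= complex.Im z -> nm (qe z) <= 1.
Proof. by move=> h; rewrite nm_qe expR_le1 oppr_le0 !mulr_ge0 // pi_ge0. Qed.
Lemma qe_neq1 z : 0 < complex.Im z -> 1 - qe z != 0.
Proof.
move=> /nm_qe_lt1 h; rewrite subr_eq0; apply/eqP => h1; move: h.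
by rewrite -h1 nm1 ltxx.
Qed.

Lemma pi_lt4 : pi < 4 :> R.
Proof. by have := @pihalf_lt2 R; lra. Qed.

Lemma qe_approx z : nm z <= 16^-1 ->
  nm (qe z - 1 - (2 * pi)%:C * 'i%C * z) <= 256 * nm z ^+ 2.
Proof.
move=> h; rewrite qeE; have p4 := pi_lt4; have p0 := @pi_gt0 R.
have e : nm ((2 * pi)%:C * 'i%C * z) = 2 * pi * nm z.
  by rewrite !nmM nmi mulr1 nmR ger0_norm // mulr_ge0 ?pi_ge0.
have n0 := nm_ge0 z.
apply: le_trans (cexp_approx _) _; rewrite e; first by nra.
rewrite exprMn mulrA ler_wpM2r ?sqr_ge0 //; nra.
Qed.

(** With w = u + iv and r = exp(-2 pi v), |1 - e(w)|^2 = (1 - r)^2 + 4 r sin^2(pi u), and the two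
    terms dominate multiples of v^2 and u^2. The zeros of 1 - e(w) are the integers; |u| <= 3/4
    stays away from all but 0. *)
Lemma one_sub_qe_lower : exists2 c : R, 0 < c & forall w, `|complex.Re w| <= 3 / 4 ->
  0 <= complex.Im w <= 1 -> c * nm w <= nm (1 - qe w).
Proof.
have p0 := @pi_gt0 R; have p2 := @pi_ge2 R.
(* On [0, 3 pi/8] the cosine is at least [k]; sin(pi u) = 2 sin(pi u/2) cos(pi u/2) reduces the sine
   to this range. *)
pose k : R := cos (3 * pi / 8).
have k0 : 0 < k by apply: cos_gt0_pihalf; lra.
pose r0 : R := expR (- (2 * pi)).
have r00 : 0 < r0 by exact: expR_gt0.
have sinb u : 0 <= u <= 3 / 4 -> pi * u * k ^+ 2 <= sin (pi * u).
  move=> /andP[u0 u1].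
  have hu : 0 <= pi * u / 2 by rewrite divr_ge0 // mulr_ge0 // ltW.
  have hu2 : pi * u / 2 <= 3 * pi / 8 by nra.
  have kc t : 0 <= t -> t <= pi * u / 2 -> k <= cos t.
    move=> t0 t1; rewrite leNgt ltr_cos ?in_itv /= -?leNgt; [|apply/andP; split..]; lra.
  have [xi /andP[xi0 xi1] hs] := sin_mvt hu.
  have -> : sin (pi * u) = cos (pi * u / 2) * sin (pi * u / 2) * 2.
    by rewrite {1}[pi * u](_ : _ = (pi * u / 2) *+ 2) ?sin_mulr2n ?mulr_natr // mulr2n -splitr.
  rewrite hs.
  have h1 := kc _ xi0 xi1; have h2 := kc _ hu (lexx _).
  have : k ^+ 2 <= cos (pi * u / 2) * cos xi.
    by rewrite expr2 ler_pM // ltW.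
  nra.
have sinb2 u : `|u| <= 3 / 4 -> (pi * k ^+ 2) ^+ 2 * u ^+ 2 <= sin (pi * u) ^+ 2.
  move=> hu; have : pi * `|u| * k ^+ 2 <= sin (pi * `|u|) by apply: sinb; rewrite normr_ge0.
  have ks : 0 <= pi * `|u| * k ^+ 2 by rewrite mulr_ge0 ?sqr_ge0 // mulr_ge0 ?pi_ge0.
  move=> h; have : (pi * `|u| * k ^+ 2) ^+ 2 <= sin (pi * `|u|) ^+ 2.
    by rewrite lerXn2r // nnegrE (le_trans ks).
  have -> : sin (pi * `|u|) ^+ 2 = sin (pi * u) ^+ 2.
    by have [?|?] := ler0P u; rewrite // mulrN sinN sqrrN.
  by rewrite !exprMn real_normK ?num_real // => ?; rewrite mulrAC.
pose d := r0 * Num.min 1 (pi * k ^+ 2).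
have d0 : 0 < d by rewrite mulr_gt0 // lt_min ltr01 mulr_gt0 // exprn_gt0.
exists d => // w hu /andP[v0 v1].
rewrite -(ler_pXn2r (n := 2)) ?nnegrE ?nm_ge0 ?(mulr_ge0 (ltW d0) (nm_ge0 _)) //.
rewrite exprMn !nm_sqr qeE /cexp; move: hu v0 v1; case: w => u v /= hu v0 v1.
rewrite !(mul0r, mulr0, mulr1, subr0, addr0, oppr0, add0r, sub0r).
set r := expR _.
have -> : 2 * pi * u = (pi * u) *+ 2 by rewrite -mulr_natr; ring.
have rE : r = expR (- (2 * pi * v)) by rewrite /r; congr expR; ring.
have r1 : r0 <= r by rewrite rE ler_expR lerN2; nra.
have r1' : r <= 1 by rewrite rE expR_le1 oppr_le0 !mulr_ge0 // ltW.
have h3 : r0 * v <= 1 - r.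
  have := expR_ge1Dx (2 * pi * v).
  have : r * expR (2 * pi * v) = 1 by rewrite rE mulrC expRxMexpNx_1.
  set e := expR _ => h1 h2; have : r * (e - 1) >= r0 * v.
    apply: ler_pM; rewrite ?(ltW r00) //; nra.
  nra.
have h4 := sinb2 u hu.
rewrite cos_mulr2n sin_mulr2n !mulr2n.
have := cos2Dsin2 (pi * u); move: h4; set c := cos _; set s := sin _ => h4 cs.
have -> : (1 - r * (c ^+ 2 + c ^+ 2 - 1)) ^+ 2 + (- (r * (c * s + c * s))) ^+ 2
  = (1 - r) ^+ 2 + 4 * r * s ^+ 2.
  have -> : s ^+ 2 = 1 - c ^+ 2 by rewrite -cs addrAC subrr add0r.
  have -> : (- (r * (c * s + c * s))) ^+ 2 = 4 * r ^+ 2 * c ^+ 2 * s ^+ 2 by ring.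
  by have -> : s ^+ 2 = 1 - c ^+ 2 by [rewrite -cs addrAC subrr add0r]; ring.
have m1 : d <= r0 by rewrite /d ler_piMr ?(ltW r00) // ge_min lexx.
have m2 : d <= r0 * (pi * k ^+ 2) by rewrite /d ler_wpM2l ?(ltW r00) // ge_min lexx orbT.
have r01 : r0 <= 1 by apply: le_trans r1 r1'.
rewrite mulrDr addrC lerD //.
  rewrite -exprMn lerXn2r ?nnegrE ?(mulr_ge0 (ltW d0) v0) ?subr_ge0 //.
  by apply: le_trans h3; rewrite ler_wpM2r.
apply: (@le_trans _ _ (r0 ^+ 2 * ((pi * k ^+ 2) ^+ 2 * u ^+ 2))).
  rewrite mulrA -(exprMn 2 r0) ler_wpM2r ?sqr_ge0 // lerXn2r ?nnegrE ?(ltW d0) //.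
  exact: le_trans (ltW d0) m2.
apply: ler_pM => //; rewrite ?sqr_ge0 ?(mulr_ge0 (sqr_ge0 _) (sqr_ge0 _)) //.
have := sqr_ge0 r0; rewrite expr2; nra.
Qed.

(** Im z keeps |z + x| away from 0, and |x| <= |z + x| + |z| gives linear growth. *)
Lemma shift_lower z : 0 < complex.Im z -> exists2 c : R, 0 < c &
  forall x : R, c * (1 + `|x|) <= nm (z + x%:C).
Proof.
move=> y0; pose y := complex.Im z; exists (1 + (1 + nm z) / y)^-1.
  by rewrite invr_gt0 addr_gt0 // divr_gt0 // ltr_wpDr // nm_ge0.
move=> x.
have h0 : 0 < 1 + (1 + nm z) / y by rewrite addr_gt0 // divr_gt0 // ltr_wpDr // nm_ge0.
rewrite mulrC ler_pdivrMr //.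
have h1 : y <= nm (z + x%:C).
  apply: le_trans (Im_le_nm _); rewrite raddfD /= addr0; exact: ler_norm.
have h2 : `|x| <= nm (z + x%:C) + nm z.
  by have := nmBr (z + x%:C) z; have := nmD (z + x%:C) (- z); rewrite nmN addrAC subrr add0r nmR.
rewrite mulrDr mulr1; apply: (@le_trans _ _ (nm (z + x%:C) + (1 + nm z))); first by lra.
rewrite lerD2l mulrCA -ler_pdivrMl ?divff //; last by rewrite ltr_wpDr ?nm_ge0.
  by rewrite mulVf ?ler_pdivlMr ?mul1r // gt_eqF // ltr_wpDr ?nm_ge0.
Qed.

Lemma lattice_lower z : 0 < complex.Im z -> exists2 c : R, 0 < c &
  forall (m : nat) (x : R), (0 < m)%N -> c * (m%:R + `|x|) <= nm (m%:R * z + x%:C).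
Proof.
move=> /shift_lower [c c0 h]; exists c => // m x m0.
have mR : (0 : R) < m%:R by rewrite ltr0n.
have := h (x / m%:R).
have -> : m%:R * z + x%:C = m%:R * (z + (x / m%:R)%:C).
  rewrite mulrDr; congr (_ + _); rewrite -(rmorph_nat (real_complex R)) -rmorphM /=.
  by rewrite mulrCA divff ?mulr1 // gt_eqF.
rewrite nmM nm_nat normrM normfV (ger0_norm (ltW mR)) => k.
have := ler_wpM2l (ltW mR) k; apply: le_trans.
by rewrite mulrCA ler_wpM2l ?(ltW c0) // mulrDr mulr1 mulrCA divff ?mulr1 // gt_eqF.
Qed.

(* 2^N (1 - e((z + x) / 2^N)), which tends to -2 pi i (z + x). *)
Definition dq (N : nat) z : C := 2 ^+ N * (1 - qe (z / 2 ^+ N)).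

Lemma dq_lim z : clim (fun N => dq N z) (- ((2 * pi)%:C * 'i%C * z)).
Proof.
have pw N : (N.+1%:R : R) <= 2 ^+ N by rewrite -natrX ler_nat ltn_expl.
have pn N : (2 ^+ N : C) != 0 by rewrite expf_neq0 // pnatr_eq0.
pose K := 256 * nm z ^+ 2.
have [N0 hN0] : exists N0 : nat, 16 * nm z < N0%:R.
  by exists (Num.bound (16 * nm z)); rewrite archi_boundP // mulr_ge0 // nm_ge0.
apply: (@clim_unshift _ _ _ N0); apply: (@clim_inv _ K) => N.
set M := (N + N0)%N.
have nmp : nm (2 ^+ M : C) = 2 ^+ M by rewrite nmX nm_nat.
have p0 : (0 : R) < 2 ^+ M by rewrite exprn_gt0.
have hz : nm (z / 2 ^+ M) <= 16^-1.
  rewrite nmM nmV nmp ler_pdivrMr // ler_pdivlMl //.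
  apply: le_trans (ltW hN0) _; apply: le_trans (pw M); rewrite ler_nat /M; lia.
have -> : dq M z - - ((2 * pi)%:C * 'i%C * z)
  = - 2 ^+ M * (qe (z / 2 ^+ M) - 1 - (2 * pi)%:C * 'i%C * (z / 2 ^+ M)).
  by rewrite /dq; field; exact: pn.
rewrite nmM nmN nmp; apply: le_trans (ler_wpM2l (ltW p0) (qe_approx hz)) _.
rewrite nmM nmV nmp exprMn /K.
have -> : 2 ^+ M * (256 * (nm z ^+ 2 * (2 ^+ M)^-1 ^+ 2)) = 256 * nm z ^+ 2 / 2 ^+ M.
  by field; rewrite gt_eqF.
rewrite -/K; have K0 : 0 <= K by rewrite mulr_ge0 ?ler0n ?sqr_ge0.
rewrite ler_wpM2l //.
rewrite lef_pV2 ?posrE ?ltr0n //.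
by apply: le_trans (pw M); rewrite ler_nat /M; lia.
Qed.

(** The bound uniform in N that Tannery's theorem needs: within half a period [one_sub_qe_lower]
    applies to (z + x) / 2^N. *)
Lemma dq_lower z : 0 < complex.Im z -> exists2 c : R, 0 < c & exists N0 : nat,
  forall N (x : R), (N0 <= N)%N -> `|x| <= 2 ^+ N / 2 -> c * (1 + `|x|) <= nm (dq N (z + x%:C)).
Proof.
move=> y0; have [c c0 hc] := shift_lower y0; have [d d0 hd] := one_sub_qe_lower.
exists (d * c); first exact: mulr_gt0.
pose B := 4 * nm z.
have B0 : 0 <= B by rewrite mulr_ge0 // nm_ge0.
(* From here on 4 |z| <= 2^N, so the real part of (z + x) / 2^N is at most 1/4 + 1/2 in absolute
   value. *)
exists (Num.bound B) => N x hN hx.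
have p0 : (0 : R) < 2 ^+ N by rewrite exprn_gt0.
have pB : B <= 2 ^+ N.
  apply: le_trans (ltW (archi_boundP B0)) _; rewrite -natrX ler_nat.
  by apply: leq_trans hN _; rewrite ltnW // ltn_expl.
have nmp : nm (2 ^+ N : C) = 2 ^+ N by rewrite nmX nm_nat.
have E : (z + x%:C) / 2 ^+ N = ((complex.Re z + x) / 2 ^+ N) +i* (complex.Im z / 2 ^+ N).
  have -> : (2 ^+ N : C) = (2 ^+ N)%:C by rewrite rmorphXn /= rmorph_nat.
  rewrite -fmorphV; case: (z) => a b; simpc; congr (_ +i* _); ring.
have := hd ((z + x%:C) / 2 ^+ N).
rewrite /dq (nmM (2 ^+ N)) nmp (nmM (z + x%:C)) nmV nmp {1 2 3}E /= normrM normfV (ger0_norm (ltW p0)).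
move=> hh; have [h1 h2] : `|complex.Re z + x| / 2 ^+ N <= 3 / 4 /\ 0 <= complex.Im z / 2 ^+ N <= 1; [split|have h := hh h1 h2].
- rewrite ler_pdivrMr //; apply: le_trans (ler_normD _ _) _.
  have := Re_le_nm z; rewrite /B in pB; lra.
- rewrite divr_ge0 ?(ltW p0) ?(ltW y0) //= ler_pdivrMr // mul1r.
  have := Im_le_nm z; have := ler_norm (complex.Im z); have := nm_ge0 z; rewrite /B in pB; lra.
have := ler_wpM2l (ltW p0) h; apply: le_trans.
have -> : 2 ^+ N * (d * (nm (z + x%:C) / 2 ^+ N)) = d * nm (z + x%:C) by field; rewrite gt_eqF.
by rewrite -mulrA ler_wpM2l ?(ltW d0).
Qed.

End Trig.

(** * Partial fractions *)

Section PartialFractions.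
Variable R : realType.
Local Notation C := R[i].
Implicit Types (z w : C).

Lemma inv_sqr_sum (n : nat) : \sum_(i < n) (i.+1%:R ^+ 2 : R)^-1 <= 2.
Proof.
(* Strengthened to a telescoping bound; as 0^-1 = 0, the step from n = 0 is treated apart. *)
suff : \sum_(i < n) (i.+1%:R ^+ 2 : R)^-1 <= 2 - n%:R^-1.
  by move=> h; apply: le_trans h _; rewrite gerBl invr_ge0.
elim: n => [|n ih]; first by rewrite big_ord0 invr0 subr0.
rewrite big_ord_recr /=; case: n ih => [|n] ih; first by rewrite big_ord0 add0r expr1n invr1; lra.
apply: le_trans (lerD ih (lexx _)) _; rewrite -addrA lerD2l -subr_ge0.
have n0 : (0 : R) < n.+1%:R by rewrite ltr0n.
have -> : - (n.+2%:R : R)^-1 - (- n.+1%:R^-1 + (n.+2%:R ^+ 2)^-1)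
  = (n.+1%:R * n.+2%:R ^+ 2)^-1.
  rewrite -[n.+2%:R]natr1; move: n0; move: (n.+1%:R : R) => x n0.
  have x1 : x + 1 != 0 by rewrite gt_eqF // addr_gt0.
  have x0 : x != 0 by rewrite gt_eqF.
  by field; rewrite x0 x1.
by rewrite invr_ge0 mulr_ge0 ?sqr_ge0 // ltW.
Qed.

Lemma bounded_inv_sqr (K : R) n : 0 <= K -> \sum_(i < n) K / i.+1%:R ^+ 2 <= K * 2.
Proof. by move=> K0; rewrite -mulr_sumr ler_wpM2l // inv_sqr_sum. Qed.

Lemma big_ord_double (F : nat -> C) n :
  \sum_(j < n.*2) F j = \sum_(i < n) (F i.*2 + F i.*2.+1).
Proof.
elim: n => [|n ih]; first by rewrite !big_ord0.
by rewrite doubleS !big_ord_recr /= ih addrA.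
Qed.

(** Over a period of length 2h the index 2h - i plays the role of -i: the indices 0 and h stay
    alone, the others pair up. *)
Lemma big_ord_fold (F G : nat -> C) h : (forall i, (i <= h)%N -> F (h.*2 - i)%N = G i) ->
  (0 < h)%N ->
  \sum_(j < h.*2) F j = F 0%N + F h + \sum_(i < h.-1) (F i.+1 + G i.+1).
Proof.
case: h => // h hFG _.
rewrite -addnn big_split_ord /= big_ord_recl [X in _ + X]big_ord_recl /= addn0 big_split /=.
have -> : \sum_(i < h) F (h.+1 + bump 0 i)%N = \sum_(i < h) G i.+1.
  rewrite (reindex_inj rev_ord_inj) /=; apply: eq_bigr => i _.
  rewrite -hFG; last by have := ltn_ord i; lia.
  by congr F; have := ltn_ord i; rewrite /bump; lia.
by rewrite /bump; ring.
Qed.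

Lemma Im_half z (x : R) N : 0 < complex.Im z -> 0 < complex.Im ((z + x%:C) / 2 ^+ N).
Proof.
move=> h; have -> : (2 ^+ N : C)^-1 = ((2 ^+ N)^-1)%:C by rewrite fmorphV rmorphXn /= rmorph_nat.
have : 0 < (2 ^+ N : R)^-1 by rewrite invr_gt0 exprn_gt0.
by move: h; case: z => a b; simpc => h k; rewrite /= mulr_gt0.
Qed.

Lemma pow2_neq0 N : (2 ^+ N : C) != 0.
Proof. by rewrite expf_neq0 // pnatr_eq0. Qed.

(** Splitting j by parity turns level N + 1 at z into level N at z/2 and at (z + 1)/2. *)
Lemma dupl_iter (Phi : C -> C) (k : nat) :
  (forall z, 0 < complex.Im z -> Phi (z / 2) + Phi ((z + 1) / 2) = 2 ^+ k * Phi z) ->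
  forall N z, 0 < complex.Im z ->
  \sum_(j < 2 ^ N) Phi ((z + j%:R) / 2 ^+ N) = 2 ^+ (k * N) * Phi z.
Proof.
move=> hd; elim=> [|N ih] z z0.
  by rewrite expn0 big_ord1 muln0 expr0 mul1r addr0 divr1.
rewrite expnS mul2n (big_ord_double (fun j => Phi ((z + j%:R) / 2 ^+ N.+1))) big_split /=.
have i1 : 0 < complex.Im (z / 2) by have := Im_half 0 1 z0; rewrite addr0 expr1.
have i2 : 0 < complex.Im ((z + 1) / 2) by have := Im_half 1 1 z0; rewrite expr1.
rewrite mulnS exprD -mulrA [RHS]mulrCA -hd // mulrDr -!ih //.
by congr (_ + _); apply: eq_bigr => j _; congr Phi; rewrite exprS invfM mulrA;
  congr (_ / _); rewrite -?natr1 -mul2n natrM; field.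
Qed.

Lemma pow2V_lim : clim (fun N => (2 ^+ N)^-1 : C) 0.
Proof.
apply: (@clim_inv _ 1) => N; rewrite subr0 nmV nmX nm_nat div1r.
by rewrite lef_pV2 ?posrE ?ltr0n ?exprn_gt0 // -natrX ler_nat ltn_expl.
Qed.

Lemma qe_lim w : clim (fun N => qe (w / 2 ^+ N)) 1.
Proof.
have := climB (@clim_cst _ 1) (climM pow2V_lim (dq_lim w)).
rewrite mul0r subr0; apply: clim_ext => N; rewrite /dq mulKf ?pow2_neq0 //.
by rewrite opprB addrC subrK.
Qed.

Lemma clim_bounded (u : nat -> C) l : clim u l -> exists N, forall n, (N <= n)%N -> nm (u n) <= nm l + 1.
Proof.
move=> /climP /(_ 1 ltr01) [N hN]; exists N => n /hN h.
rewrite -[u n](subrK l) addrC; apply: le_trans (nmD _ _) _; rewrite lerD2l; exact: ltW.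
Qed.

Section Expansion.
Variables (z : C) (z0 : 0 < complex.Im z).
Variables (Phi : C -> C) (k : nat) (kap : C) (L : nat -> C) (K : R) (N0 : nat).
Let A N (x : C) := (2 ^+ (k * N))^-1 * Phi ((z + x) / 2 ^+ N).
Hypothesis per : forall w, Phi (w + 1) = Phi w.
Hypothesis dup : forall w, 0 < complex.Im w -> Phi (w / 2) + Phi ((w + 1) / 2) = 2 ^+ k * Phi w.
Hypothesis lim0 : clim (fun N => A N 0) kap.
Hypothesis limh : clim (fun N => A N (2 ^ N.-1)%:R) 0.
Hypothesis limL : forall i, clim (fun N => A N i.+1%:R + A N (- i.+1%:R)) (L i).
Hypothesis bndL : forall N i, (N0 <= N)%N -> (i.+1 <= 2 ^ N.-1)%N ->
  nm (A N i.+1%:R + A N (- i.+1%:R)) <= K / i.+1%:R ^+ 2.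

(** [Phi z] is the normalised sum over the residues j mod 2^N, folded to -2^(N-1) < j <= 2^(N-1).
    The term j = 0 tends to [kap], the term j = 2^(N-1) to 0, and the pairs tend to [L] under the
    domination [bndL]. *)
Lemma periodic_expansion : csum L (Phi z - kap).
Proof.
have LK i : nm (L i) <= K / i.+1%:R ^+ 2.
  apply: clim_le (limL i) _; exists (N0 + i.+2)%N => n hn; apply: bndL; first by lia.
  apply: leq_trans (ltnW (ltn_expl n.-1 (ltnSn 1))); lia.
have K0 : 0 <= K by have := le_trans (nm_ge0 _) (LK 0%N); rewrite expr1n divr1.
have sK n := @bounded_inv_sqr K n K0.
have [s hs] := csum_abs LK sK.
suff -> : Phi z - kap = s by [].
(* At level N + 1 half a period is 2^N, which leaves the pairs 1, ..., 2^N - 1; extension by 0 makes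
   the rows infinite. *)
pose a N i := if (i < (2 ^ N).-1)%N then A N.+1 i.+1%:R + A N.+1 (- i.+1%:R) else 0.
have h1 : clim (fun N => \sum_(i < (2 ^ (N + N0)).-1) (A (N + N0).+1 i.+1%:R + A (N + N0).+1 (- i.+1%:R))) s.
  apply: (@tannery _ (fun N i => a (N + N0)%N i) L _ s (fun i => K / i.+1%:R ^+ 2) _ _ sK _ _ hs).
  - move=> n i; rewrite /a; case: ifP => hi; last by rewrite nm0 divr_ge0 // sqr_ge0.
    by apply: bndL => /=; lia.
  - move=> i; apply: (@clim_near _ (fun n => A (n + N0).+1 i.+1%:R + A (n + N0).+1 (- i.+1%:R)) _ _ i.+2).
      move=> n hn; rewrite /a ifT //.
      have : (n + N0 < 2 ^ (n + N0))%N by exact: ltn_expl.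
      lia.
    have := clim_shift N0.+1 (limL i); apply: clim_ext => n; by rewrite addnS.
  - move=> n; have := @csum_finite _ (a (n + N0)%N) (2 ^ (n + N0)).-1.
    rewrite (eq_bigr (fun i : 'I__ => A (n + N0).+1 i.+1%:R + A (n + N0).+1 (- i.+1%:R))).
      by apply => i hi; rewrite /a ifF //; lia.
    by move=> i _; rewrite /a ltn_ord.
apply: clim_unique h1.
have := climB (climB (@clim_cst _ (Phi z)) (clim_shift N0.+1 lim0)) (clim_shift N0.+1 limh).
rewrite subr0; apply: clim_ext => n; rewrite addnS /=.
set M := (n + N0)%N.
have := dupl_iter dup M.+1 z0.
rewrite expnS mul2n (@big_ord_fold (fun j => Phi ((z + j%:R) / 2 ^+ M.+1))
  (fun j => Phi ((z - j%:R) / 2 ^+ M.+1))) ?expn_gt0 //; last first.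
  move=> i hi; rewrite -[RHS]per; congr Phi; rewrite natrB; last by lia.
  rewrite -mul2n -expnS natrX; field; exact: pow2_neq0.
move=> /(congr1 (fun t => (2 ^+ (k * M.+1))^-1 * t)); rewrite mulKf ?pow2_neq0 // => <-.
rewrite !mulrDr mulr_sumr /A; under [RHS]eq_bigr do rewrite -mulrDr.
by ring.
Qed.

End Expansion.

(** * Expansions of the cotangent and its derivatives *)

Section Z.
Variables (z : C) (z0 : 0 < complex.Im z).
Local Notation c := ((2 * pi)%:C * 'i%C : C).

(** [Cf] is i cot(pi w) and [Xf] is -1/(4 sin^2(pi w)). With q = e(w), [Xf] and [Yf] are the sums of
    m q^m and of m^3 q^m; the duplication formulas express that averaging over the two square roots
    of q keeps the even m. *)
Definition Xf w := qe w / (1 - qe w) ^+ 2.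
Definition Yf w := 6 * Xf w ^+ 2 + Xf w.
Definition Cf w := (1 + qe w) / (1 - qe w).

Lemma c_neq0 : c != 0.
Proof. by rewrite -nm_gt0 nmM nmi mulr1 nmR normr_gt0 mulf_neq0 // gt_eqF // pi_gt0. Qed.

Lemma qe_half w : qe w = qe (w / 2) ^+ 2 /\ qe ((w + 1) / 2) = - qe (w / 2).
Proof.
have e1 : qe w = qe (w / 2) ^+ 2 by rewrite -qeMn mulrC divfK // pnatr_eq0.
split=> //; rewrite mulrDl qeD (_ : qe (1 / 2) = -1) ?mulrN1 //.
rewrite qeE /cexp mul1r.
have -> : c / 2 = 0 +i* pi.
  have -> : (2 : C)^-1 = (2^-1)%:C by rewrite fmorphV /= rmorph_nat.
  by simpc; congr (_ +i* _); field.
by rewrite /= expR0 cospi sinpi mul1r; apply/eqP; rewrite eq_complex /= oppr0 !eqxx.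
Qed.

Lemma half_neq w : 0 < complex.Im w -> (1 - qe (w / 2) != 0) /\ (1 + qe (w / 2) != 0).
Proof.
move=> w0; have i1 := Im_half 0 1 w0; have i2 := Im_half 1 1 w0; split.
  by have := qe_neq1 i1; rewrite addr0 expr1.
by have := qe_neq1 i2; rewrite expr1 (qe_half w).2 opprK.
Qed.

Lemma Xf_dup w : 0 < complex.Im w -> Xf (w / 2) + Xf ((w + 1) / 2) = 2 ^+ 2 * Xf w.
Proof.
move=> w0; rewrite /Xf; have [-> ->] := qe_half w; have [] := half_neq w0.
set v := qe _ => h1 h2; field; rewrite opprK h1 h2 (_ : 1 - v ^+ 2 = (1 - v) * (1 + v)) ?mulf_neq0 //.
by ring.
Qed.

Lemma Yf_dup w : 0 < complex.Im w -> Yf (w / 2) + Yf ((w + 1) / 2) = 2 ^+ 4 * Yf w.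
Proof.
move=> w0; rewrite /Yf /Xf; have [-> ->] := qe_half w; have [] := half_neq w0.
set v := qe _ => h1 h2; field; rewrite opprK h1 h2 (_ : 1 - v ^+ 2 = (1 - v) * (1 + v)) ?mulf_neq0 //.
by ring.
Qed.

Lemma Cf_dup w : 0 < complex.Im w -> Cf (w / 2) + Cf ((w + 1) / 2) = 2 ^+ 1 * Cf w.
Proof.
move=> w0; rewrite /Cf; have [-> ->] := qe_half w; have [] := half_neq w0.
set v := qe _ => h1 h2; field; rewrite opprK h1 h2 (_ : 1 - v ^+ 2 = (1 - v) * (1 + v)) ?mulf_neq0 //.
by ring.
Qed.

Lemma zx_neq0 (x : R) : z + x%:C != 0.
Proof.
apply/eqP => h; have := z0; have := congr1 (@complex.Im R) h; rewrite raddfD /= addr0 => ->.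
by rewrite ltxx.
Qed.

Let E N (x : R) := qe ((z + x%:C) / 2 ^+ N).
Let D N (x : R) := dq N (z + x%:C).

Let D_neq0 N x : D N x != 0.
Proof. by rewrite /D /dq mulf_neq0 ?pow2_neq0 ?qe_neq1 ?Im_half. Qed.

Let XD N x : (2 ^+ (2 * N))^-1 * Xf ((z + x%:C) / 2 ^+ N) = E N x / D N x ^+ 2.
Proof.
rewrite /Xf /D /dq -/(E N x); have := pow2_neq0 N; have := qe_neq1 (Im_half x N z0).
by rewrite -/(E N x) mulnC exprM => h1 h2; field; rewrite h1 h2.
Qed.

Let YD N x : (2 ^+ (4 * N))^-1 * Yf ((z + x%:C) / 2 ^+ N)
  = 6 * (E N x / D N x ^+ 2) ^+ 2 + (2 ^+ N)^-1 ^+ 2 * (E N x / D N x ^+ 2).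
Proof.
have e4 : (2 : C) ^+ (4 * N) = (2 ^+ N) ^+ 4 by rewrite mulnC exprM.
have e2 : (2 : C) ^+ (2 * N) = (2 ^+ N) ^+ 2 by rewrite mulnC exprM.
rewrite -XD /Yf e4 e2; have := pow2_neq0 N; set p := 2 ^+ N => h.
by field.
Qed.

Let CD N x : (2 ^+ (1 * N))^-1 * Cf ((z + x%:C) / 2 ^+ N) = (1 + E N x) / D N x.
Proof.
rewrite /Cf /D /dq -/(E N x) mul1n; have := pow2_neq0 N; have := qe_neq1 (Im_half x N z0).
by rewrite -/(E N x) => h1 h2; field; rewrite h1 h2.
Qed.

Let E_le1 N x : nm (E N x) <= 1.
Proof. by rewrite nm_qe_le1 // ltW // Im_half. Qed.

Let cz x : - (c * (z + x%:C)) != 0.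
Proof. by rewrite oppr_eq0 mulf_neq0 ?c_neq0 ?zx_neq0. Qed.

Let XDlim x : clim (fun N => E N x / D N x ^+ 2) (c ^- 2 / (z + x%:C) ^+ 2).
Proof.
have := climM (qe_lim (z + x%:C)) (climV (expf_neq0 2 (cz x)) (climX 2 (dq_lim (z + x%:C)))).
by rewrite mul1r sqrrN exprMn invfM.
Qed.

Let CDlim x : clim (fun N => (1 + E N x) / D N x) (- 2 / c / (z + x%:C)).
Proof.
have := climM (climD (@clim_cst _ 1) (qe_lim (z + x%:C))) (climV (cz x) (dq_lim (z + x%:C))).
by rewrite invrN invfM mulrN !mulNr mulrA.
Qed.

Let YDlim x : clim (fun N => 6 * (E N x / D N x ^+ 2) ^+ 2 + (2 ^+ N)^-1 ^+ 2 * (E N x / D N x ^+ 2))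
  (6 * c ^- 4 / (z + x%:C) ^+ 4).
Proof.
have := climD (@climZ _ 6 _ _ (climX 2 (XDlim x))) (climM (climX 2 pow2V_lim) (XDlim x)).
rewrite expr0n mul0r addr0; have := zx_neq0 x; have := c_neq0.
set t := z + _; set c1 := _ * 'i%C => h1 h2; rewrite (_ : 6 * (c1 ^- 2 / t ^+ 2) ^+ 2 = 6 * c1 ^- 4 / t ^+ 4) //.
by field; rewrite h1 h2.
Qed.

Let half_bound N i : (i.+1 <= 2 ^ N.-1)%N -> (0 < N)%N -> (i.+1%:R : R) <= 2 ^+ N / 2.
Proof.
case: N => // N /= h _; rewrite exprS mulrAC divff ?pnatr_eq0 // mul1r -natrX ler_nat //.
Qed.

Let XDbound : exists2 K : R, 0 < K & exists N0 : nat, forall N i, (N0 <= N)%N -> (i.+1 <= 2 ^ N.-1)%N ->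
  nm (D N i.+1%:R)^-1 <= K / i.+1%:R /\ nm (D N (- i.+1%:R))^-1 <= K / i.+1%:R.
Proof.
have [d d0 [N0 h]] := dq_lower z0.
exists d^-1; first by rewrite invr_gt0.
exists N0.+1 => N i hN hi; have hb := half_bound hi (leq_ltn_trans (leq0n _) hN).
have i0 : (0 : R) < i.+1%:R by rewrite ltr0n.
suff hh x : `|x| = i.+1%:R -> nm (D N x)^-1 <= d^-1 / i.+1%:R.
  by split; apply: hh; rewrite ?normrN ger0_norm // ltW.
move=> hx; rewrite nmV -invfM lef_pV2 ?posrE ?mulr_gt0 //; last first.
  by rewrite nm_gt0 D_neq0.
apply: le_trans (h N x (ltnW hN) _); last by rewrite hx.
by rewrite hx ler_wpM2l ?(ltW d0) // lerDr.
Qed.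

Let natC (i : nat) : (i%:R : C) = (i%:R : R)%:C.
Proof. by rewrite rmorph_nat. Qed.

(** For the unpaired term at half a period: there i + 1 = 2^(N-1), so a bound K / (i + 1) tends to
    0. *)
Let limh_aux (u : nat -> C) (K : R) N0 :
  (forall N i, (N0 <= N)%N -> i.+1 = (2 ^ N.-1)%N -> nm (u N) <= K / i.+1%:R) -> clim u 0.
Proof.
move=> h; apply: (@clim_unshift _ _ _ N0.+1).
have K0 : 0 <= K.
  have := @h N0.+1 (2 ^ N0).-1 (leqnSn _); rewrite /= prednK ?expn_gt0 // => /(_ erefl) hh.
  by have := le_trans (nm_ge0 _) hh; rewrite pmulr_lge0 // invr_gt0 ltr0n expn_gt0.
apply: (@clim_inv _ K) => n; rewrite subr0.
have := @h (n + N0.+1)%N (2 ^ (n + N0)).-1; rewrite addnS /= prednK ?expn_gt0 // => /(_ _ erefl) hh.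
apply: le_trans (hh _) _; first by lia.
apply: ler_wpM2l => //; rewrite lef_pV2 ?posrE ?ltr0n ?expn_gt0 // ler_nat.
have : (n + N0 < 2 ^ (n + N0))%N by exact: ltn_expl.
lia.
Qed.

Let XB (a K : R) i : 0 <= a -> a <= K / i.+1%:R -> a ^+ 2 <= K ^+ 2 / i.+1%:R ^+ 2.
Proof.
move=> a0 h; rewrite -expr_div_n lerXn2r ?nnegrE //; exact: le_trans h.
Qed.

Let inv_nat_le1 i : (i.+1%:R : R)^-1 <= 1.
Proof. by rewrite invf_le1 ?ltr0n // ler1n. Qed.

Let XDle N x (B : R) : nm (D N x)^-1 ^+ 2 <= B -> nm (E N x / D N x ^+ 2) <= B.
Proof.
move=> h; rewrite nmM -exprVn nmX; apply: le_trans h.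
by rewrite ler_piMl ?sqr_ge0 ?E_le1.
Qed.

Lemma csum_inv_sqr : csum (fun i => (z + i.+1%:R) ^- 2 + (z - i.+1%:R) ^- 2) (c ^+ 2 * Xf z - z ^- 2).
Proof.
have [K K0 [N0 hK]] := XDbound.
suff h : csum (fun i => c ^- 2 / (z + (i.+1%:R)%:C) ^+ 2 + c ^- 2 / (z + (- i.+1%:R)%:C) ^+ 2)
    (Xf z - c ^- 2 / (z + 0%:C) ^+ 2).
  have := @csumZ _ (c ^+ 2) _ _ h; rewrite addr0 mulrBr mulVKf ?expf_neq0 ?c_neq0 //.
  by apply: csum_ext => i; rewrite mulrDr !mulVKf ?expf_neq0 ?c_neq0 // rmorphN natC.
apply: (@periodic_expansion z z0 Xf 2 _ _ (K ^+ 2 + K ^+ 2) N0.+1).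
- by move=> w; rewrite /Xf qeD1.
- exact: Xf_dup.
- by have := XDlim 0; apply: clim_ext => N; rewrite -XD.
- apply: (@limh_aux _ (K ^+ 2) N0.+1) => N i hN hi; rewrite -hi natC XD; apply: XDle.
  have [|h1 _] := hK N i (ltnW hN); first by rewrite hi.
  apply: le_trans (XB (nm_ge0 _) h1) _; rewrite ler_wpM2l ?sqr_ge0 //.
  by rewrite expr2 invfM ler_piMr ?invr_ge0 ?inv_nat_le1.
- move=> i; have := climD (XDlim i.+1%:R) (XDlim (- i.+1%:R)).
  by apply: clim_ext => N; rewrite -!XD natC rmorphN.
- move=> N i hN hi; rewrite natC -rmorphN !XD; have [h1 h2] := hK N i (ltnW hN) hi.
  by apply: le_trans (nmD _ _) _; rewrite mulrDl lerD // XDle // XB // nm_ge0.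
Qed.

Lemma csum_inv_pow4 : csum (fun i => (z + i.+1%:R) ^- 4 + (z - i.+1%:R) ^- 4)
  (c ^+ 4 / 6 * Yf z - z ^- 4).
Proof.
have [K K0 [N0 hK]] := XDbound.
have c0 := c_neq0.
have YDle N x i : nm (D N x)^-1 <= K / i.+1%:R ->
   nm (6 * (E N x / D N x ^+ 2) ^+ 2 + (2 ^+ N)^-1 ^+ 2 * (E N x / D N x ^+ 2))
     <= (6 * K ^+ 4 + K ^+ 2) / i.+1%:R ^+ 2.
  move=> h; have h2 := XB (nm_ge0 _) h; have h3 := XDle h2.
  apply: le_trans (nmD _ _) _; rewrite (mulrDl (6 * K ^+ 4)); apply: lerD.
    rewrite nmM nm_nat nmX -mulrA ler_wpM2l //.
    have : nm (E N x / D N x ^+ 2) ^+ 2 <= (K ^+ 2 / i.+1%:R ^+ 2) ^+ 2.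
      by apply: lerXn2r; rewrite ?nnegrE ?nm_ge0 // (le_trans (nm_ge0 _) h3).
    move=> h4; apply: le_trans h4 _; rewrite expr_div_n -exprM ler_wpM2l ?exprn_ge0 ?(ltW K0) //.
    rewrite -exprVn -exprM -exprVn (_ : (2 * 2 = 2 + 2)%N) // exprD ler_piMr ?sqr_ge0 //.
    by rewrite exprn_ile1 // invr_ge0.
  rewrite nmM; apply: le_trans h3; rewrite ler_piMl ?nm_ge0 // nmX nmV nmX nm_nat.
  rewrite exprn_ile1 ?invr_ge0 ?exprn_ge0 // invf_le1 ?exprn_gt0 // exprn_ege1 // ler1n //.
suff h : csum (fun i => 6 * c ^- 4 / (z + (i.+1%:R)%:C) ^+ 4 + 6 * c ^- 4 / (z + (- i.+1%:R)%:C) ^+ 4)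
    (Yf z - 6 * c ^- 4 / (z + 0%:C) ^+ 4).
  have := @csumZ _ (c ^+ 4 / 6) _ _ h; rewrite addr0 mulrBr.
  have hc : c ^+ 4 / 6 * (6 * c ^- 4) = 1.
    by move: c0; set c1 := _ * 'i%C => c0; field.
  rewrite [in X in _ - X]mulrA hc mul1r.
  by apply: csum_ext => i; rewrite mulrDr !(mulrA (c ^+ 4 / 6) (6 * c ^- 4)) hc !mul1r rmorphN natC.
apply: (@periodic_expansion z z0 Yf 4 _ _ ((6 * K ^+ 4 + K ^+ 2) + (6 * K ^+ 4 + K ^+ 2)) N0.+1).
- by move=> w; rewrite /Yf /Xf qeD1.
- exact: Yf_dup.
- by have := YDlim 0; apply: clim_ext => N; rewrite -YD.
- apply: (@limh_aux _ (6 * K ^+ 4 + K ^+ 2) N0.+1) => N i hN hi; rewrite -hi natC YD.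
  have [|h1 _] := hK N i (ltnW hN); first by rewrite hi.
  apply: le_trans (YDle _ _ _ h1) _; rewrite ler_wpM2l //.
    by rewrite addr_ge0 ?mulr_ge0 ?exprn_ge0 // ltW.
  by rewrite expr2 invfM ler_piMr ?invr_ge0 ?inv_nat_le1.
- move=> i; have := climD (YDlim i.+1%:R) (YDlim (- i.+1%:R)).
  by apply: clim_ext => N; rewrite -!YD natC rmorphN.
- move=> N i hN hi; rewrite natC -rmorphN !YD; have [h1 h2] := hK N i (ltnW hN) hi.
  by apply: le_trans (nmD _ _) _; rewrite (mulrDl (6 * K ^+ 4 + K ^+ 2)) lerD // YDle.
Qed.

Lemma csum_inv_lin : csum (fun i => (z + i.+1%:R)^-1 + (z - i.+1%:R)^-1)
  (- c / 2 * Cf z - z^-1).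
Proof.
have [K K0 [N0 hK]] := XDbound.
have c0 := c_neq0.
have [N1 hN1] := clim_bounded (dq_lim (2 * z)).
set B := _ + 1 in hN1.
have B0 : 0 <= B by rewrite addr_ge0 ?nm_ge0.
(* A single term is only O(1/x). Since E(x) E(-x) = e(2z / 2^N), the paired numerators combine to a
   multiple of [dq N (2 * z)], which converges and so is bounded; the pair is O(1/x^2). *)
have pairE N x : (1 + E N x) / D N x + (1 + E N (- x)) / D N (- x)
    = 2 * dq N (2 * z) * (D N x)^-1 * (D N (- x))^-1.
  have E12 : qe (2 * z / 2 ^+ N) = E N x * E N (- x).
    rewrite /E -qeD; congr qe; rewrite -mulrDl; congr (_ / _); rewrite rmorphN; ring.
  have := D_neq0 N x; have := D_neq0 N (- x); rewrite /D /dq -/(E N x) -/(E N (- x)) E12.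
  rewrite !mulf_eq0 !negb_or => /andP[h1 h2] /andP[_ h3]; field; by rewrite h1 h2 h3.
suff h : csum (fun i => - 2 / c / (z + (i.+1%:R)%:C) + - 2 / c / (z + (- i.+1%:R)%:C))
    (Cf z - - 2 / c / (z + 0%:C)).
  have := @csumZ _ (- c / 2) _ _ h; rewrite addr0 mulrBr.
  have hc : - c / 2 * (- 2 / c) = 1.
    by move: c0; set c1 := _ * 'i%C => c0; field.
  rewrite [in X in _ - X]mulrA hc mul1r.
  by apply: csum_ext => i; rewrite mulrDr !(mulrA (- c / 2) (- 2 / c)) hc !mul1r rmorphN natC.
apply: (@periodic_expansion z z0 Cf 1 _ _ (2 * B * K ^+ 2) (N0 + N1).+1).
- by move=> w; rewrite /Cf qeD1.
- exact: Cf_dup.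
- by have := CDlim 0; apply: clim_ext => N; rewrite -CD.
- apply: (@limh_aux _ (2 * K) N0.+1) => N i hN hi; rewrite -hi natC CD.
  have [|h1 _] := hK N i (ltnW hN); first by rewrite hi.
  rewrite nmM -mulrA; apply: ler_pM; rewrite ?nm_ge0 //.
  by apply: le_trans (nmD _ _) _; rewrite nm1; have := E_le1 N i.+1%:R; lra.
- move=> i; have := climD (CDlim i.+1%:R) (CDlim (- i.+1%:R)).
  by apply: clim_ext => N; rewrite -!CD natC rmorphN.
- move=> N i hN hi; rewrite natC -rmorphN !CD pairE.
  have [|h1 h2] := hK N i _ hi; first by lia.
  rewrite 3!nmM nm_nat -!mulrA ler_wpM2l // ; apply: ler_pM; rewrite ?mulr_ge0 ?nm_ge0 //.
    by apply: hN1; lia.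
  have -> : K * (K / i.+1%:R ^+ 2) = K / i.+1%:R * (K / i.+1%:R) by rewrite expr2 invfM; ring.
  by apply: ler_pM; rewrite ?nm_ge0.
Qed.

End Z.
End PartialFractions.

(** * The Eisenstein series E4 *)

Section QSeries.
Variable R : realType.
Local Notation C := R[i].
Implicit Types (x z w : C) (t rho : R).

Lemma geo_sum_le t n : 0 <= t < 1 -> \sum_(i < n) t ^+ i <= (1 - t)^-1.
Proof.
move=> /andP[t0 t1]; have t1' : 0 < 1 - t by rewrite subr_gt0.
rewrite -div1r ler_pdivlMr // mulrC.
have -> : (1 - t) * \sum_(i < n) t ^+ i = 1 - t ^+ n.
  by rewrite -[RHS]opprB subrX1 -mulNr opprB.
by rewrite gerBl exprn_ge0.
Qed.

(** Each of the n terms t^i with i < n is at least t^n. *)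
Lemma natmul_geo t n : 0 <= t < 1 -> n%:R * t ^+ n <= (1 - t)^-1.
Proof.
move=> /andP[t0 t1]; apply: (le_trans _ (@geo_sum_le t n _)); last by rewrite t0.
rewrite mulr_natl -[X in _ *+ X]card_ord -sumr_const; apply: ler_sum => i _.
by rewrite ler_wiXn2l ?(ltW t1) // ltnW.
Qed.

(** In base t^8 the power offers eight factors t^n: k of them absorb n^k through [natmul_geo], and
    at least one is left for summation. *)
Lemma polygeo_le t k n : 0 <= t < 1 -> (k <= 7)%N ->
  n%:R ^+ k * (t ^+ 8) ^+ n <= (1 - t)^-1 ^+ k * t ^+ n.
Proof.
move=> ht k7; have /andP[t0 t1] := ht.
have -> : (t ^+ 8) ^+ n = (t ^+ n) ^+ k * (t ^+ n) ^+ (8 - k).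
  by rewrite -exprD subnKC 1?ltnW // exprAC.
rewrite mulrA -exprMn; apply: ler_pM; rewrite ?exprn_ge0 ?mulr_ge0 ?exprn_ge0 //.
  by rewrite lerXn2r ?nnegrE ?natmul_geo ?mulr_ge0 ?exprn_ge0 // invr_ge0 subr_ge0 ltW.
rewrite -[leRHS]expr1 ler_wiXn2l ?exprn_ge0 ?exprn_ile1 ?(ltW t1) //; lia.
Qed.

Lemma polygeo_sum t k n : 0 <= t < 1 -> (k <= 7)%N ->
  \sum_(i < n) i%:R ^+ k * (t ^+ 8) ^+ i <= (1 - t)^-1 ^+ k * (1 - t)^-1.
Proof.
move=> ht k7; apply: le_trans (ler_sum _ (fun (i : 'I_n) _ => polygeo_le i ht k7)) _.
rewrite -mulr_sumr ler_wpM2l ?geo_sum_le // exprn_ge0 // invr_ge0 subr_ge0 ltW //.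
by case/andP: ht.
Qed.

Lemma root8 rho : 0 <= rho < 1 -> exists2 t, 0 <= t < 1 & t ^+ 8 = rho.
Proof.
move=> /andP[r0 r1]; exists (Num.sqrt (Num.sqrt (Num.sqrt rho))).
  rewrite sqrtr_ge0 /= -[ltRHS]sqrtr1 ltr_sqrt // -[ltRHS]sqrtr1 ltr_sqrt //.
  by rewrite -[ltRHS]sqrtr1 ltr_sqrt.
by rewrite (exprM _ 2 4) sqr_sqrtr ?sqrtr_ge0 // (exprM _ 2 2) sqr_sqrtr ?sqrtr_ge0 // sqr_sqrtr.
Qed.

Lemma polygeo_bound rho k : 0 <= rho < 1 -> (k <= 7)%N ->
  exists B, forall n, \sum_(i < n) i%:R ^+ k * rho ^+ i <= B.
Proof.
by move=> /root8 [t ht <-] hk; exists ((1 - t)^-1 ^+ k * (1 - t)^-1) => n; exact: polygeo_sum.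
Qed.

Lemma polygeo_lim x k : nm x < 1 -> (k <= 6)%N -> clim (fun n => n%:R ^+ k * x ^+ n) 0.
Proof.
move=> x1 hk; have [t ht tE] : exists2 t, 0 <= t < 1 & t ^+ 8 = nm x by apply: root8; rewrite nm_ge0.
apply: (@clim_unshift _ _ _ 1); apply: (@clim_inv _ ((1 - t)^-1 ^+ k.+1)) => n.
rewrite addn1 subr0 nmM !nmX nm_nat -tE ler_pdivlMr ?ltr0n // mulrAC -exprSr.
apply: le_trans (polygeo_le _ ht _) _ => //.
have /andP[t0 t1] := ht; rewrite ler_piMr ?exprn_ile1 ?(ltW t1) // exprn_ge0 // invr_ge0 subr_ge0 ltW //.
Qed.

Lemma csum_geo x : nm x < 1 -> csum (fun i => x ^+ i) (1 - x)^-1.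
Proof.
move=> x1.
have h : 1 - x != 0 by rewrite subr_eq0; apply/eqP => e; move: x1; rewrite -e nm1 ltxx.
have := climM (climB (@clim_cst _ 1) (@polygeo_lim x 0 x1 isT)) (@clim_cst _ (1 - x)^-1).
rewrite subr0 mul1r; apply: clim_ext => n; rewrite expr0 mul1r -opprB subrX1 -mulNr opprB.
by rewrite mulrAC mulfV // mul1r.
Qed.

Lemma csum_geoS x : nm x < 1 -> csum (fun i => x ^+ i.+1) (x / (1 - x)).
Proof.
by move=> /csum_geo h; have := @csumZ _ x _ _ h; apply: csum_ext => i; rewrite exprS.
Qed.

Lemma csum_lin_geo x : nm x < 1 -> csum (fun i => i%:R * x ^+ i) (x / (1 - x) ^+ 2).
Proof.
move=> x1.
have h : 1 - x != 0 by rewrite subr_eq0; apply/eqP => e; move: x1; rewrite -e nm1 ltxx.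
have E n : \sum_(i < n) i%:R * x ^+ i = (x - (n%:R ^+ 1 * x ^+ n * (1 - x) + x * (n%:R ^+ 0 * x ^+ n))) / (1 - x) ^+ 2.
  elim: n => [|n ih]; first by rewrite big_ord0; field; rewrite h.
  by rewrite big_ord_recr /= ih (exprS x n) -natr1; field; rewrite h.
have := climM (climB (@clim_cst _ x) (climD (climM (@polygeo_lim x 1 x1 isT) (@clim_cst _ (1 - x)))
  (@climZ _ x _ _ (@polygeo_lim x 0 x1 isT)))) (@clim_cst _ ((1 - x) ^+ 2)^-1).
by rewrite mul0r mulr0 addr0 subr0; apply: clim_ext => n; rewrite E.
Qed.

Lemma csum_cube_geo x : nm x < 1 ->
  csum (fun i => i%:R ^+ 3 * x ^+ i) (6 * (x / (1 - x) ^+ 2) ^+ 2 + x / (1 - x) ^+ 2).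
Proof.
move=> x1.
have h : 1 - x != 0 by rewrite subr_eq0; apply/eqP => e; move: x1; rewrite -e nm1 ltxx.
(* [P] collects the boundary terms at n of the closed form; 1 + 4x + x^2 is the Eulerian polynomial
   of the cubes. *)
pose P (u3 u2 u1 u0 : C) := u3 * (1 - x) ^+ 3 + u2 * (3 * x * (1 - x) ^+ 2)
  + u1 * (3 * x * (1 + x) * (1 - x)) + u0 * (x * (1 + 4 * x + x ^+ 2)).
have E n : \sum_(i < n) i%:R ^+ 3 * x ^+ i = (x * (1 + 4 * x + x ^+ 2) - P (n%:R ^+ 3 * x ^+ n) (n%:R ^+ 2 * x ^+ n)
    (n%:R ^+ 1 * x ^+ n) (n%:R ^+ 0 * x ^+ n)) / (1 - x) ^+ 4.
  rewrite /P; elim: n => [|n ih]; first by rewrite big_ord0; field; rewrite h.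
  by rewrite big_ord_recr /= ih (exprS x n) -natr1; field; rewrite h.
have l k : (k <= 6)%N -> clim (fun n => n%:R ^+ k * x ^+ n) 0 by exact: polygeo_lim.
have c0 (y : C) := @clim_cst _ y.
have := climM (climB (c0 (x * (1 + 4 * x + x ^+ 2))) (climD (climD (climD (climM (l 3 isT) (c0 ((1 - x) ^+ 3)))
  (climM (l 2 isT) (c0 (3 * x * (1 - x) ^+ 2)))) (climM (l 1%N isT) (c0 (3 * x * (1 + x) * (1 - x)))))
  (climM (l 0 isT) (c0 (x * (1 + 4 * x + x ^+ 2)))))) (c0 ((1 - x) ^+ 4)^-1).
rewrite !mul0r !addr0 subr0 (_ : _ / _ = 6 * (x / (1 - x) ^+ 2) ^+ 2 + x / (1 - x) ^+ 2).
  by apply: clim_ext => n; rewrite E.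
by field; rewrite h.
Qed.

(** Both series sum m^p x^(m(k+1)) over m and k; row m is dominated by m^p |x|^m / (1 - |x|). *)
Lemma lambert_swap x (p : nat) (F : nat -> C) : nm x < 1 -> (0 < p <= 6)%N ->
  (forall k, csum (fun m => m%:R ^+ p * (x ^+ k.+1) ^+ m) (F k)) ->
  exists s, csum (fun m => m%:R ^+ p * (x ^+ m / (1 - x ^+ m))) s /\ csum F s.
Proof.
move=> x1 /andP[p0 p6] hF; set rho := nm x in x1; have r0 : 0 <= rho by exact: nm_ge0.
have r1 : 0 < 1 - rho by rewrite subr_gt0.
have [|B hB] := @polygeo_bound rho p _ (leqW p6); first by rewrite r0.
have zR : (0%:R : R) ^+ p = 0 by rewrite expr0n gtn_eqF.
have zC : (0%:R : C) ^+ p = 0 by rewrite expr0n gtn_eqF.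
apply: (@fubini _ (fun m k => m%:R ^+ p * (x ^+ k.+1) ^+ m) _ F
   (fun m => (1 - rho)^-1 * (m%:R ^+ p * rho ^+ m)) ((1 - rho)^-1 * B)).
- case=> [|m] n.
    rewrite zR mul0r mulr0 big1 // => i _.
    by rewrite zC mul0r nm0.
  under eq_bigr => i _ do rewrite nmM !nmX nm_nat.
  rewrite -mulr_sumr mulrCA ler_wpM2l ?exprn_ge0 //.
  have -> : \sum_(i < n) (rho ^+ i.+1) ^+ m.+1 = rho ^+ m.+1 * \sum_(i < n) (rho ^+ m.+1) ^+ i.
    by rewrite mulr_sumr; apply: eq_bigr => i _; rewrite exprAC exprS.
  rewrite mulrC ler_wpM2r ?exprn_ge0 //.
  have le1 : rho ^+ m.+1 <= rho by rewrite exprS ler_piMr // exprn_ile1 // ltW.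
  apply: le_trans (@geo_sum_le _ n _) _; first by rewrite exprn_ge0 // (le_lt_trans le1).
  by rewrite lef_pV2 ?posrE ?subr_gt0 ?(le_lt_trans le1) // lerD2l lerN2.
- by move=> n; rewrite -mulr_sumr ler_wpM2l // invr_ge0 ltW.
(* In row 0 the quotient has denominator 0, and the factor 0^p annihilates it. *)
- case=> [|m].
    rewrite zC mul0r.
    by have := @csum_finite R (fun=> 0) 0 (fun _ _ => erefl); rewrite big_ord0; apply: csum_ext => i; rewrite mul0r.
  have h : nm (x ^+ m.+1) < 1.
    by rewrite nmX -/rho exprS (le_lt_trans _ x1) // ler_piMr // exprn_ile1 // ltW.
  have := @csumZ _ (m.+1%:R ^+ p) _ _ (csum_geoS h); apply: csum_ext => i.
  by rewrite exprAC.
- exact: hF.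
Qed.

Lemma csum_dvd x m : nm x < 1 -> (0 < m)%N ->
  csum (fun n => if (m %| n)%N && (0 < n)%N then x ^+ n else 0) (x ^+ m / (1 - x ^+ m)).
Proof.
move=> x1 m0; set rho := nm x in x1; have r0 : 0 <= rho by exact: nm_ge0.
pose a n := if (m %| n)%N && (0 < n)%N then x ^+ n else 0.
have [|n|s hs] := @csum_abs _ a (fun n => rho ^+ n) (1 - rho)^-1.
- by move=> n; rewrite /a; case: ifP => _; rewrite ?nmX // nm0 exprn_ge0.
- by apply: geo_sum_le; rewrite r0.
suff -> : x ^+ m / (1 - x ^+ m) = s by [].
have h : nm (x ^+ m) < 1.
  by rewrite nmX -/rho; case: (m) m0 => // k _; rewrite exprS (le_lt_trans _ x1) // ler_piMr // exprn_ile1 // ltW.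
apply: clim_unique (csum_geoS h) _.
(* The partial sum of length m K + 1 has just taken in x^(m K); along these lengths it agrees with
   the geometric series in x^m. *)
have hk n : (n <= m * n + 1)%N by rewrite (leq_trans _ (leq_addr _ _)) // leq_pmull.
apply: clim_ext (clim_sub hk hs).
elim=> [|K ih]; first by rewrite muln0 big_ord_recr !big_ord0 /= /a ltnn andbF addr0.
have -> : (m * K.+1 + 1 = (m * K + 1) + m)%N by rewrite mulnS; lia.
rewrite big_split_ord /= ih [RHS]big_ord_recr /=; congr (_ + _).
case: m m0 @a {s hs hk ih} h => // m _ a _.
rewrite big_ord_recr /= big1 ?add0r => [|i _].
  by rewrite /a ifT -?exprM; [congr (_ ^+ _); lia | rewrite (_ : m.+1 * K + 1 + m = m.+1 * K.+1)%N; [rewrite dvdn_mulr //= ; lia|lia]].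
rewrite /a ifF //; apply/negbTE; rewrite negb_and -addnA dvdn_addr ?dvdn_mulr //.
by rewrite gtnNdvd //; have := ltn_ord i; lia.
Qed.

Lemma sigmaE k n : (0 < n)%N ->
  (sigma k n)%:R = \sum_(m < n.+1 | (m %| n)%N) (m%:R ^+ k : C).
Proof.
move=> n0; rewrite /sigma natr_sum.
rewrite -(big_mkord (fun m => m %| n)%N (fun m => m%:R ^+ k)) -[RHS]big_filter.
under eq_bigr do rewrite natrX.
apply: perm_big; apply: uniq_perm; rewrite ?divisors_uniq ?filter_uniq ?iota_uniq // => d.
rewrite -dvdn_divisors // mem_filter mem_index_iota; case: (boolP (d %| n)%N) => //= h.
by rewrite ltnS dvdn_leq.
Qed.

(** Expanding x^m / (1 - x^m) over the multiples of m and summing over m first collects the divisors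
    of n. Row n has at most n nonzero entries, each bounded by n^p |x|^n. *)
Lemma sigma_lambert x (p : nat) s : nm x < 1 -> (0 < p <= 5)%N ->
  csum (fun m => m%:R ^+ p * (x ^+ m / (1 - x ^+ m))) s ->
  csum (fun n => (0 < n)%N%:R * (sigma p n)%:R * x ^+ n) s.
Proof.
move=> x1 /andP[p0 p5] hs; set rho := nm x in x1; have r0 : 0 <= rho by exact: nm_ge0.
have [|B hB] := @polygeo_bound rho p.+1 _ (leqW p5); first by rewrite r0.
pose a n m := if [&& (0 < n)%N, (0 < m)%N & (m %| n)%N] then m%:R ^+ p * x ^+ n else 0 : C.
have arow n : (0 < n)%N%:R * (sigma p n)%:R * x ^+ n = \sum_(m < n.+1) a n m.
  case: n => [|n]; first by rewrite !mul0r big_ord1 /a.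
  rewrite mul1r sigmaE // mulr_suml big_mkcond /=; apply: eq_bigr => m _; rewrite /a /=.
  by case: (m : nat) => [|k]; rewrite ?dvd0n //=; case: ifP.
have afin n m : (n.+1 <= m)%N -> a n m = 0.
  by case: n => // n h; rewrite /a gtnNdvd ?andbF.
have anm n m : nm (a n m) <= n%:R ^+ p * rho ^+ n.
  rewrite /a; case: ifP => [/and3P[n0 m0 /(dvdn_leq n0) mn]|_]; last first.
    by rewrite nm0 mulr_ge0 ?exprn_ge0.
  by rewrite nmM !nmX nm_nat ler_wpM2r ?exprn_ge0 // lerXn2r ?nnegrE // ler_nat.
have [s' [h1 h2]] : exists s', csum (fun n => (0 < n)%N%:R * (sigma p n)%:R * x ^+ n) s' /\
   csum (fun m => m%:R ^+ p * (x ^+ m / (1 - x ^+ m))) s'.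
  apply: (@fubini _ a _ _ (fun n => n%:R ^+ p.+1 * rho ^+ n) B _ hB).
  - move=> n N.
    have h : \sum_(j < N) nm (a n j) <= \sum_(j < n.+1) nm (a n j).
      rewrite -!(big_mkord xpredT (fun j => nm (a n j))).
      have [hN|hN] := leqP N n.+1.
        rewrite [leRHS](@big_cat_nat _ _ _ N) //= lerDl sumr_ge0 // => i _; exact: nm_ge0.
      rewrite (@big_cat_nat _ _ _ n.+1) 1?ltnW //= [X in _ + X]big_nat [X in _ + X]big1 ?addr0 //.
      by move=> i /andP[/afin -> _]; rewrite nm0.
    apply: le_trans h _; rewrite big_ord_recl /= {1}/a ltnn andbF nm0 add0r.
    apply: le_trans (ler_sum _ (fun (i : 'I_n) _ => anm n (bump 0 i))) _.
    by rewrite sumr_const card_ord -[leLHS]mulr_natl mulrA -exprS.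
  - by move=> n; rewrite arow; apply: csum_finite; exact: afin.
  - case=> [|m].
      rewrite expr0n gtn_eqF // mul0r.
      by have := @csum_finite R (fun=> 0) 0 (fun _ _ => erefl); rewrite big_ord0; apply: csum_ext => i; rewrite /a andbF.
    have := @csumZ _ (m.+1%:R ^+ p) _ _ (csum_dvd x1 (ltn0Sn m)); apply: csum_ext => n.
    by rewrite /a /= andbC; case: ifP; rewrite ?mulr0.
by rewrite (csum_unique hs h2).
Qed.

End QSeries.

(** * Zeta values and the inversion formula of E4 *)

Section Eisenstein4.
Variable R : realType.
Local Notation C := R[i].
Local Notation c := ((2 * pi)%:C * 'i%C : C).
Implicit Types z w : C.

(* Letting z tend to 1/2 in the expansion of a periodic function gives the sum
   over odd integers, hence the zeta value. *)
Lemma zeta_from_half (G : C -> C) (V : C) k : (1 < k)%N ->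
  (forall z, 0 < complex.Im z ->
     csum (fun i => (z + i.+1%:R) ^- k + (z - i.+1%:R) ^- k) (G z - z ^- k)) ->
  clim (fun N => G (2^-1 + (N.+1%:R)^-1 * 'i%C)) V -> ~~ odd k ->
  csum (fun i => i.+1%:R ^- k) (V / (2 * (2 ^+ k - 1))).
Proof.
move=> k1 hG hV kev.
pose z N : C := 2^-1 + (N.+1%:R)^-1 * 'i%C.
have zE N : z N = (2^-1 +i* (N.+1%:R)^-1).
  rewrite /z; have -> : (2 : C)^-1 = (2^-1)%:C by rewrite fmorphV /= rmorph_nat.
  have -> : (N.+1%:R : C)^-1 = (N.+1%:R^-1)%:C by rewrite fmorphV /= rmorph_nat.
  by simpc.
have zI N : 0 < complex.Im (z N) by rewrite zE /= invr_gt0 ltr0n.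
have nlow N (y : R) : `|2^-1 + y| <= nm (z N + y%:C).
  by apply: le_trans (Re_le_nm _); rewrite zE.
have natC (i : nat) : (i%:R : C) = (i%:R : R)%:C by rewrite rmorph_nat.
have i0 i : (0 : R) < i.+1%:R by rewrite ltr0n.
have low N i : i.+1%:R / 2 <= nm (z N + i.+1%:R) /\ i.+1%:R / 2 <= nm (z N - i.+1%:R).
  have h1 : (1 : R) <= i.+1%:R by rewrite ler1n.
  split; first by rewrite natC; apply: le_trans (nlow _ _); rewrite ger0_norm; lra.
  by rewrite natC -rmorphN; apply: le_trans (nlow _ _); rewrite ler0_norm; lra.
have bnd (y : C) i : i.+1%:R / 2 <= nm y -> nm (y ^- k) <= 2 ^+ k / i.+1%:R ^+ 2.
  move=> hy; rewrite nmV nmX.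
  have y0 : 0 < nm y by apply: lt_le_trans hy; rewrite divr_gt0.
  apply: (@le_trans _ _ ((i.+1%:R / 2) ^+ k)^-1).
    have a2 : 0 < i.+1%:R / 2 :> R by rewrite divr_gt0.
    by rewrite lef_pV2 ?posrE ?exprn_gt0 // lerXn2r ?nnegrE ?(ltW y0) ?(ltW a2).
  rewrite expr_div_n invf_div ler_wpM2l ?exprn_ge0 // lef_pV2 ?posrE ?exprn_gt0 //.
  by rewrite ler_weXn2l // ler1n.
pose h : C := 2^-1.
have zlim : clim z h.
  apply: (@clim_inv _ 1) => N; rewrite /z addrAC subrr add0r nmM nmi mulr1 nmV nm_nat.
  by rewrite div1r.
have hE : h = (2^-1)%:C by rewrite /h fmorphV /= rmorph_nat.
have hn0 (y : R) : 2^-1 + y != 0 -> h + y%:C != 0.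
  by move=> hy; rewrite hE -rmorphD /= -nm_eq0 nmR normr_eq0.
have lim1 i : clim (fun N => (z N + i.+1%:R) ^- k + (z N - i.+1%:R) ^- k)
    ((h + i.+1%:R) ^- k + (h - i.+1%:R) ^- k).
  have h1 : (1 : R) <= i.+1%:R by rewrite ler1n.
  apply: climD.
    apply: climV (climX k (climD zlim (@clim_cst _ _))).
    by rewrite expf_neq0 // natC hn0 // gt_eqF //; lra.
  apply: climV (climX k (climB zlim (@clim_cst _ _))).
  by rewrite expf_neq0 // natC -rmorphN hn0 // lt_eqF //; lra.
have K0 : (0 : R) <= 2 ^+ k + 2 ^+ k by rewrite addr_ge0 // exprn_ge0.
have bnd2 N i : nm ((z N + i.+1%:R) ^- k + (z N - i.+1%:R) ^- k) <= (2 ^+ k + 2 ^+ k) / i.+1%:R ^+ 2.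
  by have [l1 l2] := low N i; apply: le_trans (nmD _ _) _; rewrite (mulrDl (2 ^+ k)) lerD // bnd.
have bnd3 i : nm ((h + i.+1%:R) ^- k + (h - i.+1%:R) ^- k) <= (2 ^+ k + 2 ^+ k) / i.+1%:R ^+ 2.
  by apply: clim_le (lim1 i) _; exists 0%N => N _; exact: bnd2.
have sK n := @bounded_inv_sqr R _ n K0.
have [s hs] := csum_abs bnd3 sK.
(* The expansion holds only above the real axis; Tannery's theorem carries it to 1/2 along the
   points [z N]. *)
have sV : s = V - h ^- k.
  have l1 := tannery bnd2 sK lim1 (fun N => hG _ (zI N)) hs.
  have l2 := climB hV (climV (expf_neq0 k (_ : h != 0)) (climX k zlim)).
  by apply: clim_unique l1 (l2 _); rewrite invr_eq0 pnatr_eq0.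
pose o i : C := (h + i%:R) ^- k.
(* As k is even and 1/2 - (i + 1) = -(1/2 + i), every term of [o] is counted twice in the two-sided
   sum. *)
have odd_sum : csum (fun i => o i) (V / 2).
  have oS n : \sum_(i < n) o i.+1 = \sum_(i < n) o i + o n - o 0%N.
    have : \sum_(i < n.+1) o i = o 0%N + \sum_(i < n) o i.+1.
      by rewrite big_ord_recl; congr (_ + _); apply: eq_bigr.
    by rewrite big_ord_recr /= => ->; rewrite addrAC subrr add0r.
  have o_lim : clim o 0.
    apply: (@clim_unshift _ _ _ 1); apply: (@clim_inv _ (2 ^+ k)) => n; rewrite subr0 addn1.
    apply: le_trans (bnd _ n _) _.
      by rewrite natC hE -rmorphD nmR ger0_norm; have := i0 n; lra.
    by rewrite ler_wpM2l ?exprn_ge0 // lef_pV2 ?posrE ?exprn_gt0 // expr2 ler_pMl // ler1n.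
  have := climB (climD hs (@clim_cst _ (o 0%N))) o_lim; rewrite sV /o addr0 subrK subr0 => l.
  have := climZ (2^-1) l; rewrite mulrC; apply: clim_ext => n.
  have oE i : (h - i.+1%:R) ^- k = o i.
    rewrite /o; have -> : h - i.+1%:R = - (h + i%:R).
      have hh : h + h = 1 by rewrite /h; field.
      by rewrite -natr1 -hh; ring.
    by rewrite exprNn -signr_odd (negbTE kev) mul1r.
  under eq_bigr => i _ do rewrite oE -/(o i.+1).
  rewrite big_split /= oS /o addr0; move: (h ^- k) ((h + n%:R) ^- k) => u v; by field.
have i20 : (2 : C) != 0 by rewrite pnatr_eq0.
have bz i : nm ((i.+1%:R : C) ^- k) <= 2 ^+ k / i.+1%:R ^+ 2.
  by apply: bnd; rewrite nm_nat; have := i0 i; lra.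
have [Z hZ] := csum_abs bz (fun n => @bounded_inv_sqr R _ n (exprn_ge0 k (ler0n R 2))).
(* Splitting by parity: the odd numbers are 2 (1/2 + i), the even ones 2 (i + 1). *)
have Zeq : Z = 2 ^- k * (V / 2) + 2 ^- k * Z.
  have hd2 n : (n <= n.*2)%N by rewrite -addnn leq_addr.
  have l1 := clim_sub hd2 hZ.
  have l2 := climD (climZ (2 ^- k) odd_sum) (climZ (2 ^- k) hZ).
  apply: clim_unique l1 _; apply: clim_ext l2 => n.
  rewrite (big_ord_double (fun i => (i.+1%:R : C) ^- k)) big_split /= !mulr_sumr.
  congr (_ + _); apply: eq_bigr => i _; rewrite -invfM -exprMn; congr ((_ ^+ _)^-1).
    have -> : (i.*2.+1%:R : C) = 2 * i%:R + 1 by rewrite -addn1 natrD -mul2n natrM.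
    by rewrite /h; field.
  have -> : (i.*2.+2%:R : C) = 2 * (i%:R + 1) by rewrite natr1 -natrM mul2n doubleS.
  by rewrite natr1.
have k2 : (2 ^+ k - 1 : C) != 0.
  rewrite subr_eq0 -natrX -[1]/(1%:R) eqr_nat; apply/eqP => e.
  have := ltn_expl k (ltnSn 1); rewrite e; lia.
suff -> : V / (2 * (2 ^+ k - 1)) = Z by [].
have k3 : (2 ^+ k : C) != 0 by rewrite expf_neq0.
have : Z * (2 ^+ k - 1) = V / 2.
  have h1 : 2 ^+ k * Z = V / 2 + Z by rewrite {1}Zeq mulrDr !mulVKf.
  by rewrite mulrBr mulr1 mulrC h1 addrK.
by rewrite invfM mulrA => <-; rewrite mulfK.
Qed.

Lemma qe_half_lim : clim (fun N => qe (2^-1 + (N.+1%:R)^-1 * 'i%C : C)) (-1).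
Proof.
have -> : (-1 : C) = qe (2^-1 : C) * 1.
  by have [_ h] := qe_half (0 : C); move: h; rewrite add0r mul1r mul0r qe0 => ->; rewrite mulr1.
under eq_fun do rewrite qeD.
apply: climM; first exact: clim_cst.
apply: (@clim_unshift _ _ _ 16); apply: (@clim_inv _ (256 + 2 * pi)) => n.
set y : C := _ * 'i%C.
have ny : nm y = ((n + 16).+1%:R)^-1 by rewrite nmM nmi mulr1 nmV nm_nat.
have le1 : nm y <= (n.+1%:R)^-1 by rewrite ny lef_pV2 ?posrE ?ltr0n // ler_nat; lia.
have le2 : nm y <= 16^-1 by rewrite ny lef_pV2 ?posrE ?ltr0n // ler_nat; lia.
rewrite -[qe y - 1](subrK (c * y)); apply: le_trans (nmD _ _) _.
rewrite (mulrDl 256) lerD //.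
  apply: le_trans (qe_approx le2) _; rewrite ler_wpM2l ?ler0n // expr2.
  by apply: le_trans le1; rewrite ler_piMr ?nm_ge0 // (le_trans le2) // invf_le1 ?ler1n ?ltr0n.
by rewrite (nmM _ y) nmM nmi mulr1 nmR ger0_norm ?mulr_ge0 ?pi_ge0 // ler_wpM2l ?mulr_ge0 ?pi_ge0.
Qed.

Lemma Xf_half_lim : clim (fun N => Xf (2^-1 + (N.+1%:R)^-1 * 'i%C : C)) (- 4^-1).
Proof.
have n0 : (1 - -1 : C) ^+ 2 != 0 by rewrite opprK expf_neq0 // -[1 + 1]/(2%:R) pnatr_eq0.
have := climM qe_half_lim (climV n0 (climX 2 (climB (@clim_cst _ 1) qe_half_lim))).
rewrite (_ : -1 / _ = - 4^-1) //; rewrite mulN1r; congr (- _^-1); ring.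
Qed.

(** Here c = 2 pi i, so this is pi^2 / 6; it comes from the value -1/4 of [Xf] at 1/2. *)
Lemma zeta2 : csum (fun i => (i.+1%:R : C) ^- 2) (- c ^+ 2 / 24).
Proof.
have := @zeta_from_half (fun z => c ^+ 2 * Xf z) (c ^+ 2 * - 4^-1) 2 isT (fun z hz => csum_inv_sqr hz)
  (@climZ _ (c ^+ 2) _ _ Xf_half_lim) isT.
by rewrite (_ : c ^+ 2 * - 4^-1 / _ = - c ^+ 2 / 24) //; set d := c; field.
Qed.

(** That is pi^4 / 90, from the value 1/8 of [Yf] at 1/2. *)
Lemma zeta4 : csum (fun i => (i.+1%:R : C) ^- 4) (c ^+ 4 / 1440).
Proof.
have l := climD (@climZ _ 6 _ _ (climX 2 Xf_half_lim)) Xf_half_lim.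
have := @zeta_from_half (fun z => c ^+ 4 / 6 * Yf z) (c ^+ 4 / 6 * (6 * (- 4^-1) ^+ 2 + - 4^-1)) 4 isT (fun z hz => csum_inv_pow4 hz)
  (@climZ _ (c ^+ 4 / 6) _ _ l) isT.
by rewrite (_ : c ^+ 4 / 6 * _ / _ = c ^+ 4 / 1440) //; set d := c; field.
Qed.

Lemma Im_natmul (m : nat) z : 0 < complex.Im z -> 0 < complex.Im (m.+1%:R * z).
Proof.
have -> : (m.+1%:R : C) = (m.+1%:R)%:C by rewrite rmorph_nat.
by case: z => a b h; simpc; rewrite /= mulr_gt0 // ltr0n.
Qed.

Lemma Im_neg_inv z : 0 < complex.Im z -> 0 < complex.Im (- z^-1).
Proof.
case: z => a b /= b0; rewrite opprK; apply: divr_gt0 => //.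
by rewrite ltr_wpDl ?sqr_ge0 // exprn_gt0.
Qed.

Lemma Im_neq0 z : 0 < complex.Im z -> z != 0.
Proof. by move=> h; apply/eqP => e; move: h; rewrite e ltxx. Qed.

Lemma qe_natmul (k : nat) z : qe (k.+1%:R * z) = qe z ^+ k.+1.
Proof. exact: qeMn. Qed.

(** One number [A] is both the q-series and the sum of [Yf] over the multiples of z; the second form
    is the one that partial fractions expand. *)
Lemma E4_lambert z : 0 < complex.Im z ->
  exists A, [/\ E4 z = 1 + 240 * A, csum (fun n => (0 < n)%N%:R * (sigma 3 n)%:R * qe z ^+ n) A &
    csum (fun k => Yf (k.+1%:R * z)) A].
Proof.
move=> z0; have q1 := nm_qe_lt1 z0.
have [k|s [h1 h2]] := @lambert_swap _ (qe z) 3 (fun k => Yf (k.+1%:R * z)) q1 isT.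
  rewrite /Yf /Xf qe_natmul; apply: csum_cube_geo.
  by rewrite -qe_natmul nm_qe_lt1 // Im_natmul.
have h3 := @sigma_lambert _ _ 3 _ q1 isT h1.
exists s; split=> //; rewrite /E4; congr (1 + 240 * _); apply: clim_limn.
apply: clim_ext h3 => n; case: n => [|n]; first by rewrite big_ord0 big_geq.
rewrite -(big_mkord xpredT (fun i => (0 < i)%N%:R * (sigma 3 i)%:R * qe z ^+ i)) big_ltn // !mul0r add0r.
by rewrite big_nat [RHS]big_nat; apply: eq_bigr => i /andP[-> _]; rewrite qexpE mul1r.
Qed.

(** Multiplication by z^-k turns (j(-1/z) + i)^-k into (iz - j)^-k, so the column sums of the
    lattice series are values of [G] at multiples of -1/z. *)
Lemma csum_neg_inv z (k : nat) (G : C -> C) : 0 < complex.Im z -> ~~ odd k ->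
  (forall w, 0 < complex.Im w ->
     csum (fun i => (w + i.+1%:R) ^- k + (w - i.+1%:R) ^- k) (G w - w ^- k)) ->
  forall j, csum (fun i => (i.+1%:R * z + j.+1%:R) ^- k + (i.+1%:R * z - j.+1%:R) ^- k)
    (z ^- k * (G (j.+1%:R * - z^-1) - (j.+1%:R * - z^-1) ^- k)).
Proof.
move=> z0 kev hG j.
have := @csumZ _ (z ^- k) _ _ (hG _ (Im_natmul j (Im_neg_inv z0))); apply: csum_ext => i.
have zn := Im_neq0 z0.
have e1 : z * (j.+1%:R * - z^-1 + i.+1%:R) = i.+1%:R * z - j.+1%:R by field.
have e2 : z * (j.+1%:R * - z^-1 - i.+1%:R) = - (i.+1%:R * z + j.+1%:R) by field.
rewrite mulrDr -!invfM -!exprMn e1 e2 exprNn -signr_odd (negbTE kev) expr0 mul1r.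
by rewrite addrC.
Qed.

(** The series of (mz + n)^-4 + (mz - n)^-4 over m, n >= 1 gives E4 at z when summed by rows and at
    -1/z when summed by columns; the zeta(4) terms supply the constant terms. *)
Theorem E4_neg_inv z : 0 < complex.Im z -> E4 (- z^-1) = z ^+ 4 * E4 z.
Proof.
move=> z0; have w0 := Im_neg_inv z0; set w := - z^-1 in w0 *.
have zn := Im_neq0 z0; have cn : c != 0 by exact: c_neq0.
have [A [-> _ hA]] := E4_lambert z0; have [B [-> _ hB]] := E4_lambert w0.
have natC (i : nat) : (i%:R : C) = (i%:R : R)%:C by rewrite rmorph_nat.
have [d d0 hd] := lattice_lower z0.
pose K : R := d ^- 4 + d ^- 4.
have K0 : 0 <= K by rewrite addr_ge0 // invr_ge0 exprn_ge0 // ltW.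
have nb (m n : nat) (y : R) : `|y| = n.+1%:R ->
    nm ((m.+1%:R * z + y%:C) ^- 4) <= d ^- 4 / m.+1%:R ^+ 2 / n.+1%:R ^+ 2.
  move=> hy; have := hd m.+1 y isT; rewrite hy nmV nmX => h.
  have m0 : (0 : R) < m.+1%:R by rewrite ltr0n.
  have n0 : (0 : R) < n.+1%:R by rewrite ltr0n.
  have p0 : 0 < d * (m.+1%:R + n.+1%:R) by rewrite mulr_gt0 // addr_gt0.
  have p1 : 0 < nm (m.+1%:R * z + y%:C) ^+ 4 by rewrite exprn_gt0 // (lt_le_trans p0 h).
  have p2 : 0 < d ^+ 4 * m.+1%:R ^+ 2 * n.+1%:R ^+ 2 by rewrite !mulr_gt0 ?exprn_gt0.
  rewrite -!invfM lef_pV2 ?posrE //.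
  (* (m + n)^4 >= m^2 n^2 turns the bound into a product, summable in each index. *)
  apply: (@le_trans _ _ ((d * (m.+1%:R + n.+1%:R)) ^+ 4)); last first.
    by apply: lerXn2r => //; rewrite nnegrE ?nm_ge0 ?(ltW p0).
  rewrite exprMn -mulrA ler_wpM2l ?exprn_ge0 ?(ltW d0) // -exprMn (exprM _ 2 2).
  by rewrite lerXn2r ?nnegrE ?sqr_ge0 ?(mulr_ge0 (ltW m0) (ltW n0)) //; nra.
have [m n||m||s [h1 h2]] := @fubini R (fun m n => (m.+1%:R * z + n.+1%:R) ^- 4 + (m.+1%:R * z - n.+1%:R) ^- 4)
  (fun m => c ^+ 4 / 6 * Yf (m.+1%:R * z) - (m.+1%:R * z) ^- 4)
  (fun n => z ^- 4 * (c ^+ 4 / 6 * Yf (n.+1%:R * w) - (n.+1%:R * w) ^- 4))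
  (fun m => K / m.+1%:R ^+ 2 * 2) (K * 2 * 2).
- apply: le_trans (ler_sum _ (fun (j : 'I_n) _ => _)) (_ : \sum_(j < n) (K / m.+1%:R ^+ 2) / j.+1%:R ^+ 2 <= _).
    move=> j _; apply: le_trans (nmD _ _) _.
    have -> : K / m.+1%:R ^+ 2 / j.+1%:R ^+ 2 = d ^- 4 / m.+1%:R ^+ 2 / j.+1%:R ^+ 2
      + d ^- 4 / m.+1%:R ^+ 2 / j.+1%:R ^+ 2 by rewrite /K; ring.
    apply: lerD.
      by rewrite [j.+1%:R]natC; apply: nb; rewrite ger0_norm.
    by rewrite [j.+1%:R]natC -rmorphN; apply: nb; rewrite normrN ger0_norm.
  by apply: bounded_inv_sqr; rewrite divr_ge0 // sqr_ge0.
- by move=> n; rewrite -mulr_suml ler_wpM2r // bounded_inv_sqr.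
- by apply: csum_inv_pow4; exact: Im_natmul.
- by apply: (@csum_neg_inv z 4 (fun z => c ^+ 4 / 6 * Yf z)) => // v; exact: csum_inv_pow4.
have ie (m : nat) (v : C) : (m.+1%:R * v) ^- 4 = v ^- 4 * m.+1%:R ^- 4 by rewrite exprMn invfM mulrC.
have l1 : csum (fun m => c ^+ 4 / 6 * Yf (m.+1%:R * z) - (m.+1%:R * z) ^- 4)
    (c ^+ 4 / 6 * A - z ^- 4 * (c ^+ 4 / 1440)).
  have := csumB (@csumZ _ (c ^+ 4 / 6) _ _ hA) (@csumZ _ (z ^- 4) _ _ zeta4).
  by apply: csum_ext => m; rewrite ie.
have l2 : csum (fun n => z ^- 4 * (c ^+ 4 / 6 * Yf (n.+1%:R * w) - (n.+1%:R * w) ^- 4))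
    (z ^- 4 * (c ^+ 4 / 6 * B - w ^- 4 * (c ^+ 4 / 1440))).
  apply: csumZ; have := csumB (@csumZ _ (c ^+ 4 / 6) _ _ hB) (@csumZ _ (w ^- 4) _ _ zeta4).
  by apply: csum_ext => m; rewrite ie.
have := csum_unique h1 l1; rewrite (csum_unique h2 l2) /w.
move: cn zn; set e := c => en zn E.
(* The factor 1440 / c^4 normalises the zeta(4) term and turns c^4 / 6 into the coefficient 240. *)
have {}E : z ^- 4 * (c ^+ 4 / 6 * B - (- z^-1) ^- 4 * (e ^+ 4 / 1440)) * (1440 / e ^+ 4)
   = (e ^+ 4 / 6 * A - z ^- 4 * (e ^+ 4 / 1440)) * (1440 / e ^+ 4) by rewrite -E.
have e1 : z ^- 4 * (e ^+ 4 / 6 * B - (- z^-1) ^- 4 * (e ^+ 4 / 1440)) * (1440 / e ^+ 4)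
  = z ^- 4 * (240 * B) - 1 by field; rewrite en zn.
have e2 : (e ^+ 4 / 6 * A - z ^- 4 * (e ^+ 4 / 1440)) * (1440 / e ^+ 4) = 240 * A - z ^- 4.
  by field; rewrite en zn.
rewrite e1 e2 in E.
have -> : 240 * A = z ^- 4 * (240 * B) - 1 + z ^- 4 by rewrite E subrK.
by field.
Qed.

End Eisenstein4.

(** * The weight two Lambert series *)

Section Eisenstein2.
Variable R : realType.
Local Notation C := R[i].
Local Notation c := ((2 * pi)%:C * 'i%C : C).
Implicit Types z w : C.

(** The generating series of sigma_1: 1 - 24 [lambert1] is the Eisenstein series E_2. *)
Definition lambert1 z : C := limn (fun n => \sum_(k < n) Xf (k.+1%:R * z) : C^o).

Lemma lambert1P z : 0 < complex.Im z ->
  csum (fun k => Xf (k.+1%:R * z)) (lambert1 z) /\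
  csum (fun m => m%:R * (qe z ^+ m / (1 - qe z ^+ m))) (lambert1 z).
Proof.
move=> z0; have q1 := nm_qe_lt1 z0.
have [k|s [h1 h2]] := @lambert_swap _ (qe z) 1 (fun k => Xf (k.+1%:R * z)) q1 isT.
  rewrite /Xf qe_natmul; have := @csum_lin_geo R (qe z ^+ k.+1); rewrite -qe_natmul => h.
  by have := h (nm_qe_lt1 (Im_natmul k z0)); apply: csum_ext => i; rewrite expr1.
by rewrite /lambert1 (clim_limn h2); split=> //; apply: csum_ext h1 => i; rewrite expr1.
Qed.

(** The telescoping majorant 1/(s(s + 1)) bounds the rows of an O((m+n)^-3) error and can be summed
    over s in turn. *)
Lemma inv_cube_sum (n : nat) (s : nat) : (0 < s)%N ->
  \sum_(j < n) (((s + j).+1%:R : R) ^+ 3)^-1 <= (s%:R * s.+1%:R)^-1.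
Proof.
move=> s0.
suff : \sum_(j < n) (((s + j).+1%:R : R) ^+ 3)^-1 <= (s%:R * s.+1%:R)^-1 - ((s + n)%:R * (s + n).+1%:R)^-1.
  by move=> h; apply: le_trans h _; rewrite gerBl invr_ge0 mulr_ge0.
elim: n => [|n ih]; first by rewrite big_ord0 addn0 subrr.
rewrite big_ord_recr /= addnS; apply: le_trans (lerD ih (lexx _)) _.
rewrite -addrA lerD2l -!natr1.
have : (1 : R) <= (s + n)%:R by rewrite ler1n; lia.
move: ((s + n)%:R : R) => t t1.
have n1 : t != 0 by rewrite gt_eqF // (lt_le_trans _ t1).
have n2 : t + 1 != 0 by rewrite gt_eqF //; lra.
have n3 : t + 1 + 1 != 0 by rewrite gt_eqF //; lra.
rewrite -subr_ge0.
have -> : - ((t + 1) * (t + 1 + 1))^-1 - (- (t * (t + 1))^-1 + (t + 1) ^- 3)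
  = (t ^+ 2 + 2 * t + 2) / (t * (t + 1 + 1) * (t + 1) ^+ 3) by field; rewrite n1 n2 n3.
by rewrite divr_ge0 // ?addr_ge0 ?mulr_ge0 ?exprn_ge0 //; lra.
Qed.

Lemma inv_consec_sum (n : nat) : \sum_(i < n) ((i.+1%:R * i.+2%:R : R))^-1 <= 1.
Proof.
suff -> : \sum_(i < n) ((i.+1%:R * i.+2%:R : R))^-1 = 1 - n.+1%:R^-1 by rewrite gerBl invr_ge0.
elim: n => [|n ih]; first by rewrite big_ord0 invr1 subrr.
rewrite big_ord_recr /= ih -[n.+2%:R]natr1; have : (0 : R) < n.+1%:R by rewrite ltr0n.
move: (n.+1%:R : R) => x x0.
have n1 : x != 0 by rewrite gt_eqF.
have n2 : x + 1 != 0 by rewrite gt_eqF // addr_gt0.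
by field; rewrite n1 n2.
Qed.

Lemma qe_nat_lim w : 0 < complex.Im w -> clim (fun n => qe (n%:R * w)) 0.
Proof.
move=> /nm_qe_lt1 h; have := @polygeo_lim R (qe w) 0 h isT.
by apply: clim_ext => n; rewrite expr0 mul1r qeMn.
Qed.

Lemma nat_inv_lim w : w != 0 -> clim (fun n => (n%:R * w)^-1) 0.
Proof.
move=> w0; apply: (@clim_unshift _ _ _ 1); apply: (@clim_inv _ (nm w)^-1) => n.
by rewrite subr0 addn1 nmV nmM nm_nat invfM mulrC.
Qed.

(* The two orders of summation of (mz+n)^-2 are compared with the telescoping
   series [phi m (j+1) - phi m j], from which it differs by O((m+n)^-3). *)
Theorem lambert1_neg_inv z : 0 < complex.Im z ->
  1 - 24 * lambert1 (- z^-1) = z ^+ 2 * (1 - 24 * lambert1 z) + 12 * z / c.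
Proof.
have hnat (m n : nat) : ((m.+1 + n).+1 <= 2 * (m.+1 + n))%N by clear; lia.
move=> z0; have w0 := Im_neg_inv z0; set w := - z^-1 in w0 *.
have zn := Im_neq0 z0; have wn := Im_neq0 w0; have cn : c != 0 by exact: c_neq0.
have [hA _] := lambert1P z0; have [hB _] := lambert1P w0.
have natC (i : nat) : (i%:R : C) = (i%:R : R)%:C by rewrite rmorph_nat.
have [d d0 hd] := lattice_lower z0.
(* Its increments in n approximate (mz+n)^-2 + (mz-n)^-2, because 1/(a - 1) - 1/a - 1/a^2 = 1/(a^2
   (a - 1)). *)
pose phi (m n : nat) : C := - (m.+1%:R * z + n%:R)^-1 + (m.+1%:R * z - n%:R)^-1.
have low (m n : nat) : d * (m.+1 + n)%:R <= nm (m.+1%:R * z + n%:R) /\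
    d * (m.+1 + n)%:R <= nm (m.+1%:R * z - n%:R).
  rewrite natrD; split.
    by rewrite (natC n); have := hd m.+1 n%:R isT; rewrite ger0_norm.
  by rewrite (natC n) -rmorphN; have := hd m.+1 (- n%:R) isT; rewrite normrN ger0_norm.
have pos (m n : nat) : 0 < d * (m.+1 + n)%:R by rewrite mulr_gt0 // ltr0n.
have nz (m n : nat) : m.+1%:R * z + n%:R != 0 /\ m.+1%:R * z - n%:R != 0.
  by have [l1 l2] := low m n; rewrite -!nm_gt0 !(lt_le_trans (pos m n)).
have phi0 m : phi m 0%N = 0 by rewrite /phi addr0 subr0 addNr.
have phi_lim m : clim (phi m) 0.
  apply: (@clim_inv _ (d^-1 + d^-1)) => n; rewrite subr0; apply: le_trans (nmD _ _) _.
  have [l1 l2] := low m n; have p := pos m n; rewrite nmN !nmV (mulrDl d^-1).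
  have h (y : R) : d * (m.+1 + n)%:R <= y -> y^-1 <= d^-1 / n.+1%:R.
    move=> hy; have y0 : 0 < y by exact: lt_le_trans hy.
    have q0 : 0 < d * n.+1%:R by rewrite mulr_gt0 ?ltr0n.
    rewrite -invfM lef_pV2 ?posrE //.
    by apply: le_trans hy; rewrite ler_wpM2l ?(ltW d0) // ler_nat addSn ltnS leq_addl.
  by apply: lerD; apply: h.
pose T (m n : nat) : C := (m.+1%:R * z + n.+1%:R) ^- 2 + (m.+1%:R * z - n.+1%:R) ^- 2.
pose D m n := T m n - (phi m n.+1 - phi m n).
pose K : R := 4 / d ^+ 3.
have K0 : 0 <= K by rewrite divr_ge0 // exprn_ge0 // ltW.
have Dbound m n : nm (D m n) <= K * (((m.+1 + n).+1%:R) ^+ 3)^-1.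
  have [l1 l2] := low m n.+1; have [l3 l4] := low m n.
  have [n1 n2] := nz m n.+1; have [n3 n4] := nz m n.
  set a := m.+1%:R * z + n.+1%:R in l1 n1; set b := m.+1%:R * z - n.+1%:R in l2 n2.
  have ea : m.+1%:R * z + n%:R = a - 1 by rewrite /a -[n.+1%:R]natr1; ring.
  have eb : m.+1%:R * z - n%:R = b + 1 by rewrite /b -[n.+1%:R]natr1; ring.
  rewrite ea in l3 n3; rewrite eb in l4 n4.
  have -> : D m n = - (a ^+ 2 * (a - 1))^-1 + (b ^+ 2 * (b + 1))^-1.
    by rewrite /D /T /phi -/a -/b ea eb; field; rewrite n1 n2 n3 n4.
  have ps := pos m n; have ps1 := pos m n.+1; rewrite addnS in l1 l2 ps1.
  set s : R := (m.+1 + n).+1%:R in l1 l2 ps1 *.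
  have hs : s <= 2 * (m.+1 + n)%:R by rewrite /s -natrM ler_nat.
  have sp : 0 < s by rewrite ltr0n.
  have key (x y : C) : d * s <= nm x -> d * (m.+1 + n)%:R <= nm y ->
      nm (x ^+ 2 * y)^-1 <= 2 / d ^+ 3 * (s ^+ 3)^-1.
    move=> hx hy.
    have -> : 2 / d ^+ 3 * (s ^+ 3)^-1 = ((d * s) ^+ 2 * (d * s / 2))^-1.
      by field; rewrite !gt_eqF.
    rewrite nmV nmM nmX lef_pV2 ?posrE; last first.
    - by rewrite !mulr_gt0 ?exprn_gt0 ?mulr_gt0 ?invr_gt0.
    - by rewrite mulr_gt0 ?exprn_gt0 ?(lt_le_trans ps1 hx) ?(lt_le_trans ps hy).
    apply: ler_pM; rewrite ?exprn_ge0 ?divr_ge0 ?(ltW ps1) //.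
      by apply: lerXn2r => //; rewrite nnegrE ?nm_ge0 ?(ltW ps1).
    apply: le_trans hy; rewrite -mulrA ler_wpM2l ?(ltW d0) //; lra.
  apply: le_trans (nmD _ _) _; rewrite nmN.
  have -> : K * (s ^+ 3)^-1 = 2 / d ^+ 3 * (s ^+ 3)^-1 + 2 / d ^+ 3 * (s ^+ 3)^-1.
    by rewrite /K; field; rewrite !gt_eqF.
  by apply: lerD; apply: key.
(* The column sums of [phi], from the cotangent expansion at n w. The value at 0 is set apart:
   [phi m 0] vanishes, while the formula would divide by 0. *)
pose Psi (n : nat) : C := if n is 0 then 0 else z^-1 * (- c / 2 * Cf (n%:R * w) - (n%:R * w)^-1).
have phi_col n : csum (fun m => phi m n) (Psi n).
  case: n => [|n] /=.
    have := @csum_finite R (fun=> 0) 0 (fun _ _ => erefl); rewrite big_ord0.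
    by apply: csum_ext => m; rewrite phi0.
  have := @csumZ _ z^-1 _ _ (csum_inv_lin (Im_natmul n w0)); apply: csum_ext => m.
  have [n1 n2] := nz m n.+1.
  have e1 : z * (n.+1%:R * w + m.+1%:R) = m.+1%:R * z - n.+1%:R by rewrite /w; field.
  have e2 : z * (n.+1%:R * w - m.+1%:R) = - (m.+1%:R * z + n.+1%:R) by rewrite /w; field.
  by rewrite mulrDr -!invfM e1 e2 invrN addrC.
(* Summed by rows the telescoping series gives 0, by columns this limit, as e(n w) -> 0 sends [Cf]
   to 1. The discrepancy is the term 12 z / c. *)
have Psi_lim : clim Psi (z^-1 * (- c / 2)).
  apply: (@clim_near _ (fun n => z^-1 * (- c / 2 * Cf (n%:R * w) - (n%:R * w)^-1)) _ _ 1).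
    by case.
  have n1 : (1 : C) - 0 != 0 by rewrite subr0 oner_eq0.
  have l := climM (climD (@clim_cst _ 1) (qe_nat_lim w0)) (climV n1 (climB (@clim_cst _ 1) (qe_nat_lim w0))).
  have := @climZ _ z^-1 _ _ (climB (@climZ _ (- c / 2) _ _ l) (nat_inv_lim wn)).
  by rewrite addr0 !subr0 divr1 mulr1.
have [m n|n|m|n|s [h1 h2]] := @fubini R D
  (fun m => c ^+ 2 * Xf (m.+1%:R * z) - (m.+1%:R * z) ^- 2)
  (fun n => z ^- 2 * (c ^+ 2 * Xf (n.+1%:R * w) - (n.+1%:R * w) ^- 2) - (Psi n.+1 - Psi n))
  (fun m => K * (m.+1%:R * m.+2%:R)^-1) (K * 1).
- apply: le_trans (ler_sum _ (fun (j : 'I_n) _ => Dbound m j)) _.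
  by rewrite -mulr_sumr ler_wpM2l // inv_cube_sum.
- by rewrite -mulr_sumr ler_wpM2l // inv_consec_sum.
- rewrite -[X in csum _ X]subr0; apply: csumB.
    by apply: csum_inv_sqr; exact: Im_natmul.
  apply: clim_ext (phi_lim m) => n.
  by rewrite -(big_mkord xpredT (fun j => phi m j.+1 - phi m j)) telescope_sumr // phi0 subr0.
- apply: csumB; last by apply: csumB.
  by apply: (@csum_neg_inv _ z 2 (fun z => c ^+ 2 * Xf z)) => // v; exact: csum_inv_sqr.
have ie (m : nat) (v : C) : (m.+1%:R * v) ^- 2 = v ^- 2 * m.+1%:R ^- 2 by rewrite exprMn invfM mulrC.
have l1 : csum (fun m => c ^+ 2 * Xf (m.+1%:R * z) - (m.+1%:R * z) ^- 2)
    (c ^+ 2 * lambert1 z - z ^- 2 * (- c ^+ 2 / 24)).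
  have := csumB (@csumZ _ (c ^+ 2) _ _ hA) (@csumZ _ (z ^- 2) _ _ (@zeta2 R)).
  by apply: csum_ext => m; rewrite ie.
have l2 : csum (fun n => z ^- 2 * (c ^+ 2 * Xf (n.+1%:R * w) - (n.+1%:R * w) ^- 2) - (Psi n.+1 - Psi n))
    (z ^- 2 * (c ^+ 2 * lambert1 w - w ^- 2 * (- c ^+ 2 / 24)) - z^-1 * (- c / 2)).
  apply: csumB.
    apply: csumZ; have := csumB (@csumZ _ (c ^+ 2) _ _ hB) (@csumZ _ (w ^- 2) _ _ (@zeta2 R)).
    by apply: csum_ext => m; rewrite ie.
  apply: clim_ext Psi_lim => n.
  by rewrite -(big_mkord xpredT (fun j => Psi j.+1 - Psi j)) telescope_sumr // /= subr0.
have := csum_unique h1 l1; rewrite (csum_unique h2 l2) /w.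
move: (lambert1 z) (lambert1 (- z^-1)) => A B.
move: cn zn; set e := c => en zn E.
have {}E : (z ^- 2 * (e ^+ 2 * B - (- z^-1) ^- 2 * (- e ^+ 2 / 24)) - z^-1 * (- e / 2)) * (24 / e ^+ 2 * z ^+ 2)
   = (e ^+ 2 * A - z ^- 2 * (- e ^+ 2 / 24)) * (24 / e ^+ 2 * z ^+ 2) by rewrite E.
have e1 : (z ^- 2 * (e ^+ 2 * B - (- z^-1) ^- 2 * (- e ^+ 2 / 24)) - z^-1 * (- e / 2)) * (24 / e ^+ 2 * z ^+ 2)
  = 24 * B + z ^+ 2 + 12 * z / e by field; rewrite en zn.
have e2 : (e ^+ 2 * A - z ^- 2 * (- e ^+ 2 / 24)) * (24 / e ^+ 2 * z ^+ 2) = z ^+ 2 * 24 * A + 1.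
  by field; rewrite en zn.
rewrite e1 e2 in E.
have -> : 24 * B = z ^+ 2 * 24 * A + 1 - z ^+ 2 - 12 * z / e by rewrite -E; ring.
by ring.
Qed.

End Eisenstein2.

(** * Calculus on the upper half-plane and the Euler product *)

Section Eta.
Variable R : realType.
Local Notation C := R[i].
Local Notation c := ((2 * pi)%:C * 'i%C : C).
Implicit Types z w : C.

Lemma prod_le_expR (x : nat -> R) n : (forall i, 0 <= x i) ->
  \prod_(i < n) (1 + x i) <= expR (\sum_(i < n) x i).
Proof.
move=> x0; elim: n => [|n ih]; first by rewrite !big_ord0 expR0.
rewrite !big_ord_recr /= expRD ler_pM ?expR_ge1Dx ?addr_ge0 //.
by rewrite prodr_ge0 // => i _; rewrite addr_ge0.
Qed.

Lemma nm_prod (F : nat -> C) n : nm (\prod_(i < n) F i) = \prod_(i < n) nm (F i).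
Proof. by elim: n => [|n ih]; rewrite ?big_ord0 ?nm1 // !big_ord_recr /= nmM ih. Qed.

(** Both differences expand into monomials in the x i with positive coefficients, so the same
    expressions in the norms majorise them. *)
Lemma prod1D_approx (x : nat -> C) n :
  nm (\prod_(i < n) (1 + x i) - 1 - \sum_(i < n) x i)
   <= \prod_(i < n) (1 + nm (x i)) - 1 - \sum_(i < n) nm (x i)
  /\ nm (\prod_(i < n) (1 + x i) - 1) <= \prod_(i < n) (1 + nm (x i)) - 1.
Proof.
elim: n => [|n [ih1 ih2]]; first by rewrite !big_ord0 !subrr nm0.
rewrite !big_ord_recr /=; set p := \prod_(i < n) (1 + x i) in ih1 ih2 *.
set P := \prod_(i < n) (1 + nm (x i)) in ih1 ih2 *.
set s := \sum_(i < n) x i in ih1 *; set S := \sum_(i < n) nm (x i) in ih1 *.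
have x0 := nm_ge0 (x n); have h3 := ler_wpM2r x0 ih2; split.
  have -> : p * (1 + x n) - 1 - (s + x n) = (p - 1 - s) + (p - 1) * x n by ring.
  apply: le_trans (nmD _ _) _; rewrite nmM.
  have -> : P * (1 + nm (x n)) - 1 - (S + nm (x n)) = (P - 1 - S) + (P - 1) * nm (x n) by ring.
  exact: lerD.
have -> : p * (1 + x n) - 1 = (p - 1) + (p - 1) * x n + x n by ring.
apply: le_trans (nmD _ _) _; apply: le_trans (lerD (nmD _ _) (lexx _)) _; rewrite nmM.
have -> : P * (1 + nm (x n)) - 1 = (P - 1) + (P - 1) * nm (x n) + nm (x n) by ring.
by rewrite !lerD.
Qed.

Lemma prod1D_linear (x : nat -> C) n (s : R) : \sum_(i < n) nm (x i) <= s -> s <= 2^-1 ->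
  nm (\prod_(i < n) (1 + x i) - 1 - \sum_(i < n) x i) <= 2 * s ^+ 2.
Proof.
set t := \sum_(i < n) nm (x i) => ts s2.
have t0 : 0 <= t by rewrite sumr_ge0 // => i _; exact: nm_ge0.
apply: le_trans (prod1D_approx x n).1 _; rewrite -/t.
have h := prod_le_expR n (fun i => nm_ge0 (x i)); rewrite -/t in h.
have a : `|t| <= 2^-1 by rewrite ger0_norm // (le_trans ts).
have := expR_approx a; rewrite ler_norml => /andP[_ e].
have : t ^+ 2 <= s ^+ 2 by rewrite lerXn2r ?nnegrE // (le_trans t0).
lra.
Qed.

(* Regions whose union is the upper half plane: convex, and mapped into one
   another by z |-> -1/z. *)
Definition region (r : R) : set C := [set z | r <= complex.Im z /\ nm z <= r^-1].

(* A quadratic remainder uniform on regions stands in for complex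
   differentiability: it passes to products, inverses and uniform limits. *)
Definition holo (F F' : C -> C) : Prop := forall r : R, 0 < r -> exists M d : R,
  [/\ 0 <= M, 0 < d, forall z, region r z -> nm (F z) <= M /\ nm (F' z) <= M &
   forall z w, region r z -> region r w -> nm (w - z) <= d ->
     nm (F w - F z - F' z * (w - z)) <= M * nm (w - z) ^+ 2].

Lemma region_Im r z : 0 < r -> region r z -> 0 < complex.Im z.
Proof. by move=> r0 [h _]; exact: lt_le_trans h. Qed.

Lemma holo_ext F F' G G' : (forall z, 0 < complex.Im z -> F z = G z) ->
  (forall z, 0 < complex.Im z -> F' z = G' z) -> holo F F' -> holo G G'.
Proof.
move=> h1 h2 h r r0; have [M [d [M0 d0 b1 b2]]] := h r r0; exists M, d; split=> //.
  by move=> z hz; have iz := region_Im r0 hz; rewrite -h1 // -h2 //; exact: b1.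
move=> z w hz hw; have iz := region_Im r0 hz; have iw := region_Im r0 hw.
by rewrite -!h1 // -h2 //; exact: b2.
Qed.

Lemma holo_id : holo id (fun=> 1).
Proof.
move=> r r0; exists (r^-1 + 1), 1.
have r1 : 0 < r^-1 by rewrite invr_gt0.
split; rewrite ?ltr01 //; first by rewrite addr_ge0 // ltW.
  by move=> z [_ h]; rewrite nm1 lerDr (ltW r1); split=> //; apply: le_trans h _; rewrite lerDl.
by move=> z w _ _ _; rewrite mul1r subrr nm0 mulr_ge0 ?sqr_ge0 // addr_ge0 // ltW.
Qed.

Lemma holo_mul F F' G G' : holo F F' -> holo G G' ->
  holo (fun z => F z * G z) (fun z => F' z * G z + F z * G' z).
Proof.
move=> hF hG r r0.
have [M [d [M0 d0 b1 b2]]] := hF r r0; have [N [e [N0 e0 b3 b4]]] := hG r r0.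
pose K := 4 * (M + N + 1) ^+ 2.
have mM : M <= M + N + 1 by lra.
have mN : N <= M + N + 1 by lra.
exists K, (Num.min 1 (Num.min d e)); split.
- by rewrite mulr_ge0 // sqr_ge0.
- by rewrite !lt_min ltr01 d0 e0.
- move=> z hz; have [f1 f2] := b1 z hz; have [g1 g2] := b3 z hz.
  have p (x y : C) : nm x <= M -> nm y <= N -> nm (x * y) <= (M + N + 1) ^+ 2.
    by move=> hx hy; rewrite nmM expr2 ler_pM ?nm_ge0 // ?(le_trans hx) ?(le_trans hy).
  have s0 := sqr_ge0 (M + N + 1); split; first by have := p _ _ f1 g1; rewrite /K; lra.
  by apply: le_trans (nmD _ _) _; have := p _ _ f1 g2; have := p _ _ f2 g1; rewrite /K; lra.
move=> z w hz hw; rewrite !le_min => /and3P[h1 hd he].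
have k1 := b2 z w hz hw hd; have k2 := b4 z w hz hw he.
have [f1 f2] := b1 z hz; have [g1 g2] := b3 z hz; have [g3 _] := b3 w hw.
set h := w - z in h1 hd he k1 k2 *.
set t := nm h in h1 hd he k1 k2 *; have t0 : 0 <= t by exact: nm_ge0.
have -> : F w * G w - F z * G z - (F' z * G z + F z * G' z) * h
  = (F w - F z - F' z * h) * G w + F z * (G w - G z - G' z * h)
    + F' z * h * (G w - G z - G' z * h) + F' z * G' z * h ^+ 2 by ring.
have tt : t ^+ 2 * t <= t ^+ 2 by rewrite ler_piMr ?sqr_ge0.
apply: le_trans (nmD _ _) _; apply: le_trans (lerD (nmD _ _) (lexx _)) _.
apply: le_trans (lerD (lerD (nmD _ _) (lexx _)) (lexx _)) _.
rewrite (nmM _ (h ^+ 2)) (nmX h) !nmM -/t.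
have q1 : nm (F w - F z - F' z * h) * nm (G w) <= M * t ^+ 2 * N by rewrite ler_pM ?nm_ge0.
have q2 : nm (F z) * nm (G w - G z - G' z * h) <= M * (N * t ^+ 2) by rewrite ler_pM ?nm_ge0.
have q3 : nm (F' z) * t * nm (G w - G z - G' z * h) <= M * 1 * (N * t ^+ 2).
  by rewrite !ler_pM ?mulr_ge0 ?nm_ge0.
have q4 : nm (F' z) * nm (G' z) * t ^+ 2 <= M * N * t ^+ 2.
  by rewrite ler_wpM2r ?sqr_ge0 // ler_pM ?nm_ge0.
have MN : M * N <= (M + N + 1) ^+ 2 by rewrite expr2 ler_pM.
have := ler_wpM2r (sqr_ge0 t) MN; rewrite /K; lra.
Qed.

Lemma holo_inv F F' : holo F F' ->
  (forall r, 0 < r -> exists2 k, 0 < k & forall z, region r z -> k <= nm (F z)) ->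
  holo (fun z => (F z)^-1) (fun z => - F' z / F z ^+ 2).
Proof.
move=> hF low r r0; have [k k0 hk] := low r r0.
have [M [d [M0 d0 b1 b2]]] := hF r r0.
have kv z : region r z -> nm (F z)^-1 <= k^-1.
  by move=> hz; rewrite nmV lef_pV2 ?posrE ?hk // (lt_le_trans k0 (hk z hz)).
have ki : 0 <= k^-1 by rewrite invr_ge0 ltW.
pose K := k^-1 + M * k^-1 ^+ 2 + (2 * M + 1) ^+ 2 * k^-1 ^+ 3.
have po1 : 0 <= M * k^-1 ^+ 2 by rewrite mulr_ge0 ?exprn_ge0.
have po2 : 0 <= (2 * M + 1) ^+ 2 * k^-1 ^+ 3 by rewrite mulr_ge0 ?sqr_ge0 ?exprn_ge0.
exists K, (Num.min 1 d); split.
- by rewrite /K !addr_ge0.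
- by rewrite lt_min ltr01.
- move=> z hz; have [f1 f2] := b1 z hz; have v := kv z hz; split; first by rewrite /K; lra.
  rewrite nmM nmN -exprVn nmX.
  have : nm (F' z) * nm (F z)^-1 ^+ 2 <= M * k^-1 ^+ 2.
    by rewrite ler_pM ?nm_ge0 ?exprn_ge0 ?nm_ge0 // lerXn2r ?nnegrE ?nm_ge0.
  rewrite /K; lra.
move=> z w hz hw; rewrite le_min => /andP[h1 hd].
have k1 := b2 z w hz hw hd; have [f1 f2] := b1 z hz.
have v := kv z hz; have v' := kv w hw.
have Fz : F z != 0 by rewrite -nm_gt0 (lt_le_trans k0 (hk z hz)).
have Fw : F w != 0 by rewrite -nm_gt0 (lt_le_trans k0 (hk w hw)).
set h := w - z in h1 hd k1 *; set t := nm h in h1 hd k1 *; have t0 : 0 <= t by exact: nm_ge0.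
set E := F w - F z - F' z * h in k1.
have dF : nm (F w - F z) <= (2 * M + 1) * t.
  rewrite -[F w - F z](subrK (F' z * h)) -/E; apply: le_trans (nmD _ _) _; rewrite nmM -/t.
  have : M * t ^+ 2 <= M * t by rewrite ler_wpM2l // expr2 ler_piMr.
  have : nm (F' z) * t <= M * t by rewrite ler_wpM2r.
  lra.
have -> : (F w)^-1 - (F z)^-1 - - F' z / F z ^+ 2 * h
  = (F w - F z) ^+ 2 * ((F w)^-1 * (F z)^-1 ^+ 2) - E * ((F z)^-1 ^+ 2).
  by rewrite /E; field; rewrite Fz Fw.
apply: le_trans (nmD _ _) _.
rewrite nmN (nmM ((F w - F z) ^+ 2)) (nmM E) (nmM (F w)^-1) !nmX.
have v2 : nm (F z)^-1 ^+ 2 <= k^-1 ^+ 2 by rewrite lerXn2r ?nnegrE ?nm_ge0.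
have v3 : nm (F w)^-1 * nm (F z)^-1 ^+ 2 <= k^-1 ^+ 3.
  by rewrite (exprS _ 2) ler_pM ?nm_ge0 ?exprn_ge0 ?nm_ge0.
have q1 : nm E * nm (F z)^-1 ^+ 2 <= M * t ^+ 2 * k^-1 ^+ 2.
  by rewrite ler_pM ?nm_ge0 ?exprn_ge0 ?nm_ge0.
have q2 : nm (F w - F z) ^+ 2 * (nm (F w)^-1 * nm (F z)^-1 ^+ 2) <= ((2 * M + 1) * t) ^+ 2 * k^-1 ^+ 3.
  rewrite ler_pM ?mulr_ge0 ?exprn_ge0 ?nm_ge0 //.
  by rewrite lerXn2r ?nnegrE ?nm_ge0 // mulr_ge0 // addr_ge0 // mulr_ge0.
have : 0 <= k^-1 * t ^+ 2 by rewrite mulr_ge0 ?sqr_ge0.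
move: q1 q2; rewrite exprMn /K; lra.
Qed.

(** Im(-1/z) = Im z / |z|^2 >= r r^2. A nonempty region has r <= Im z <= |z| <= 1/r, hence r <= 1
    and |1/z| <= 1/r <= 1/r^3. *)
Lemma region_neg_inv r z : 0 < r -> region r z -> region (r ^+ 3) (- z^-1).
Proof.
move=> r0 hz; have z0 := region_Im r0 hz; have [h1 h2] := hz; have zn := Im_neq0 z0.
have n0 : 0 < nm z by rewrite nm_gt0.
have hr : r <= nm z by apply: le_trans h1 (le_trans (ler_norm _) (Im_le_nm z)).
have hI : complex.Im (- z^-1) = complex.Im z / nm z ^+ 2.
  by rewrite nm_sqr; case: (z) => a b /=; rewrite opprK.
split.
  rewrite hI ler_pdivlMr ?exprn_gt0 //; apply: le_trans h1.
  rewrite exprSr -mulrA mulrC -mulrA ler_piMr ?(ltW r0) // -exprMn exprn_ile1 ?mulr_ge0 ?(ltW r0) ?(ltW n0) //.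
  by have := ler_wpM2r (ltW r0) h2; rewrite mulVf ?gt_eqF // mulrC.
have r1 : r <= 1.
  rewrite leNgt; apply/negP => r1; have := le_trans hr h2; rewrite leNgt => /negP; apply.
  by rewrite (lt_trans _ r1) // invf_lt1.
rewrite nmN nmV lef_pV2 ?posrE ?exprn_gt0 //; apply: le_trans hr.
by rewrite exprS ler_piMr ?(ltW r0) // exprn_ile1 // ltW.
Qed.

(** The chain rule; the constants of [F] are taken on the region of parameter r^3, which contains
    the images. *)
Lemma holo_neg_inv F F' : holo F F' -> holo (fun z => F (- z^-1)) (fun z => F' (- z^-1) / z ^+ 2).
Proof.
move=> hF.
have hS : holo (fun z => - z^-1) (fun z => z ^- 2).
  have := holo_inv holo_id _; have : forall r : R, 0 < r -> exists2 k, 0 < k & forall z, region r z -> k <= nm z.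
    move=> r r0; exists r => // z [h _]; apply: le_trans h _; exact: le_trans (ler_norm _) (Im_le_nm z).
  move=> low /(_ low) hi.
  move=> r r0; have [M [d [M0 d0 b1 b2]]] := hi r r0; exists M, d; split=> //.
    by move=> z /b1; rewrite nmN mulN1r nmN.
  move=> z w hz hw hd; have := b2 z w hz hw hd; rewrite -nmN.
  by congr (nm _ <= _); rewrite mulN1r; ring.
move=> r r0.
have [N [e [N0 e0 b3 b4]]] := hS r r0.
have r3 : 0 < r ^+ 3 by rewrite exprn_gt0.
have [M [d [M0 d0 b1 b2]]] := hF _ r3.
pose K := M + M * N + M * (2 * N) ^+ 2 + M * N.
have K0 : 0 <= K by rewrite !addr_ge0 ?mulr_ge0 ?sqr_ge0.
exists K, (Num.min (Num.min 1 e) (d / (2 * N + 1))).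
have N1 : 0 < 2 * N + 1 by rewrite ltr_wpDl // mulr_ge0.
have p1 : 0 <= M * N by rewrite mulr_ge0.
have p2 : 0 <= M * (2 * N) ^+ 2 by rewrite mulr_ge0 ?sqr_ge0.
split=> //; first by rewrite !lt_min ltr01 e0 divr_gt0.
  move=> z hz; have [f1 f2] := b1 _ (region_neg_inv r0 hz); have [_ s2] := b3 z hz.
  split; first by rewrite /K; lra.
  have : nm (F' (- z^-1) / z ^+ 2) <= M * N by rewrite nmM ler_pM ?nm_ge0.
  rewrite /K; lra.
move=> z w hz hw; rewrite !le_min => /andP[/andP[h1 he] hd].
have k2 := b4 z w hz hw he; have [_ s2] := b3 z hz.
have [f1 f2] := b1 _ (region_neg_inv r0 hz).
set h := w - z in h1 he hd k2 *; set t := nm h in h1 he hd k2 *; have t0 : 0 <= t by exact: nm_ge0.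
set E := - w^-1 - - z^-1 - z ^- 2 * h in k2.
have dS : nm (- w^-1 - - z^-1) <= 2 * N * t.
  rewrite -[_ - _](subrK (z ^- 2 * h)) -/E; apply: le_trans (nmD _ _) _; rewrite nmM -/t.
  have : N * t ^+ 2 <= N * t by rewrite ler_wpM2l // expr2 ler_piMr.
  have : nm (z ^- 2) * t <= N * t by rewrite ler_wpM2r.
  lra.
have dd : nm (- w^-1 - - z^-1) <= d.
  apply: le_trans dS _; apply: (@le_trans _ _ ((2 * N + 1) * t)); first by rewrite ler_wpM2r // lerDl.
  by rewrite mulrC -ler_pdivlMr.
have k1 := b2 _ _ (region_neg_inv r0 hz) (region_neg_inv r0 hw) dd.
rewrite (_ : F (- w^-1) - _ - _ = (F (- w^-1) - F (- z^-1) - F' (- z^-1) * (- w^-1 - - z^-1)) + F' (- z^-1) * E); last first.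
  by rewrite /E; ring.
apply: le_trans (nmD _ _) _; rewrite nmM.
have q1 : nm (F' (- z^-1)) * nm E <= M * (N * t ^+ 2) by rewrite ler_pM ?nm_ge0.
have q2 : M * nm (- w^-1 - - z^-1) ^+ 2 <= M * (2 * N * t) ^+ 2.
  by rewrite ler_wpM2l // lerXn2r ?nnegrE ?nm_ge0 // !mulr_ge0.
have : 0 <= M * t ^+ 2 by rewrite mulr_ge0 ?sqr_ge0.
have : 0 <= M * N * t ^+ 2 by rewrite mulr_ge0 ?sqr_ge0.
move: k1 q1 q2; rewrite [(2 * N * t) ^+ 2]exprMn /K; lra.
Qed.

Lemma region_convex r z w (t : R) : 0 <= t <= 1 -> region r z -> region r w ->
  region r (z + t%:C * (w - z)).
Proof.
move=> /andP[t0 t1] [z1 z2] [w1 w2]; split.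
  move: z1 w1 {z2 w2}; case: z w => a b [a' b'] /=; rewrite !mul0r !addr0 => h1 h2; nra.
have -> : z + t%:C * (w - z) = (1 - t)%:C * z + t%:C * w by rewrite rmorphB rmorph1; ring.
apply: le_trans (nmD _ _) _; rewrite !nmM !nmR !ger0_norm ?subr_ge0 //.
have := ler_wpM2l t0 w2; have t1' : 0 <= 1 - t by rewrite subr_ge0.
have := ler_wpM2l t1' z2; lra.
Qed.

(** On a segment of length D cut into n + 1 equal steps each increment is at most M (D / (n + 1))^2,
    so the total change is O(1/n). *)
Lemma holo_const F : holo F (fun=> 0) -> forall z w, 0 < complex.Im z -> 0 < complex.Im w -> F z = F w.
Proof.
move=> hF z w z0 w0.
(* Small enough for one region to contain both end points, and by convexity the segment. *)
pose r := Num.min (Num.min (complex.Im z) (complex.Im w)) (Num.min (nm z)^-1 (nm w)^-1).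
have r0 : 0 < r by rewrite !lt_min z0 w0 !invr_gt0 !nm_gt0 !Im_neq0.
have hz : region r z.
  split; first by rewrite /r !ge_min lexx.
  by rewrite -[leLHS]invrK lef_pV2 ?posrE ?invr_gt0 ?nm_gt0 ?Im_neq0 // /r !ge_min lexx !orbT.
have hw : region r w.
  split; first by rewrite /r !ge_min lexx !orbT.
  by rewrite -[leLHS]invrK lef_pV2 ?posrE ?invr_gt0 ?nm_gt0 ?Im_neq0 // /r !ge_min lexx !orbT.
have [M [d [M0 d0 _ b]]] := hF r r0.
set D := nm (w - z).
pose p (n k : nat) : C := z + (k%:R / n.+1%:R)%:C * (w - z).
have hp n k : (k <= n.+1)%N -> region r (p n k).
  move=> kn; apply: region_convex => //; rewrite divr_ge0 //= ler_pdivrMr ?ltr0n // mul1r ler_nat //.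
have step n k : p n k.+1 - p n k = (n.+1%:R^-1)%:C * (w - z).
  by rewrite /p -natr1 mulrDl mul1r rmorphD; ring.
have sn n k : nm (p n k.+1 - p n k) = D / n.+1%:R.
  by rewrite step nmM nmR ger0_norm ?invr_ge0 // mulrC.
have [n0 hn0] : exists n0 : nat, D / d < n0%:R.
  by exists (Num.bound (D / d)); rewrite archi_boundP // divr_ge0 ?nm_ge0 // ltW.
have bound n k : (n0 <= n)%N -> (k <= n.+1)%N -> nm (F (p n k) - F z) <= k%:R * (M * (D / n.+1%:R) ^+ 2).
  move=> nn; elim: k => [|k ih] kn; first by rewrite /p mul0r mul0r addr0 subrr nm0 mul0r.
  rewrite -[F (p n k.+1) - _](subrK (F (p n k) - F z)); apply: le_trans (nmD _ _) _.
  rewrite -natr1 mulrDl mul1r addrC lerD ?ih 1?ltnW //.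
  have := b _ _ (hp n k (ltnW kn)) (hp n k.+1 kn); rewrite sn mul0r subr0.
  have -> : F (p n k.+1) - F z - (F (p n k) - F z) = F (p n k.+1) - F (p n k) by ring.
  apply; rewrite ler_pdivrMr ?ltr0n // mulrC -ler_pdivrMr //.
  by apply: le_trans (ltW hn0) _; rewrite ler_nat leqW.
have lim : clim (fun=> F w - F z) 0.
  apply: (@clim_unshift _ _ _ n0); apply: (@clim_inv _ (M * D ^+ 2)) => n.
  have := bound (n + n0)%N (n + n0).+1 (leq_addl _ _) (leqnn _).
  have -> : p (n + n0)%N (n + n0).+1 = w.
    by rewrite /p divff ?pnatr_eq0 // mul1r addrC subrK.
  rewrite subr0 => h; apply: le_trans h _.
  have n1 : (0 : R) < (n + n0).+1%:R by rewrite ltr0n.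
  have -> : (n + n0).+1%:R * (M * (D / (n + n0).+1%:R) ^+ 2) = M * D ^+ 2 / (n + n0).+1%:R.
    by field; rewrite gt_eqF.
  apply: ler_wpM2l; first by rewrite mulr_ge0 ?sqr_ge0.
  by rewrite lef_pV2 ?posrE ?ltr0n // ler_nat ltnS leq_addr.
by have /eqP := clim_unique (clim_cst (F w - F z)) lim; rewrite subr_eq0 => /eqP.
Qed.

Lemma holo_cexp (a : C) : (forall z, 0 <= complex.Im z -> nm (cexp (a * z)) <= 1) ->
  holo (fun z => cexp (a * z)) (fun z => a * cexp (a * z)).
Proof.
move=> ha r r0; have n0 := nm_ge0 a.
exists (1 + nm a + 4 * nm a ^+ 2), (2 * nm a + 1)^-1.
have n1 : 0 < 2 * nm a + 1 by rewrite ltr_wpDl // mulr_ge0.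
have n2 := sqr_ge0 (nm a).
split; rewrite ?invr_gt0 //; first by rewrite !addr_ge0 // mulr_ge0.
  move=> z hz; have k := ha z (ltW (region_Im r0 hz)); split; first by lra.
  by rewrite nmM; apply: (@le_trans _ _ (nm a)); [rewrite ler_piMr | lra].
move=> z w hz hw hd; have k := ha z (ltW (region_Im r0 hz)).
set h := w - z in hd *.
have ah : nm (a * h) <= 2^-1.
  rewrite nmM; have := ler_wpM2l (ltW n1) hd; rewrite divff ?gt_eqF //; have := nm_ge0 h; nra.
have -> : cexp (a * w) - cexp (a * z) - a * cexp (a * z) * h = cexp (a * z) * (cexp (a * h) - 1 - a * h).
  have -> : w = z + h by rewrite /h addrC subrK.
  by rewrite mulrDr cexpD; ring.
rewrite nmM; apply: (@le_trans _ _ (1 * (4 * nm (a * h) ^+ 2))).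
  by rewrite ler_pM ?nm_ge0 // cexp_approx.
rewrite mul1r nmM exprMn mulrA ler_wpM2r ?sqr_ge0 //; lra.
Qed.

(** * The Euler product and its logarithmic derivative *)

Definition eprod (n : nat) z : C := \prod_(i < n) (1 - qe z ^+ i.+1).
Definition eprod_lim z : C := limn (fun n => eprod n z : C^o).

(** Each factor satisfies 1 / (1 - rho^(i+1)) <= 1 + rho^i / (1 - rho) <= exp(rho^i / (1 - rho));
    this keeps the infinite product away from 0. *)
Lemma prod1B_lower (rho : R) n : 0 <= rho < 1 ->
  expR (- ((1 - rho)^-1 * (1 - rho)^-1)) <= \prod_(i < n) (1 - rho ^+ i.+1).
Proof.
move=> hr; have /andP[r0 r1] := hr; have q0 : 0 < 1 - rho by rewrite subr_gt0.
have step i : expR (- ((1 - rho)^-1 * rho ^+ i)) <= 1 - rho ^+ i.+1.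
  have le : rho ^+ i.+1 <= rho by rewrite exprS ler_piMr // exprn_ile1 // ltW.
  have p : 0 < 1 - rho ^+ i.+1 by rewrite subr_gt0 (le_lt_trans le).
  rewrite expRN -[leRHS]invrK lef_pV2 ?posrE ?expR_gt0 ?invr_gt0 //.
  apply: le_trans (expR_ge1Dx _).
  have -> : (1 - rho ^+ i.+1)^-1 = 1 + rho ^+ i.+1 / (1 - rho ^+ i.+1) by field; rewrite gt_eqF.
  rewrite lerD2l mulrC; apply: ler_pM; rewrite ?invr_ge0 ?(ltW p) ?exprn_ge0 //.
    by rewrite lef_pV2 ?posrE // lerD2l lerN2.
  by rewrite exprS ler_piMl ?exprn_ge0 // ltW.
apply: (@le_trans _ _ (\prod_(i < n) expR (- ((1 - rho)^-1 * rho ^+ i)))).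
  rewrite -expR_sum ler_expR sumrN lerN2 -mulr_sumr ler_wpM2l ?geo_sum_le //.
  by rewrite invr_ge0 ltW.
by apply: ler_prod => i _; rewrite expR_ge0 step.
Qed.

Lemma eprod_bounds n z rho : nm (qe z) <= rho -> rho < 1 ->
  nm (eprod n z) <= expR (1 - rho)^-1 /\
  expR (- ((1 - rho)^-1 * (1 - rho)^-1)) <= nm (eprod n z).
Proof.
move=> h r1; have r0 : 0 <= rho := le_trans (nm_ge0 _) h; rewrite /eprod (nm_prod (fun i => 1 - qe z ^+ i.+1)); split.
  apply: (@le_trans _ _ (\prod_(i < n) (1 + rho ^+ i.+1))).
    apply: ler_prod => i _; rewrite nm_ge0 /=; apply: le_trans (nmD _ _) _.
    by rewrite nm1 nmN nmX lerD2l lerXn2r ?nnegrE ?nm_ge0.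
  have := @prod_le_expR (fun i => rho ^+ i.+1) n (fun i => exprn_ge0 _ r0).
  move=> k; apply: le_trans k _; rewrite ler_expR.
  apply: (@le_trans _ _ (\sum_(i < n) rho ^+ i)); last by rewrite geo_sum_le ?r0.
  by apply: ler_sum => i _; rewrite exprS ler_piMl ?exprn_ge0 // ltW.
apply: le_trans (prod1B_lower n (_ : 0 <= rho < 1)) _; first by rewrite r0.
apply: ler_prod => i _; apply/andP; split.
  by rewrite subr_ge0 exprn_ile1 // ltW.
have := nmBr 1 (qe z ^+ i.+1); rewrite nm1 nmX; apply: le_trans.
by rewrite lerD2l lerN2 lerXn2r ?nnegrE ?nm_ge0.
Qed.

Lemma eprodP z : 0 < complex.Im z -> clim (fun n => eprod n z) (eprod_lim z).
Proof.
move=> z0; have q1 := nm_qe_lt1 z0; set rho := nm (qe z) in q1.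
have r0 : 0 <= rho by exact: nm_ge0.
pose a n := eprod n.+1 z - eprod n z.
have [|n|s hs] := @csum_abs R a (fun n => expR (1 - rho)^-1 * rho ^+ n) (expR (1 - rho)^-1 * (1 - rho)^-1).
- move=> i; rewrite /a /eprod big_ord_recr /= mulrBr mulr1 addrAC subrr add0r nmN nmM.
  apply: ler_pM; rewrite ?nm_ge0 //; first by have [] := eprod_bounds i (lexx rho) q1.
  by rewrite nmX exprS ler_piMl ?exprn_ge0 // ltW.
- by rewrite -mulr_sumr ler_wpM2l ?expR_ge0 // geo_sum_le // r0.
have l : clim (fun n => eprod n z) (s + 1).
  have := climD hs (@clim_cst _ 1); apply: clim_ext => n.
  rewrite -(big_mkord xpredT a) /a telescope_sumr // /eprod big_ord0 subrK //.
by rewrite /eprod_lim (clim_limn l).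
Qed.

Lemma clim_ge (u : nat -> C) l (B : R) : clim u l -> (forall n, B <= nm (u n)) -> B <= nm l.
Proof.
move=> /climP h hB; apply/ler_addgt0Pr => e e0; have [N hN] := h _ e0.
apply: le_trans (hB N) _; rewrite -[u N](subrK l) addrC; apply: le_trans (nmD _ _) _.
by rewrite lerD2l ltW // hN.
Qed.

Lemma eprod_lim_bounds z rho : 0 < complex.Im z -> nm (qe z) <= rho -> rho < 1 ->
  nm (eprod_lim z) <= expR (1 - rho)^-1 /\
  expR (- ((1 - rho)^-1 * (1 - rho)^-1)) <= nm (eprod_lim z).
Proof.
move=> z0 h r1; have l := eprodP z0; split.
  by apply: clim_le l _; exists 0%N => n _; have [] := eprod_bounds n h r1.
by apply: clim_ge l _ => n; have [] := eprod_bounds n h r1.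
Qed.

(** The increment is measured in units of [rho], so each induction step contributes one more factor
    [rho] and the bound stays summable over m. *)
Lemma pow_diff1 (q q' : C) (rho h : R) m : nm q <= rho -> nm q' <= rho -> nm (q' - q) <= rho * h ->
  nm (q' ^+ m - q ^+ m) <= m%:R * rho ^+ m * h.
Proof.
move=> h1 h2 h3; have r0 := le_trans (nm_ge0 _) h1.
elim: m => [|m ih]; first by rewrite subrr nm0 mul0r mul0r.
rewrite !exprS -natr1.
have -> : q' * q' ^+ m - q * q ^+ m = q' * (q' ^+ m - q ^+ m) + (q' - q) * q ^+ m by ring.
apply: le_trans (nmD _ _) _; rewrite !nmM nmX.
have a1 : nm q' * nm (q' ^+ m - q ^+ m) <= rho * (m%:R * rho ^+ m * h) by rewrite ler_pM ?nm_ge0.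
have a2 : nm (q' - q) * nm q ^+ m <= rho * h * rho ^+ m.
  by rewrite ler_pM ?nm_ge0 ?exprn_ge0 ?nm_ge0 // lerXn2r ?nnegrE ?nm_ge0.
have -> : (m%:R + 1) * (rho * rho ^+ m) * h = rho * (m%:R * rho ^+ m * h) + rho * h * rho ^+ m by ring.
exact: lerD.
Qed.

(** The second-order companion; it is applied with q = e(z), q' = e(w) and a = 2 pi i (w - z). *)
Lemma pow_diff2 (q q' a : C) (rho H : R) m : nm q <= rho -> nm q' <= rho ->
  nm (q' - q - a * q) <= rho * H -> nm (a * (q' - q)) <= rho * H ->
  nm (q' ^+ m - q ^+ m - m%:R * a * q ^+ m) <= m%:R ^+ 2 * rho ^+ m * H.
Proof.
move=> h1 h2 h3 h4; have r0 := le_trans (nm_ge0 _) h1.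
elim: m => [|m ih]; first by rewrite subrr !mul0r subrr nm0 expr0n mul0r mul0r.
rewrite (exprS q') (exprS q) (exprS rho) -natr1; set e := q' ^+ m - _ - _ in ih.
have -> : q' * q' ^+ m - q * q ^+ m - (m%:R + 1) * a * (q * q ^+ m)
  = q' * e + (q' - q - a * q) * q ^+ m + m%:R * (a * (q' - q)) * q ^+ m by rewrite /e; ring.
apply: le_trans (nmD _ _) _; apply: le_trans (lerD (nmD _ _) (lexx _)) _.
rewrite nmM (nmM _ (q ^+ m)) (nmM _ (q ^+ m)) (nmM m%:R) nm_nat nmX.
have qm : nm q ^+ m <= rho ^+ m by rewrite lerXn2r ?nnegrE ?nm_ge0.
have q0 : 0 <= nm q ^+ m by rewrite exprn_ge0 ?nm_ge0.
have a1 : nm q' * nm e <= rho * (m%:R ^+ 2 * rho ^+ m * H) by rewrite ler_pM ?nm_ge0.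
have a2 : nm (q' - q - a * q) * nm q ^+ m <= rho * H * rho ^+ m by rewrite ler_pM ?nm_ge0.
have a3 : m%:R * nm (a * (q' - q)) * nm q ^+ m <= m%:R * (rho * H) * rho ^+ m.
  by rewrite ler_pM ?mulr_ge0 ?nm_ge0 // ler_wpM2l.
have a4 : 0 <= m%:R * (rho * H) * rho ^+ m.
  by apply: le_trans a3; rewrite !mulr_ge0 ?nm_ge0.
have eR : (m.+1%:R : R) = m%:R + 1 by rewrite natr1.
rewrite eR; have -> : (m%:R + 1) ^+ 2 * (rho * rho ^+ m) * H
  = rho * (m%:R ^+ 2 * rho ^+ m * H) + rho * H * rho ^+ m + m%:R * (rho * H) * rho ^+ m
    + m%:R * (rho * H) * rho ^+ m by ring.
lra.
Qed.

(** A remainder bound for the partial products, uniform in n, passes to the limit. Their ratio at w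
    and z is a product of factors 1 + x i, and its linear part is -c (w - z) times the Lambert
    series. *)
Lemma holo_eprod : holo eprod_lim (fun z => - c * lambert1 z * eprod_lim z).
Proof.
move=> r r0; have p0 := @pi_gt0 R.
pose rho : R := expR (- (2 * pi * r)).
have r1 : rho < 1 by rewrite expR_lt1 oppr_lt0 !mulr_gt0.
have rp : 0 < rho by exact: expR_gt0.
have q0 : 0 < 1 - rho by rewrite subr_gt0.
have hq z : region r z -> nm (qe z) <= rho.
  by move=> [h _]; rewrite nm_qe ler_expR lerN2 ler_wpM2l // mulr_ge0 // ltW.
have [|B1 hB1] := @polygeo_bound R rho 1 _ isT; first by rewrite ltW.
have [|B2 hB2] := @polygeo_bound R rho 2 _ isT; first by rewrite ltW.
have B10 : 0 <= B1 by have := hB1 0%N; rewrite big_ord0.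
have B20 : 0 <= B2 by have := hB2 0%N; rewrite big_ord0.
pose M0 := expR (1 - rho)^-1; have M00 : 0 <= M0 by exact: expR_ge0.
have dn (m : nat) (q : C) : (0 < m)%N -> nm q <= rho -> nm (1 - q ^+ m)^-1 <= (1 - rho)^-1 /\ 1 - q ^+ m != 0.
  move=> m0 hqq.
  have a : 1 - rho <= nm (1 - q ^+ m).
    have := nmBr 1 (q ^+ m); rewrite nm1 nmX; apply: le_trans.
    rewrite lerD2l lerN2; case: m m0 => // m _; rewrite exprS; apply: (le_trans _ hqq).
    by rewrite ler_piMr ?nm_ge0 // exprn_ile1 ?nm_ge0 // (le_trans hqq) // ltW.
  by rewrite nmV lef_pV2 ?posrE ?(lt_le_trans q0 a) // -nm_gt0 (lt_le_trans q0 a).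
have lam z : region r z -> nm (lambert1 z) <= (1 - rho)^-1 * B1.
  move=> hz; have [_ l] := lambert1P (region_Im r0 hz).
  apply: (csum_le l (b := fun m => (1 - rho)^-1 * (m%:R ^+ 1 * rho ^+ m))); last first.
    by move=> n; rewrite -mulr_sumr ler_wpM2l // invr_ge0 ltW.
  case=> [|m]; first by rewrite mul0r nm0 expr1 mul0r mulr0.
  rewrite nmM nm_nat (nmM (qe z ^+ m.+1)) nmX expr1 [leRHS]mulrCA ler_wpM2l // [leRHS]mulrC ler_pM ?nm_ge0 ?exprn_ge0 ?nm_ge0 //.
    by rewrite lerXn2r ?nnegrE ?nm_ge0 ?(ltW rp) ?hq.
  by have [] := dn m.+1 _ isT (hq z hz).
(* [S1] bounds the sum of the |x i| per unit of |w - z|, and [S2] the second-order errors per unit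
   of its square; 32 and 256 come from the estimates of e(h) - 1 and e(h) - 1 - c h. *)
pose S1 := 32 / rho * (1 - rho)^-1 * B1.
pose S2 := 256 / rho * (1 - rho)^-1 * B2.
have S10 : 0 <= S1 by rewrite !mulr_ge0 ?invr_ge0 ?(ltW q0) ?(ltW rp).
have S20 : 0 <= S2 by rewrite !mulr_ge0 ?invr_ge0 ?ler0n ?(ltW q0) ?(ltW rp).
pose d := Num.min 16^-1 (2 * S1 + 1)^-1.
pose K := M0 + 8 * ((1 - rho)^-1 * B1) * M0 + M0 * (2 * S1 ^+ 2 + S2).
have k1 : 0 <= 8 * ((1 - rho)^-1 * B1) * M0 by rewrite !mulr_ge0 ?invr_ge0 ?(ltW q0).
have k2 : 0 <= M0 * (2 * S1 ^+ 2 + S2) by rewrite mulr_ge0 // addr_ge0 // mulr_ge0 ?sqr_ge0.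
have nc : nm c = 2 * pi by rewrite nmM nmi mulr1 nmR ger0_norm // mulr_ge0 // ltW.
have p4 := @pi_lt4 R.
exists K, d; split.
- by rewrite /K !addr_ge0.
- by rewrite lt_min !invr_gt0 ltr0n ltr_wpDl // mulr_ge0.
- move=> z hz; have [b1 _] := eprod_lim_bounds (region_Im r0 hz) (hq z hz) r1.
  rewrite -/M0 in b1; split; first by rewrite /K; lra.
  have l := lam z hz.
  have : nm (- c * lambert1 z * eprod_lim z) <= 8 * ((1 - rho)^-1 * B1) * M0.
    rewrite nmM nmM nmN nc ler_pM ?mulr_ge0 ?nm_ge0 ?(ltW p0) // ler_pM ?mulr_ge0 ?nm_ge0 ?(ltW p0) //; lra.
  rewrite /K; lra.
move=> z w hz hw; rewrite le_min => /andP[h16 hS].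
have z0 := region_Im r0 hz; have w0 := region_Im r0 hw.
set h := w - z in h16 hS *; set t := nm h in h16 hS *; have t0 : 0 <= t by exact: nm_ge0.
have hS1 : S1 * t <= 2^-1.
  have s1 : 0 < 2 * S1 + 1 by rewrite ltr_wpDl // mulr_ge0.
  have := ler_wpM2l (ltW s1) hS; rewrite divff ?gt_eqF //; nra.
set q := qe z; set q' := qe w.
have q1 : nm q <= rho by exact: hq.
have q1' : nm q' <= rho by exact: hq.
have qh : q' = q * qe h by rewrite /q' /q -qeD /h addrC subrK.
have ap := qe_approx h16; rewrite -/t in ap.
have t2 : t ^+ 2 <= t * 16^-1 by rewrite expr2 ler_wpM2l.
have e1 : nm (qe h - 1) <= 32 * t.
  rewrite -[qe h - 1](subrK (c * h)); apply: le_trans (nmD _ _) _; rewrite nmM nc -/t.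
  have : 2 * pi * t <= 8 * t by rewrite ler_wpM2r //; lra.
  lra.
have dq1 : nm (q' - q) <= rho * (32 / rho * t).
  rewrite qh -{2}[q]mulr1 -mulrBr nmM mulrA mulrCA divff ?gt_eqF // mulr1.
  by apply: le_trans e1; rewrite ler_piMl ?nm_ge0 // (le_trans q1) // ltW.
have rr : rho * (256 / rho * t ^+ 2) = 256 * t ^+ 2 by field; rewrite gt_eqF.
have ch : c * h * q = q * (c * h) by rewrite mulrC.
have nq1 : nm q <= 1 by rewrite (le_trans q1) // ltW.
have dq2 : nm (q' - q - c * h * q) <= rho * (256 / rho * t ^+ 2).
  rewrite rr ch qh (_ : q * qe h - q - q * (c * h) = q * (qe h - 1 - c * h)); last by ring.
  by rewrite nmM; apply: le_trans ap; rewrite ler_piMl ?nm_ge0.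
have dq3 : nm (c * h * (q' - q)) <= rho * (256 / rho * t ^+ 2).
  rewrite rr qh -{2}[q]mulr1 -mulrBr (nmM (c * h)) (nmM c) (nmM q) nc -/t.
  have : nm q * nm (qe h - 1) <= 32 * t by apply: le_trans e1; rewrite ler_piMl ?nm_ge0.
  move=> e2; apply: (@le_trans _ _ (8 * t * (32 * t))); last by rewrite expr2; lra.
  by rewrite ler_pM ?mulr_ge0 ?nm_ge0 ?(ltW p0) // ler_wpM2r //; lra.
(* [x i] is the relative change of the i-th factor from z to w, and -c h [y i] its linear part. *)
pose x (i : nat) : C := (q ^+ i.+1 - q' ^+ i.+1) / (1 - q ^+ i.+1).
pose y (i : nat) : C := i.+1%:R * (q ^+ i.+1 / (1 - q ^+ i.+1)).
have xb i : nm (x i) <= 32 / rho * (1 - rho)^-1 * (i.+1%:R ^+ 1 * rho ^+ i.+1) * t.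
  have [v _] := dn i.+1 q isT q1; rewrite /x nmM nmB.
  have := pow_diff1 i.+1 q1 q1' dq1 => v2.
  apply: le_trans (ler_pM (nm_ge0 _) (nm_ge0 _) v2 v) _.
  by rewrite expr1 le_eqVlt; apply/orP; left; apply/eqP; ring.
have yb i : nm (x i + c * h * y i) <= 256 / rho * (1 - rho)^-1 * (i.+1%:R ^+ 2 * rho ^+ i.+1) * t ^+ 2.
  have [v _] := dn i.+1 q isT q1.
  have := pow_diff2 i.+1 q1 q1' dq2 dq3 => v2.
  rewrite (_ : x i + c * h * y i = - (q' ^+ i.+1 - q ^+ i.+1 - i.+1%:R * (c * h) * q ^+ i.+1) / (1 - q ^+ i.+1)); last first.
    by rewrite /x /y; ring.
  rewrite nmM nmN; apply: le_trans (ler_pM (nm_ge0 _) (nm_ge0 _) v2 v) _.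
  by rewrite le_eqVlt; apply/orP; left; apply/eqP; ring.
have shift k n B : (forall n, \sum_(i < n) i%:R ^+ k * rho ^+ i <= B) ->
   \sum_(i < n) (i.+1%:R ^+ k * rho ^+ i.+1) <= B.
  move=> hB; apply: le_trans (hB n.+1); rewrite big_ord_recl /= lerDr.
  by rewrite mulr_ge0 ?exprn_ge0 // ltW.
have sx n : \sum_(i < n) nm (x i) <= S1 * t.
  apply: le_trans (ler_sum _ (fun (i : 'I_n) _ => xb i)) _; rewrite -mulr_suml -mulr_sumr ler_wpM2r //.
  by rewrite ler_wpM2l ?(shift 1%N) // !mulr_ge0 ?invr_ge0 ?(ltW q0) ?(ltW rp).
have sy n : nm (\sum_(i < n) x i + c * h * \sum_(i < n) y i) <= S2 * t ^+ 2.
  rewrite mulr_sumr -big_split /=; apply: le_trans (nm_sum _ _ _) _.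
  apply: le_trans (ler_sum _ (fun (i : 'I_n) _ => yb i)) _; rewrite -mulr_suml -mulr_sumr ler_wpM2r ?sqr_ge0 //.
  by rewrite ler_wpM2l ?(shift 2) ?mulr_ge0 ?invr_ge0 ?ler0n ?(ltW q0) ?(ltW rp).
have pe n : eprod n w = eprod n z * \prod_(i < n) (1 + x i).
  rewrite /eprod -big_split /=; apply: eq_bigr => i _.
  have [_ v] := dn i.+1 q isT q1; rewrite /x -/q -/q' in v *; by field.
have fin n : nm (eprod n w - eprod n z - - c * (\sum_(i < n) y i) * eprod n z * h) <= M0 * (2 * S1 ^+ 2 + S2) * t ^+ 2.
  rewrite pe.
  rewrite (_ : _ - _ = eprod n z * ((\prod_(i < n) (1 + x i) - 1 - \sum_(i < n) x i)
    + (\sum_(i < n) x i + c * h * \sum_(i < n) y i))); last by ring.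
  rewrite nmM -(mulrA M0); apply: ler_pM; rewrite ?nm_ge0 //; first by have [] := eprod_bounds n q1 r1.
  apply: le_trans (nmD _ _) _; rewrite (mulrDl (2 * S1 ^+ 2)); apply: lerD => //.
  apply: le_trans (prod1D_linear (sx n) hS1) _; rewrite exprMn; lra.
have ly : clim (fun n => \sum_(i < n) y i) (lambert1 z).
  have [_ l] := lambert1P z0; have := clim_shift 1 l; apply: clim_ext => n.
  by rewrite addn1 big_ord_recl mul0r add0r.
have lim := climB (climB (eprodP w0) (eprodP z0))
  (climM (climM (@climZ _ (- c) _ _ ly) (eprodP z0)) (@clim_cst _ h)).
apply: (@le_trans _ _ (M0 * (2 * S1 ^+ 2 + S2) * t ^+ 2)).
  by apply: clim_le lim _; exists 0%N => n _; exact: fin.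
rewrite ler_wpM2r ?sqr_ge0 // /K; lra.
Qed.

End Eta.

(** * Transformation rules of f *)

Section Modularity.
Variable R : realType.
Local Notation C := R[i].
Local Notation c := ((2 * pi)%:C * 'i%C : C).
Implicit Types z w : C.

(** The square of eta has weight one: its inversion formula has the factor -iz instead of a square
    root, and f is built from such squares. *)
Definition eta2 z : C := cexp (c / 12 * z) * (eprod_lim z * eprod_lim z).

Lemma eta_sqr z : 0 < complex.Im z -> eta z ^+ 2 = eta2 z.
Proof.
move=> z0; rewrite /eta /eta2 exprMn; congr (_ * _).
  have e : (2 * pi)%:C = 2 * pi%:C :> C by rewrite rmorphM /= rmorph_nat.
  by rewrite expr2 -cexpD e; congr cexp; move: (pi%:C : C) => p; field.
rewrite -expr2; congr (_ ^+ 2); apply: clim_limn; apply: (@clim_unshift _ _ _ 1).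
apply: clim_ext (eprodP z0) => n; rewrite addn1 big_add1 big_mkord.
by apply: eq_bigr => i _; rewrite qexpE.
Qed.

Lemma Re_c12 z : complex.Re (c / 12 * z) = - (pi / 6 * complex.Im z).
Proof.
have -> : c / 12 = 0 +i* (pi / 6).
  have -> : (12 : C)^-1 = (12^-1)%:C by rewrite fmorphV /= rmorph_nat.
  by simpc; congr (_ +i* _); field.
by case: z => a b /=; ring.
Qed.

Lemma holo_eta2 : holo eta2 (fun z => c / 12 * (1 - 24 * lambert1 z) * eta2 z).
Proof.
have h1 : holo (fun z => cexp (c / 12 * z)) (fun z => c / 12 * cexp (c / 12 * z)).
  apply: holo_cexp => z z0; rewrite nm_cexp Re_c12 expR_le1 oppr_le0 mulr_ge0 // divr_ge0 ?pi_ge0 //.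
have := holo_mul h1 (holo_mul (@holo_eprod R) (@holo_eprod R)).
apply: holo_ext => z _ //; rewrite /eta2; by field.
Qed.

(** The upper bound on |z| in [region] enters here, as the exponential prefactor decays when Im z
    grows. *)
Lemma eta2_lower r : 0 < r -> exists2 k, 0 < k & forall z, region r z -> k <= nm (eta2 z).
Proof.
move=> r0; have p0 := @pi_gt0 R.
pose rho : R := expR (- (2 * pi * r)).
have r1 : rho < 1 by rewrite expR_lt1 oppr_lt0 !mulr_gt0.
pose k := expR (- (pi / 6 * r^-1)) * (expR (- ((1 - rho)^-1 * (1 - rho)^-1)) * expR (- ((1 - rho)^-1 * (1 - rho)^-1))).
exists k; first by rewrite !mulr_gt0 ?expR_gt0.
move=> z hz; have [h1 h2] := hz; have z0 := region_Im r0 hz.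
have hq : nm (qe z) <= rho.
  by rewrite nm_qe ler_expR lerN2 ler_wpM2l // mulr_ge0 // ltW.
have [_ l] := eprod_lim_bounds z0 hq r1.
rewrite /eta2 nmM (nmM (eprod_lim z)) nm_cexp Re_c12.
rewrite ler_pM ?mulr_ge0 ?expR_ge0 // ?ler_pM ?expR_ge0 // ler_expR lerN2 ler_wpM2l ?divr_ge0 ?(ltW p0) //.
exact: le_trans (le_trans (ler_norm _) (Im_le_nm z)) h2.
Qed.

Lemma eta2_neq0 z : 0 < complex.Im z -> eta2 z != 0.
Proof.
move=> z0; pose r := Num.min (complex.Im z) (nm z)^-1.
have r0 : 0 < r by rewrite lt_min z0 invr_gt0 nm_gt0 Im_neq0.
have [k k0 hk] := eta2_lower r0; rewrite -nm_gt0; apply: lt_le_trans k0 (hk z _).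
split; first by rewrite ge_min lexx.
by rewrite -[leLHS]invrK lef_pV2 ?posrE ?invr_gt0 ?nm_gt0 ?Im_neq0 // ge_min lexx orbT.
Qed.

(* The quotient of both sides has logarithmic derivative zero by the
   transformation of the weight 2 Eisenstein series. *)
Theorem eta2_neg_inv z : 0 < complex.Im z -> eta2 (- z^-1) = - 'i%C * z * eta2 z.
Proof.
move=> z0; have cn : c != 0 by exact: c_neq0.
pose J z := eta2 (- z^-1) * (z * eta2 z)^-1.
have low r : 0 < r -> exists2 k, 0 < k & forall z, region r z -> k <= nm (z * eta2 z).
  move=> r0; have [k k0 hk] := eta2_lower r0; exists (r * k); first exact: mulr_gt0.
  move=> w hw; rewrite nmM ler_pM ?(ltW r0) ?(ltW k0) ?hk //.
  by have [h _] := hw; apply: le_trans h (le_trans (ler_norm _) (Im_le_nm w)).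
have hJ : holo J (fun=> 0).
  have := holo_mul (holo_neg_inv holo_eta2) (holo_inv (holo_mul (@holo_id R) holo_eta2) low).
  apply: holo_ext => w w0 //=; have wn := Im_neq0 w0; have en := eta2_neq0 w0.
  rewrite (lambert1_neg_inv w0); move: (lambert1 w) (eta2 (- w^-1)) cn => a b; move: en.
  move: (eta2 w) => e en cn; move: cn; set d := c => cn.
  by field; rewrite wn en cn.
(* The constant value of [J] is read off at i, the fixed point of z |-> -1/z. *)
have i0 : 0 < complex.Im ('i%C : C) by rewrite /= ltr01.
have ii : - ('i%C : C)^-1 = 'i%C.
  have i2 : ('i%C : C) ^+ 2 = -1 by exact: sqr_i.
  have in0 : ('i%C : C) != 0 by exact: Im_neq0.
  by apply: (mulfI in0); rewrite mulrN divff // -expr2 i2.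
have zn := Im_neq0 z0; have en := eta2_neq0 z0.
have := holo_const hJ z0 i0; rewrite /J ii => E.
have ein := eta2_neq0 i0.
have iv : ('i%C : C)^-1 = - 'i%C by apply: oppr_inj; rewrite ii opprK.
have {}E : eta2 (- z^-1) * (z * eta2 z)^-1 = - 'i%C.
  by rewrite E invfM mulrCA (mulfV ein) mulr1 iv.
by rewrite -[LHS](divfK (mulf_neq0 zn en)) E mulrA.
Qed.

Definition zeta12 : C := cexp (c / 12).

Lemma zeta12_6 : zeta12 ^+ 6 = -1.
Proof.
have h : zeta12 ^+ 6 = cexp (c / 2).
  have -> : c / 2 = c / 12 + c / 12 + c / 12 + c / 12 + c / 12 + c / 12 by set d := c; field.
  by rewrite !cexpD !exprS expr0 mulr1 !mulrA.
rewrite h -qeE; have [_] := qe_half (0 : C); rewrite add0r mul1r mul0r qe0 => //.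
Qed.

Lemma eta2D1 z : eta2 (z + 1) = zeta12 * eta2 z.
Proof.
have e : eprod_lim (z + 1) = eprod_lim z.
  apply: (congr1 (fun u : nat -> C^o => limn u)); apply/funext => n.
  by apply: eq_bigr => i _; rewrite qeD1.
by rewrite /eta2 e mulrDr mulr1 cexpD /zeta12; ring.
Qed.

Lemma eta2Dn z n : eta2 (z + n%:R) = zeta12 ^+ n * eta2 z.
Proof.
elim: n => [|n ih]; first by rewrite addr0 mul1r.
by rewrite -natr1 addrA eta2D1 ih exprS mulrA.
Qed.

Lemma E4Dn z n : E4 (z + n%:R) = E4 z.
Proof.
have h w : E4 (w + 1) = E4 w.
  apply: (congr1 (fun u : nat -> C^o => 1 + 240 * limn u)); apply/funext => N; apply: eq_bigr => m _.
  by rewrite !qexpE qeD1.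
by elim: n => [|n ih]; rewrite ?addr0 // -natr1 addrA h.
Qed.

Definition fnum z : C := E4 z - 4 * E4 (2 * z) - 9 * E4 (3 * z) + 36 * E4 (6 * z).
Definition fden z : C := eta2 z * eta2 (2 * z) * eta2 (3 * z) * eta2 (6 * z).

Lemma fE z : 0 < complex.Im z -> f z = 24^-1 * (fnum z / fden z).
Proof.
move=> z0; rewrite /f /fden -!eta_sqr ?(@Im_natmul R 1) ?(@Im_natmul R 2) ?(@Im_natmul R 5) //.
by rewrite !exprMn.
Qed.

Lemma fden_neq0 z : 0 < complex.Im z -> fden z != 0.
Proof.
move=> z0; have i2 := @Im_natmul R 1 _ z0; have i3 := @Im_natmul R 2 _ z0; have i6 := @Im_natmul R 5 _ z0.
exact: (mulf_neq0 (mulf_neq0 (mulf_neq0 (eta2_neq0 z0) (eta2_neq0 i2)) (eta2_neq0 i3)) (eta2_neq0 i6)).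
Qed.

Lemma f_add1 z : 0 < complex.Im z -> f (z + 1) = f z.
Proof.
move=> z0; have z1 : 0 < complex.Im (z + 1) by rewrite raddfD /= addr0.
have a2 : 2 * (z + 1) = 2 * z + 2%:R by ring.
have a3 : 3 * (z + 1) = 3 * z + 3%:R by ring.
have a6 : 6 * (z + 1) = 6 * z + 6%:R by ring.
rewrite (fE z1) (fE z0).
have -> : fnum (z + 1) = fnum z by rewrite /fnum a2 a3 a6 (E4Dn z 1) !E4Dn.
suff -> : fden (z + 1) = fden z by [].
rewrite /fden a2 a3 a6 (eta2Dn z 1) !eta2Dn.
have y12 : zeta12 ^+ 12 = 1 by rewrite (exprM _ 6 2) zeta12_6 sqrrN expr1n.
(* The exponents 1 + 2 + 3 + 6 add up to 12, and [zeta12] is a twelfth root of unity. *)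
transitivity (zeta12 ^+ 12 * (eta2 z * eta2 (2 * z) * eta2 (3 * z) * eta2 (6 * z))); last by rewrite y12 mul1r.
clear; move: zeta12 (eta2 z) (eta2 (2 * z)) (eta2 (3 * z)) (eta2 (6 * z)) => y a b e g; ring.
Qed.

(** Up to inversion, W_6 interchanges z with 6z and 2z with 3z; numerator and denominator both
    acquire 36 z^4. *)
Lemma f_W6 z : 0 < complex.Im z -> f (- (6 * z)^-1) = f z.
Proof.
move=> z0; have i2 := @Im_natmul R 1 _ z0; have i3 := @Im_natmul R 2 _ z0; have i6 := @Im_natmul R 5 _ z0.
have zn := Im_neq0 z0; have w0 := Im_neg_inv i6.
have e1 : 2 * - (6 * z)^-1 = - (3 * z)^-1 by field.
have e2 : 3 * - (6 * z)^-1 = - (2 * z)^-1 by field.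
have e3 : 6 * - (6 * z)^-1 = - z^-1 by field.
rewrite (fE w0) (fE z0).
have -> : fnum (- (6 * z)^-1) = 36 * z ^+ 4 * fnum z.
  by rewrite /fnum e1 e2 e3 (E4_neg_inv z0) (E4_neg_inv i2) (E4_neg_inv i3) (E4_neg_inv i6); ring.
have -> : fden (- (6 * z)^-1) = 36 * z ^+ 4 * fden z.
  rewrite /fden e1 e2 e3 (eta2_neg_inv z0) (eta2_neg_inv i2) (eta2_neg_inv i3) (eta2_neg_inv i6).
  have i4 : ('i%C : C) ^+ 4 = 1 by rewrite (exprM _ 2 2) sqr_i sqrrN expr1n.
  transitivity ('i%C ^+ 4 * (36 * z ^+ 4 * (eta2 z * eta2 (2 * z) * eta2 (3 * z) * eta2 (6 * z)))); last by rewrite i4 mul1r.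
  clear;   move: ('i%C : C) (eta2 z) (eta2 (2 * z)) (eta2 (3 * z)) (eta2 (6 * z)) => j a b e g; ring.
by congr (_ * _); have := fden_neq0 z0 => fn; field; rewrite fn zn.
Qed.

Lemma Im_addn z n : complex.Im (z + n%:R) = complex.Im z.
Proof. by rewrite -(rmorph_nat (real_complex R)); case: z => a b; rewrite /= addr0. Qed.

Lemma Im_subn z n : complex.Im (z - n%:R) = complex.Im z.
Proof. by rewrite -{2}[z](subrK n%:R) Im_addn. Qed.

Lemma Im_gen z : 0 < complex.Im z -> 2 * z + 1 != 0 /\ 0 < complex.Im (- z^-1 - 2).
Proof.
move=> z0; have i2 := @Im_natmul R 1 _ z0; split.
  by apply: Im_neq0; rewrite raddfD /= addr0.
by rewrite (Im_subn _ 2); exact: Im_neg_inv.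
Qed.

(** This map is inversion, translation by -2 and inversion again, so the rules already proved
    apply. *)
Lemma frac_eq z : 0 < complex.Im z -> z / (2 * z + 1) = - (- z^-1 - 2)^-1.
Proof.
move=> z0; have zn := Im_neq0 z0; have [n1 n2] := Im_gen z0; have := Im_neq0 n2 => n3.
have e : - z^-1 - 2 = - (2 * z + 1) / z by field.
by rewrite e invfM invrK invrN mulNr opprK mulrC.
Qed.

Lemma E4_frac z : 0 < complex.Im z -> E4 (z / (2 * z + 1)) = (2 * z + 1) ^+ 4 * E4 z.
Proof.
move=> z0; have zn := Im_neq0 z0; have [n1 n2] := Im_gen z0.
have e : (- z^-1 - 2) * z = - (2 * z + 1) by field.
rewrite (frac_eq z0) (E4_neg_inv n2) -(E4Dn _ 2) subrK (E4_neg_inv z0) mulrA -exprMn e.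
by rewrite exprNn -signr_odd expr0 mul1r.
Qed.

Lemma eta2_frac z : 0 < complex.Im z ->
  eta2 (z / (2 * z + 1)) = (2 * z + 1) * zeta12 ^- 2 * eta2 z.
Proof.
move=> z0; have zn := Im_neq0 z0; have [n1 n2] := Im_gen z0.
have z12 : zeta12 != 0 by exact: cexp_neq0.
have h : eta2 (- z^-1 - 2) = zeta12 ^- 2 * eta2 (- z^-1).
  by have := eta2Dn (- z^-1 - 2) 2; rewrite subrK => ->; rewrite mulKf // expf_neq0.
rewrite (frac_eq z0) (eta2_neg_inv n2) h (eta2_neg_inv z0).
have i2 : ('i%C : C) ^+ 2 = -1 by exact: sqr_i.
rewrite [LHS](_ : _ = 'i%C ^+ 2 * (- (2 * z + 1) * zeta12 ^- 2 * eta2 z)); first by rewrite i2; ring.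
by field; rewrite zn z12.
Qed.

(** W_3 interchanges z with 3z and 2z with 6z. The coefficients 1, -4, -9, 36 reappear multiplied by
    -9 (2z + 1)^4, while the denominator acquires 9 (2z + 1)^4. *)
Lemma f_W3 z : 0 < complex.Im z -> f ((3 * z + 1) / (6 * z + 3)) = - f z.
Proof.
move=> z0; have i2 := @Im_natmul R 1 _ z0; have i3 := @Im_natmul R 2 _ z0; have i6 := @Im_natmul R 5 _ z0.
have zn := Im_neq0 z0; have [n1 _] := Im_gen z0.
have u0 : 0 < complex.Im (3 * z + 1) by rewrite raddfD /= addr0.
have v0 : 0 < complex.Im (2 * z + 1) by rewrite raddfD /= addr0.
have w0 : 0 < complex.Im (6 * z + 3) by rewrite (Im_addn _ 3).
have wE : 6 * z + 3 = 3 * (2 * z + 1) by ring.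
have n6 : 6 * z + 3 != 0 by exact: Im_neq0.
have uE : 2 * (3 * z + 1) + 1 = 6 * z + 3 by ring.
set t := (3 * z + 1) / (6 * z + 3).
have t1 : t = (3 * z + 1) / (2 * (3 * z + 1) + 1) by rewrite uE.
have t2 : 2 * t = - (6 * z + 3)^-1 + 1%:R by rewrite /t; field.
have t3 : 3 * t = z / (2 * z + 1) + 1%:R by rewrite /t wE; field.
have t6 : 6 * t = - (2 * z + 1)^-1 + 3%:R by rewrite /t wE; field.
have it : 0 < complex.Im t.
  rewrite t1 (frac_eq u0); apply: Im_neg_inv; exact: (Im_gen u0).2.
have z12 : zeta12 != 0 by exact: cexp_neq0.
rewrite (fE it) (fE z0).
have -> : fnum t = - (9 * (2 * z + 1) ^+ 4 * fnum z).
  rewrite /fnum t2 t3 t6 t1 !E4Dn (E4_frac u0) (E4_frac z0) uE (E4_neg_inv w0) (E4_neg_inv v0) -[3 * z + 1]/(3 * z + 1%:R).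
  by rewrite !E4Dn (E4Dn (2 * z) 1) wE; ring.
have -> : fden t = 9 * (2 * z + 1) ^+ 4 * fden z.
  rewrite /fden t2 t3 t6 t1 !eta2Dn (eta2_frac u0) (eta2_frac z0) uE (eta2_neg_inv w0) (eta2_neg_inv v0) -[3 * z + 1]/(3 * z + 1%:R).
  rewrite (_ : eta2 (2 * z + 1) = zeta12 ^+ 1 * eta2 (2 * z)) ?(eta2Dn _ 1) ?eta2Dn ?wE; last by [].
  (* The two inversions of eta^2 contribute i^2; the translations contribute the exponent 10 and the
     two maps z / (2z + 1) the exponent -4. *)
  have i6' : ('i%C : C) ^+ 2 * zeta12 ^+ 6 = 1 by rewrite sqr_i zeta12_6 mulrNN mulr1.
  transitivity (('i%C ^+ 2 * zeta12 ^+ 6) * (9 * (2 * z + 1) ^+ 4 *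
    (eta2 z * eta2 (2 * z) * eta2 (3 * z) * eta2 (6 * z)))); last by rewrite i6' mul1r.
  move: z12; clear.
  move: ('i%C : C) zeta12 (eta2 z) (eta2 (2 * z)) (eta2 (3 * z)) (eta2 (6 * z)) => j y a b e g y0.
  by field.
have := fden_neq0 z0 => fn; by field; rewrite fn n1.
Qed.

End Modularity.

(** * Growth of f at the cusp *)

Section Growth.
Variable R : realType.
Local Notation C := R[i].
Local Notation c := ((2 * pi)%:C * 'i%C : C).
Implicit Types z w : C.

Lemma sigma_le k n : (0 < n)%N -> (sigma k n <= n ^ k.+1)%N.
Proof.
move=> n0; rewrite /sigma big_seq.
apply: (@leq_trans (\sum_(d <- divisors n | d \in divisors n) n ^ k)).
  by apply: leq_sum => d; rewrite -dvdn_divisors // => /(dvdn_leq n0) h; case: k => // k; rewrite leq_exp2r.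
rewrite -big_seq big_const_seq count_predT iter_addn_0 expnSr leq_mul2l; apply/orP; right.
rewrite -[leqRHS](size_iota 1); apply: uniq_leq_size; first exact: divisors_uniq.
by move=> d; rewrite -dvdn_divisors // mem_iota add1n ltnS => h; rewrite (dvdn_gt0 n0 h) dvdn_leq.
Qed.

Lemma prod1B_ge (a : nat -> R) n : (forall i, 0 <= a i <= 1) ->
  1 - \sum_(i < n) a i <= \prod_(i < n) (1 - a i).
Proof.
move=> ha; elim: n => [|n ih]; first by rewrite !big_ord0 subr0.
have p1 : \prod_(i < n) (1 - a i) <= 1.
  by apply: prodr_ile1 => i _; have := ha i; lra.
rewrite !big_ord_recr /=; have := ha n; nra.
Qed.

(** Since (1 + a)(1 - a) <= 1, this inverts the lower bound of [prod1B_ge]. *)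
Lemma prod1D_le (a : nat -> R) n s : (forall i, 0 <= a i <= 1) -> \sum_(i < n) a i <= s -> s < 1 ->
  \prod_(i < n) (1 + a i) <= (1 - s)^-1.
Proof.
move=> ha hs s1; have s0 : 0 < 1 - s by rewrite subr_gt0.
have h : (\prod_(i < n) (1 + a i)) * (\prod_(i < n) (1 - a i)) <= 1.
  rewrite -big_split /=; apply: prodr_ile1 => i _; have := ha i; nra.
have h2 := prod1B_ge n ha.
have p0 : 0 <= \prod_(i < n) (1 + a i) by rewrite prodr_ge0 // => i _; have := ha i; lra.
rewrite -div1r ler_pdivlMr //; apply: le_trans h; apply: ler_wpM2l => //; lra.
Qed.

(** About 0.43. As an eighth power it lets [polygeo_sum] with t = 9/10 bound the sum of n^4 rho^n by
    10^5; it is also large enough for [qe_small], which estimates pi from below by 2. *)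
Let rho : R := (9 / 10) ^+ 8.
Let rho_bounds : 430 / 1000 <= rho <= 431 / 1000.
Proof.
have e : rho = ((9 / 10) ^+ 2 ^+ 2) ^+ 2 by rewrite -!exprM.
have -> : rho = ((9 / 10) ^+ 2 * (9 / 10) ^+ 2) * ((9 / 10) ^+ 2 * (9 / 10) ^+ 2) by rewrite e; ring.
have -> : (9 / 10 : R) ^+ 2 = 81 / 100 by field.
clear e; lra.
Qed.

(** With s = q / (1 - q) <= 0.76 the product lies within 1/(1 - s) - 1 <= 8q of 1, and its modulus
    is at least 1 - s >= 0.24. *)
Lemma eprod_near1 w q : 0 < complex.Im w -> nm (qe w) <= q -> q <= rho ->
  nm (eprod_lim w - 1) <= 8 * q /\ 10^-1 <= nm (eprod_lim w).
Proof.
move=> w0 hq qr; have l := eprodP w0; have q0 : 0 <= q := le_trans (nm_ge0 _) hq.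
have /andP[rE1 rE2] := rho_bounds.
have q1 : q < 1 by lra.
pose a (i : nat) := q ^+ i.+1.
have ha i : 0 <= a i <= 1 by rewrite exprn_ge0 // exprn_ile1 // ltW.
have qn i : nm (qe w ^+ i.+1) <= a i by rewrite nmX lerXn2r ?nnegrE ?nm_ge0.
pose s := q / (1 - q).
have sE : s * (1 - q) = q by rewrite /s divfK // subr_eq0 gt_eqF.
have hs n : \sum_(i < n) a i <= s.
  rewrite /a /s; under eq_bigr do rewrite exprS; rewrite -mulr_sumr ler_wpM2l //.
  by rewrite geo_sum_le // q0.
have s2 : s <= 76 / 100 by nra.
have s0 : 0 <= s by rewrite divr_ge0 // subr_ge0 ltW.
have s3 : s <= 176 / 100 * q by nra.
have sp : 0 < 1 - s by lra.
split.
  have := climB l (@clim_cst _ 1); move/clim_le; apply; exists 0%N => n _.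
  have -> : eprod n w = \prod_(i < n) (1 + (- qe w ^+ i.+1)) by [].
  apply: le_trans (prod1D_approx (fun i => - qe w ^+ i.+1) n).2 _.
  apply: (@le_trans _ _ (\prod_(i < n) (1 + a i) - 1)).
    rewrite lerD2r; apply: ler_prod => i _; rewrite nmN addr_ge0 ?nm_ge0 //= lerD2l //.
  have := prod1D_le ha (hs n) (ltac:(lra)).
  have : (1 - s)^-1 - 1 <= 8 * q.
    have -> : (1 - s)^-1 - 1 = s / (1 - s) by field; rewrite gt_eqF.
    by rewrite ler_pdivrMr //; nra.
  lra.
apply: (@le_trans _ _ (24 / 100)); first by lra.
apply: clim_ge l _ => n; rewrite /eprod (nm_prod (fun i => 1 - qe w ^+ i.+1)).
apply: (@le_trans _ _ (\prod_(i < n) (1 - a i))).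
  by have := prod1B_ge n ha; have := hs n; lra.
apply: ler_prod => i _; rewrite subr_ge0; have /andP[_ ->] := ha i => /=.
by have := nmBr 1 (qe w ^+ i.+1); rewrite nm1; have := qn i; lra.
Qed.

(** sigma_3(n) <= n^4 and q^n <= (q / rho) rho^n; the sum of n^4 rho^n is at most 10^5, and 1 / rho
    at most 3. *)
Lemma E4_near1 w q : 0 < complex.Im w -> nm (qe w) <= q -> q <= rho ->
  nm (E4 w - 1) <= 240 * (3 * (10 ^+ 5 * q)).
Proof.
move=> w0 hq qr; have [A [-> hA _]] := E4_lambert w0.
have q0 : 0 <= q := le_trans (nm_ge0 _) hq.
have /andP[rE1 rE2] := rho_bounds.
have rp : 0 < rho by lra.
rewrite addrAC subrr add0r nmM nm_nat; apply: ler_wpM2l; first exact: ler0n.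
have h : nm A <= q / rho * 10 ^+ 5.
  apply: (csum_le hA (b := fun n => q / rho * (n%:R ^+ 4 * rho ^+ n))).
    case=> [|n]; first by rewrite !mul0r nm0 expr0n mul0r mulr0.
    rewrite mul1r nmM nm_nat nmX.
    have -> : q / rho * (n.+1%:R ^+ 4 * rho ^+ n.+1) = n.+1%:R ^+ 4 * (q * rho ^+ n).
      by rewrite [rho ^+ n.+1]exprS; move: rho rp => r rp; field; rewrite gt_eqF.
    apply: ler_pM; rewrite ?exprn_ge0 ?nm_ge0 //.
      by rewrite -natrX ler_nat; exact: sigma_le.
    apply: (@le_trans _ _ (q ^+ n.+1)); first by rewrite lerXn2r ?nnegrE ?nm_ge0.
    by rewrite exprS ler_wpM2l // lerXn2r ?nnegrE // ltW.
  move=> n; rewrite -mulr_sumr ler_wpM2l ?divr_ge0 ?(ltW rp) //.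
  have := @polygeo_sum R (9 / 10) 4 n _ isT; rewrite -/rho => h.
  have t1 : 0 <= (9 / 10 : R) < 1 by apply/andP; split; lra.
  apply: le_trans (h t1) _.
  have -> : (1 - 9 / 10 : R)^-1 = 10 by field.
  rewrite -exprSr; by rewrite le_eqVlt; apply/orP; left; apply/eqP; ring.
apply: le_trans h _; rewrite mulrAC ler_pdivrMr //.
have : 0 <= (10 : R) ^+ 5 by rewrite exprn_ge0.
move: ((10 : R) ^+ 5) => B B0; have := mulr_ge0 (mulr_ge0 B0 q0) (_ : 0 <= 3 * rho - 1).
move: rho rE1 => r rE1 /(_ ltac:(lra)); lra.
Qed.

Lemma nm_mul_near1 (x y : C) (a b B : R) : nm (x - 1) <= a -> nm (y - 1) <= b -> nm y <= B ->
  nm (x * y - 1) <= a * B + b.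
Proof.
move=> h1 h2 h3; have -> : x * y - 1 = (x - 1) * y + (y - 1) by ring.
by apply: le_trans (nmD _ _) _; rewrite nmM lerD // ler_pM ?nm_ge0.
Qed.

Lemma sqr_near1 P (q : R) : q <= 1 / 2 -> nm (P - 1) <= 8 * q ->
  nm (P * P - 1) <= 48 * q /\ nm (P * P) <= 25.
Proof.
move=> q1 h; have u : nm P <= 5.
  by rewrite -[P](subrK 1); apply: le_trans (nmD _ _) _; rewrite nm1; lra.
split; last by rewrite nmM; have := nm_ge0 P; nra.
by apply: le_trans (nm_mul_near1 h h u) _; lra.
Qed.

Lemma nm_prod8_ge (x y u v : C) (t : R) : 0 <= t -> t <= nm x -> t <= nm y -> t <= nm u -> t <= nm v ->
  t ^+ 8 <= nm (x * x * (y * y) * (u * u) * (v * v)).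
Proof.
move=> t0 hx hy hu hv; rewrite !nmM.
have -> : t ^+ 8 = t * t * (t * t) * (t * t) * (t * t) by ring.
by rewrite !ler_pM ?mulr_ge0.
Qed.

Lemma nm_lin4 (x y u v : C) (B : R) : nm x <= B -> nm y <= B -> nm u <= B -> nm v <= B ->
  nm (x - 4 * y - 9 * u + 36 * v) <= 50 * B.
Proof.
move=> hx hy hu hv; apply: le_trans (nmD _ _) _; apply: le_trans (lerD (nmD _ _) (lexx _)) _.
apply: le_trans (lerD (lerD (nmD _ _) (lexx _)) (lexx _)) _.
rewrite !nmN (nmM 4) (nmM 9) (nmM 36) !nm_nat; lra.
Qed.

(** The numerator is at most 1.5 * 10^8 q from the Eisenstein series plus less than 10^6 q from the
    Euler products, within 10^9 q; the denominator is at least 10^-8. *)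
Lemma growth_arith (q w m p : R) : 0 <= q -> w <= 1500 * (10 ^+ 5 * q) ->
  m <= ((48 * q * 25 + 48 * q) * 25 + 48 * q) * 25 + 48 * q -> 10^-1 ^+ 8 <= p ->
  w + m <= q * 10 ^+ 17 * p.
Proof.
move=> q0 hw hm hp; have h1 : q * 10 ^+ 17 * 10^-1 ^+ 8 <= q * 10 ^+ 17 * p.
  by apply: ler_wpM2l => //; rewrite mulr_ge0 // exprn_ge0.
apply: le_trans h1.
have -> : q * 10 ^+ 17 * 10^-1 ^+ 8 = 10 ^+ 4 * (10 ^+ 5 * q).
  rewrite exprVn (_ : 17 = 8 + (4 + 5))%N // !exprD.
  have : (10 : R) ^+ 8 != 0 by rewrite expf_neq0.
  by move: (10 ^+ 8) (10 ^+ 4) (10 ^+ 5) => x y u x0; field.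
have -> : (10 : R) ^+ 4 = 100 * 100 by rewrite !exprS; ring.
have e5 : (10 : R) ^+ 5 = 100 * 1000 by rewrite !exprS; ring.
move: hw; rewrite e5 => hw; have -> : 100 * 100 * (100 * 1000 * q) = 1000 * (1000 * (1000 * q)) by ring.
have e6 : 100 * 1000 * q = 100 * (1000 * q) by ring.
rewrite e6 in hw; lra.
Qed.

Lemma qe_small z : 0 < complex.Im z -> 8 <= (12 * complex.Im z) ^+ 2 -> nm (qe z) <= rho.
Proof.
move=> z0 h; have /andP[rE1 rE2] := rho_bounds.
rewrite nm_qe; move: rho rE1 rE2 => r rE1 rE2; move: (complex.Im z) z0 h => y z0 h; clear z.
have p2 := @pi_ge2 R.
have y1 : 2357 / 10000 <= y.
  by rewrite leNgt; apply/negP => hy; move: h; apply/negP; rewrite -ltNge; nra.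
(* As pi >= 2 and y >= 0.2357, exp(pi y / 2) >= 1 + y >= 1.235, whose fourth power exceeds 1 /
   rho. *)
have h1 : (1235 / 1000 : R) ^+ 4 <= expR (2 * pi * y).
  have -> : expR (2 * pi * y) = expR (pi * y / 2) ^+ 4 by rewrite -expRM_natr; congr expR; field.
  have h1 : 1235 / 1000 <= expR (pi * y / 2) by apply: le_trans (expR_ge1Dx _); nra.
  apply: lerXn2r; [rewrite nnegrE; lra|rewrite nnegrE; exact: expR_ge0|exact: h1].
have e0 := expR_gt0 (2 * pi * y).
rewrite expRN -[leLHS]div1r ler_pdivrMr //.
apply: (@le_trans _ _ (r * (1235 / 1000 : R) ^+ 4)); last by rewrite ler_wpM2l //; lra.
have -> : (1235 / 1000 : R) ^+ 4 = (1235 / 1000) ^+ 2 * (1235 / 1000) ^+ 2 by rewrite -exprD.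
have : 1525 / 1000 <= (1235 / 1000 : R) ^+ 2 by rewrite expr2; lra.
by move: (_ ^+ 2) => u; nra.
Qed.

(** The constant term 1 - 4 - 9 + 36 = 24 of the numerator cancels 1/24 and the denominator is q
    times [Pi], so f - 1/q = (W - (Pi - 1)) / (q Pi) with W and Pi - 1 both O(q). *)
Theorem f_growth z : 0 < complex.Im z -> 8 <= (12 * complex.Im z) ^+ 2 ->
  nm (f z - (qe z)^-1) <= 10 ^+ 17.
Proof.
move=> z0 hz; have i2 := @Im_natmul R 1 _ z0; have i3 := @Im_natmul R 2 _ z0; have i6 := @Im_natmul R 5 _ z0.
have hq := qe_small z0 hz; set q := nm (qe z) in hq.
have q0 : 0 <= q by exact: nm_ge0.
have /andP[rE1 rE2] := rho_bounds.
have q1 : q <= 1 by lra.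
have qd (d : nat) : nm (qe (d.+1%:R * z)) <= q.
  by rewrite qe_natmul nmX exprS ler_piMr ?nm_ge0 // exprn_ile1 ?nm_ge0.
have [a1 l1] := eprod_near1 z0 (lexx _) hq; have [a2 l2] := eprod_near1 i2 (qd 1%N) hq.
have [a3 l3] := eprod_near1 i3 (qd 2) hq; have [a6 l6] := eprod_near1 i6 (qd 5) hq.
have b1 := E4_near1 z0 (lexx _) hq; have b2 := E4_near1 i2 (qd 1%N) hq.
have b3 := E4_near1 i3 (qd 2) hq; have b6 := E4_near1 i6 (qd 5) hq.
rewrite -/q in a1 b1.
set P1 := eprod_lim z in a1 l1; set P2 := eprod_lim (2 * z) in a2 l2.
set P3 := eprod_lim (3 * z) in a3 l3; set P6 := eprod_lim (6 * z) in a6 l6.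
have sq (P : C) : nm (P - 1) <= 8 * q -> nm (P * P - 1) <= 48 * q /\ nm (P * P) <= 25.
  by apply: sqr_near1; clear -rE2 hq; move: rho rE2 hq => r; lra.
have [s1 _] := sq _ a1; have [s2 u2] := sq _ a2; have [s3 u3] := sq _ a3; have [s6 u6] := sq _ a6.
have m2 := nm_mul_near1 s1 s2 u2; have m3 := nm_mul_near1 m2 s3 u3; have m6 := nm_mul_near1 m3 s6 u6.
set Pi := P1 * P1 * (P2 * P2) * (P3 * P3) * (P6 * P6) in m6.
have qz : qe z != 0 by exact: qe_neq0.
have denE : fden z = qe z * Pi.
  rewrite /fden /eta2 -/P1 -/P2 -/P3 -/P6.
  have -> : qe z = cexp (c / 12 * z) * cexp (c / 12 * (2 * z)) * cexp (c / 12 * (3 * z)) * cexp (c / 12 * (6 * z)).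
    rewrite -!cexpD qeE; congr cexp; clear; set d := c; by field.
  rewrite /Pi; clear; move: (cexp _) (cexp _) (cexp _) (cexp _) P1 P2 P3 P6 => x1 x2 x3 x4 y1 y2 y3 y4; ring.
pose W := (fnum z - 24) / 24.
have hW : nm W <= 1500 * (10 ^+ 5 * q).
  rewrite /W nmM nmV nm_nat.
  have -> : fnum z - 24 = (E4 z - 1) - 4 * (E4 (2 * z) - 1) - 9 * (E4 (3 * z) - 1) + 36 * (E4 (6 * z) - 1).
    by rewrite /fnum; clear; move: (E4 z) (E4 (2 * z)) (E4 (3 * z)) (E4 (6 * z)) => e1 e2 e3 e4; ring.
  rewrite ler_pdivrMr; last exact: ltr0n.
  have -> : 1500 * (10 ^+ 5 * q) * 24 = 50 * (240 * (3 * (10 ^+ 5 * q))).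
    by clear; move: (10 ^+ 5 * q) => B; ring.
  exact (nm_lin4 b1 b2 b3 b6).
have t0 : (0 : R) <= 10^-1 by rewrite invr_ge0.
have lo : 10^-1 ^+ 8 <= nm Pi by exact (nm_prod8_ge t0 l1 l2 l3 l6).
have k8 : (0 : R) < 10^-1 ^+ 8 by apply: exprn_gt0; rewrite invr_gt0.
have Pn : Pi != 0 by rewrite -nm_gt0 (lt_le_trans k8 lo).
have -> : f z - (qe z)^-1 = (qe z)^-1 * ((W - (Pi - 1)) / Pi).
  rewrite (fE z0) denE /W; move: (fnum z) (qe z) (Pi) qz Pn; clear => n x p x0 p0; field.
  by rewrite x0 p0.
have qp : 0 < q by rewrite nm_gt0.
have pp : 0 < nm Pi := lt_le_trans k8 lo.
rewrite nmM nmV -/q nmM nmV.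
rewrite ler_pdivrMl; last exact: qp.
rewrite ler_pdivrMr; last exact: pp.
apply: le_trans (growth_arith (ltW qp) hW m6 lo).
by apply: le_trans (nmD _ _) _; rewrite nmN.
Qed.

End Growth.

(** * Forms and Atkin-Lehner steps *)

Section Forms.
Implicit Types (A b c e d p q r s D : int) (X Y Z : int * int * int).

(** In the notation of [al_act] the moves are T = [al_act 1 6 1 1 0 1], W_6 =
    [al_act 6 1 0 (-1) 1 0] and W_3 = [al_act 3 2 1 1 1 1]. W_6 is an involution on triples; T and
    W_3 come with their inverses. *)
Inductive step_equiv X : int * int * int -> Prop :=
| se_refl : step_equiv X X
| se_T A b c : step_equiv X (A, b, c) -> step_equiv X (A, b + 12 * A, 6 * A + b + c)
| se_Tinv A b c : step_equiv X (A, b, c) -> step_equiv X (A, b - 12 * A, 6 * A - b + c)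
| se_W6 A b c : step_equiv X (A, b, c) -> step_equiv X (c, - b, A)
| se_W3 A b c : step_equiv X (A, b, c) ->
    step_equiv X (3 * A + b + 2 * c, 12 * A + 5 * b + 12 * c, 2 * A + b + 3 * c)
| se_W3inv A b c : step_equiv X (A, b, c) ->
    step_equiv X (3 * A - b + 2 * c, 5 * b - 12 * A - 12 * c, 2 * A - b + 3 * c).

Lemma step_trans X Y Z : step_equiv X Y -> step_equiv Y Z -> step_equiv X Z.
Proof.
move=> h; elim=> {Z} // A b c _ ih.
- exact: se_T.
- exact: se_Tinv.
- exact: se_W6.
- exact: se_W3.
- exact: se_W3inv.
Qed.

Lemma triple_eq A b c A' b' c' : A = A' -> b = b' -> c = c' -> (A, b, c) = (A', b', c').
Proof. by move=> -> -> ->. Qed.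

Lemma step_sym X Y : step_equiv X Y -> step_equiv Y X.
Proof.
have conv Z W W' : W = W' -> step_equiv Z W -> step_equiv Z W' by move=> ->.
elim=> {Y} [|A b c _ ih|A b c _ ih|A b c _ ih|A b c _ ih|A b c _ ih]; first exact: se_refl.
- apply: step_trans ih; apply: conv (se_Tinv (se_refl _)); apply: triple_eq; ring.
- apply: step_trans ih; apply: conv (se_T (se_refl _)); apply: triple_eq; ring.
- apply: step_trans ih; apply: conv (se_W6 (se_refl _)); apply: triple_eq; ring.
- apply: step_trans ih; apply: conv (se_W3inv (se_refl _)); apply: triple_eq; ring.
- apply: step_trans ih; apply: conv (se_W3 (se_refl _)); apply: triple_eq; ring.
Qed.

Definition disc X : int := X.1.2 ^+ 2 - 24 * X.1.1 * X.2.

Lemma step_disc X Y : step_equiv X Y -> disc Y = disc X.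
Proof. by elim=> {Y} // A b c _ <-; rewrite /disc /=; ring. Qed.

Lemma pos_of_disc A b c D : 0 < D -> b ^+ 2 - 24 * A * c = - D -> 0 < A -> 0 < c.
Proof. by move=> D0 h A0; rewrite ltNge; apply/negP => c0; nia. Qed.

(** Completing the square: 24A times the value is (12Ax + by)^2 + D y^2. *)
Lemma value_pos A b c D (x y : int) : 0 < D -> b ^+ 2 - 24 * A * c = - D -> 0 < A ->
  (x != 0) || (y != 0) -> 0 < 6 * A * x ^+ 2 + b * x * y + c * y ^+ 2.
Proof.
move=> D0 h A0 xy.
have e : 24 * A * (6 * A * x ^+ 2 + b * x * y + c * y ^+ 2) = (12 * A * x + b * y) ^+ 2 + D * y ^+ 2.
  have -> : D = 24 * A * c - b ^+ 2 by rewrite -[D]opprK -h; ring.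
  by ring.
have : 0 < (12 * A * x + b * y) ^+ 2 + D * y ^+ 2.
  have [y0|y0] := eqVneq y 0.
    move: xy; rewrite y0 eqxx orbF => x0; rewrite mulr0 addr0 expr0n mulr0 addr0.
    by rewrite exprn_even_gt0 //= !mulf_neq0 // gt_eqF.
  by rewrite ltr_wpDl ?sqr_ge0 // mulr_gt0 // exprn_even_gt0.
by rewrite -e pmulr_rgt0 // mulr_gt0.
Qed.

(** The new leading coefficients are c for W_6, positive by the discriminant, and for W_3 and its
    inverse 1/18 of the values of the form at (3, 6) and (3, -6). *)
Lemma step_pos X Y D : 0 < D -> disc X = - D -> 0 < X.1.1 -> step_equiv X Y -> 0 < Y.1.1.
Proof.
move=> D0 hX A0; elim=> {Y} // A b c h /= ih; have hd := step_disc h; rewrite hX /disc /= in hd.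
- exact: pos_of_disc D0 hd ih.
- have := value_pos D0 hd ih (isT : ((3 : int) != 0) || ((6 : int) != 0)).
  have -> : 6 * A * 3 ^+ 2 + b * 3 * 6 + c * 6 ^+ 2 = 18 * (3 * A + b + 2 * c) by ring.
  lia.
- have := value_pos D0 hd ih (isT : ((3 : int) != 0) || ((- 6 : int) != 0)).
  have -> : 6 * A * 3 ^+ 2 + b * 3 * (- 6) + c * (- 6) ^+ 2 = 18 * (3 * A - b + 2 * c) by ring.
  lia.
Qed.

Definition al_pair e d := [\/ e = 1 /\ d = 6, e = 2 /\ d = 3, e = 3 /\ d = 2 | e = 6 /\ d = 1].

(* The matrix of W_e has rows (e p, q) and (6 r, e s), with e d = 6. *)
Definition al_act e d p q r s X : int * int * int :=
  let: (A, b, c) := X in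
  (e * A * p ^+ 2 + b * p * r + d * c * r ^+ 2,
   12 * A * p * q + b * (e * p * s + d * q * r) + 12 * c * r * s,
   d * A * q ^+ 2 + b * q * s + e * c * s ^+ 2).

Definition al_equiv X Y := exists e d p q r s,
  [/\ al_pair e d, e * p * s - d * q * r = 1 & Y = al_act e d p q r s X].

Lemma al_intro e d p q r s X Y : al_pair e d -> e * p * s - d * q * r = 1 ->
  Y = al_act e d p q r s X -> al_equiv X Y.
Proof. by move=> *; exists e, d, p, q, r, s. Qed.

Lemma al_refl X : al_equiv X X.
Proof.
case: X => -[A b] c; apply: (@al_intro 1 6 1 0 0 1); first by constructor 1.
  by ring.
apply: triple_eq; ring.
Qed.

(** A matrix of type W_e times one in Gamma_0(6) is again of type W_e. *)
Lemma al_Gamma0 X A b c p q r s : al_equiv X (A, b, c) -> p * s - 6 * q * r = 1 ->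
  al_equiv X (A * p ^+ 2 + b * p * r + 6 * c * r ^+ 2,
    12 * A * p * q + b * (p * s + 6 * q * r) + 12 * c * r * s,
    6 * A * q ^+ 2 + b * q * s + c * s ^+ 2).
Proof.
case: X => -[A0 b0] c0 [e [d [x [y [z [w [h1 h2 [-> -> ->]]]]]]]] h3.
apply: (@al_intro e d (x * p + d * y * r) (e * x * q + y * s) (z * p + e * w * r) (d * z * q + w * s)) => //.
  have <- : (e * x * w - d * y * z) * (p * s - 6 * q * r) = 1 by rewrite h2 h3.
  by case: h1 => -[-> ->]; ring.
by case: h1 => -[-> ->]; apply: triple_eq; ring.
Qed.

Lemma al_W6 X A b c : al_equiv X (A, b, c) -> al_equiv X (c, - b, A).
Proof.
case: X => -[A0 b0] c0 [e [d [x [y [z [w [h1 h2 [-> -> ->]]]]]]]].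
apply: (@al_intro d e y (- x) w (- z)).
- by case: h1 => -[-> ->]; [constructor 4|constructor 3|constructor 2|constructor 1].
- by apply: etrans h2; ring.
- by apply: triple_eq; ring.
Qed.

(** Multiplication by W_3 exchanges the indices 1 and 3, and 2 and 6. Starting from 3 or 6 the
    product matrix is divisible by 3, and the witnesses are those of the quotient. *)
Lemma al_W3 X A b c : al_equiv X (A, b, c) ->
  al_equiv X (3 * A + b + 2 * c, 12 * A + 5 * b + 12 * c, 2 * A + b + 3 * c).
Proof.
case: X => -[A0 b0] c0 [e [d [x [y [z [w [h1 h2 [-> -> ->]]]]]]]].
case: h1 h2 => -[-> ->] h2.
- apply: (@al_intro 3 2 (x + 2 * y) (x + 3 * y) (3 * z + w) (2 * z + w)); first by constructor 3.
    by apply: etrans h2; ring.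
  by apply: triple_eq; ring.
- apply: (@al_intro 6 1 (x + y) (2 * x + 3 * y) (3 * z + 2 * w) (z + w)); first by constructor 4.
    by apply: etrans h2; ring.
  by apply: triple_eq; ring.
- apply: (@al_intro 1 6 (3 * x + 2 * y) (x + y) (z + w) (2 * z + 3 * w)); first by constructor 1.
    by apply: etrans h2; ring.
  by apply: triple_eq; ring.
- apply: (@al_intro 2 3 (3 * x + y) (2 * x + y) (z + 2 * w) (z + 3 * w)); first by constructor 2.
    by apply: etrans h2; ring.
  by apply: triple_eq; ring.
Qed.

Lemma al_step X Y Z : al_equiv X Y -> step_equiv Y Z -> al_equiv X Z.
Proof.
move=> h; have conv W W' : W = W' -> al_equiv X W -> al_equiv X W' by move=> ->.
elim=> {Z} // A b c _ ih.
- apply: conv (@al_Gamma0 _ _ _ _ 1 1 0 1 ih _); last by ring.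
  by apply: triple_eq; ring.
- apply: conv (@al_Gamma0 _ _ _ _ 1 (-1) 0 1 ih _); last by ring.
  by apply: triple_eq; ring.
- exact: al_W6.
- exact: al_W3.
(* The square of W_3 is 3 times the matrix with rows (5, 2) and (12, 5); W_3 followed by the inverse
   of that matrix is its own inverse map. *)
- apply: conv (@al_Gamma0 _ _ _ _ 5 (-2) (-2) 5 (al_W3 ih) _); last by ring.
  by apply: triple_eq; ring.
Qed.

(** Modulo 12 the middle coefficient is multiplied by e p s + d q r = 1 + 2 d q r. If both are 1,
    then 6 = e d divides d q r, so e divides q r, and e p s - d q r = 1 gives e = 1. *)
Lemma al_mod12 A b c A' b' c' : al_equiv (A, b, c) (A', b', c') ->
  (exists v, b = 1 + 12 * v) -> (exists v, b' = 1 + 12 * v) -> 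
  exists p q r s, p * s - 6 * q * r = 1 /\ (A', b', c') = al_act 1 6 p q r s (A, b, c).
Proof.
move=> [e [d [p [q [r [s [h1 h2 h3]]]]]]] [v hv] [v' hv'].
have [_ hb _] := h3.
case: h1 h2 h3 hb => -[-> ->] h2 h3 hb; first by exists p, q, r, s; split => //; apply: etrans h2; ring.
- move: hb; rewrite hv hv'.
  have -> : 12 * A * p * q + (1 + 12 * v) * (2 * p * s + 3 * q * r) + 12 * c * r * s =
     12 * (A * p * q + v * (2 * p * s + 3 * q * r) + c * r * s) + (2 * (p * s) + 3 * (q * r)) by ring.
  have : 2 * (p * s) - 3 * (q * r) = 1 by apply: etrans h2; ring.
  by move: (p * s) (q * r) (_ + c * r * s) => m k w; lia.
- move: hb; rewrite hv hv'.
  have -> : 12 * A * p * q + (1 + 12 * v) * (3 * p * s + 2 * q * r) + 12 * c * r * s =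
     12 * (A * p * q + v * (3 * p * s + 2 * q * r) + c * r * s) + (3 * (p * s) + 2 * (q * r)) by ring.
  have : 3 * (p * s) - 2 * (q * r) = 1 by apply: etrans h2; ring.
  by move: (p * s) (q * r) (_ + c * r * s) => m k w; lia.
- move: hb; rewrite hv hv'.
  have -> : 12 * A * p * q + (1 + 12 * v) * (6 * p * s + 1 * q * r) + 12 * c * r * s =
     12 * (A * p * q + v * (6 * p * s + 1 * q * r) + c * r * s) + (6 * (p * s) + (q * r)) by ring.
  have : 6 * (p * s) - (q * r) = 1 by apply: etrans h2; ring.
  by move: (p * s) (q * r) (_ + c * r * s) => m k w; lia.
Qed.

(** If r != 0 then D <= 4 e A' <= 24 A', and 8 A'^2 <= D forces A' <= 3 and D <= 72, whence the
    threshold. If r = 0 then e p s = 1 leaves a translation by 12 q, and |b| <= 5, |b'| <= 6 allow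
    only q = 0. *)
Lemma al_main b c A' b' c' D : 72 < D -> b ^+ 2 - 24 * c = - D -> `|b| <= 5 -> 
  8 * A' ^+ 2 <= D -> 0 < A' -> `|b'| <= 6 * A' -> al_equiv (1, b, c) (A', b', c') ->
  (A', b', c') = (1, b, c).
Proof.
move=> D72 hD hb hA A0 hb' [e [d [p [q [r [s [h1 h2 [hA' hB' hC']]]]]]]].
have e6 : e * d = 6 by case: h1 => -[-> ->].
have e0 : 0 < e <= 6 by case: h1 => -[-> _].
have [r0|r0] := eqVneq r 0; last first.
  have k : 4 * e * A' = (2 * e * p + b * r) ^+ 2 + D * r ^+ 2.
    have -> : D = 4 * (e * d) * c - b ^+ 2 by rewrite e6 -[D]opprK -hD; ring.
    by rewrite hA'; ring.
  have r2 : 1 <= r ^+ 2 by have : 0 < r ^+ 2 by rewrite exprn_even_gt0.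
  have k2 : D <= 24 * A'.
    have := sqr_ge0 (2 * e * p + b * r); move: (r ^+ 2) (_ ^+ 2) k r2 => v u k r2 u0.
    have h3 : D * 1 <= D * v by rewrite ler_pM2l //; lia.
    have h4 : e * A' <= 6 * A' by rewrite ler_pM2r //; lia.
    have h5 : 4 * e * A' = 4 * (e * A') by ring.
    rewrite h5 in k; clear -h3 h4 k u0; move: (D * v) (e * A') h3 h4 k => x y; lia.
  exfalso; clear -hA k2 A0 D72; rewrite expr2 in hA; have : A' <= 3 by nia.
  lia.
subst r; have h : e * (p * s) = 1 by apply: etrans h2; ring.
have e1 : e = 1 by case: h1 => -[e1 _]; move: h; rewrite e1; clear; move: (p * s) => m; lia.
have d6 : d = 6 by rewrite -e6 e1; ring.
have ps : p * s = 1 by rewrite -h e1; ring.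
have [[p1 s1]|[p1 s1]] : (p = 1 /\ s = 1) \/ (p = -1 /\ s = -1).
  have /eqP : (`|p| * `|s|)%N = 1%N by rewrite -abszM ps.
  rewrite muln_eq1 => /andP[/eqP p1 /eqP s1]; clear -ps p1 s1; have [p2|p2] : p = 1 \/ p = -1 by lia.
    by move: ps; rewrite p2 mul1r => ->; left.
  by move: ps; rewrite p2 mulN1r => ps; right; lia.
  have A1 : A' = 1 by rewrite hA' e1 p1; ring.
  have B1 : b' = b + 12 * q by rewrite hB' e1 p1 s1; ring.
  have q0 : q = 0 by clear -B1 A1 hb hb'; lia.
  by apply: triple_eq; rewrite ?A1 ?B1 ?hC' ?q0 ?s1 ?e1 ?d6; ring.
have A1 : A' = 1 by rewrite hA' e1 p1; ring.
have B1 : b' = b - 12 * q by rewrite hB' e1 p1 s1; ring.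
have q0 : q = 0 by clear -B1 A1 hb hb'; lia.
by apply: triple_eq; rewrite ?A1 ?B1 ?hC' ?q0 ?s1 ?e1 ?d6; ring.
Qed.

(** Minimality against W_6 gives A <= c, against W_3 and its inverse |b| - 2A <= 2c. With D = 24Ac -
    b^2 the first settles |b| <= 4A, the second 4A < |b| <= 6A. *)
Lemma reduced_exists X D : 0 < D -> disc X = - D -> 0 < X.1.1 ->
  exists A b c, [/\ step_equiv X (A, b, c), 0 < A, `|b| <= 6 * A & 8 * A ^+ 2 <= D].
Proof.
move=> D0 hX X0.
have pos := step_pos D0 hX X0.
have [m [[Y hY Ym] minm]] : exists m : nat, (exists2 Y, step_equiv X Y & `|Y.1.1|%N = m) /\
    forall Y, step_equiv X Y -> (m <= `|Y.1.1|)%N.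
  have ex : exists m, `[< exists2 Y, step_equiv X Y & `|Y.1.1|%N = m >].
    by exists `|X.1.1|%N; apply/asboolP; exists X => //; exact: se_refl.
  have /asboolP h := xchooseP ex; have mn := ex_minnP ex.
  case: mn => m /asboolP h1 h2; exists m; split => // Y hY; apply: h2; apply/asboolP; by exists Y.
have minA Z : step_equiv X Z -> Y.1.1 <= Z.1.1.
  by move=> hZ; have := minm Z hZ; have := pos _ hZ; have := pos _ hY; lia.
have [b [c [hb bA]]] : exists b c, step_equiv X (Y.1.1, b, c) /\ `|b| <= 6 * Y.1.1.
  have A0 := pos _ hY.
  (* While |b| > 6A a translation by 12A strictly lowers |b|; [k] is the fuel of this descent. *)
  have : forall k : nat, forall b c, step_equiv X (Y.1.1, b, c) -> (`|b| < k)%N ->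
      exists b c, step_equiv X (Y.1.1, b, c) /\ `|b| <= 6 * Y.1.1.
    elim=> [|k ih] b c h; first by rewrite ltn0.
    move=> bk; have [le|gt] := lerP `|b| (6 * Y.1.1); first by exists b, c.
    have [b0|b0] := lerP 0 b.
      by apply: ih (se_Tinv h) _; lia.
    by apply: ih (se_T h) _; lia.
  case: Y hY {minA minm Ym A0} => -[A b] c /= hY; move/(_ `|b|.+1%N b c hY); apply; exact: ltnSn.
exists Y.1.1, b, c; have A0 := pos _ hb; rewrite /= in A0.
move: (Y.1.1) minA A0 hb bA => A minA A0 hb bA; split => //.
have hd : b ^+ 2 - 24 * A * c = - D by rewrite -hX -(step_disc hb).
have h1 := minA _ (se_W6 hb); have h2 := minA _ (se_W3 hb); have h3 := minA _ (se_W3inv hb).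
rewrite /= in h1 h2 h3.
have k : `|b| - 2 * A <= 2 * c by lia.
have bE : b ^+ 2 = `|b| ^+ 2 by rewrite -normrX ger0_norm ?sqr_ge0.
have -> : D = 24 * A * c - `|b| ^+ 2 by rewrite -bE -[D]opprK -hd; ring.
have b0 := normr_ge0 b.
move: (`|b|) b0 bA k => x x0 bA k {bE hd h2 h3 minA}.
have [x4|x4] := lerP x (4 * A); nia.
Qed.

End Forms.

(** * Classes and reduced forms *)

Section Classes.
Implicit Types (A b c p q r s v : int) (Q : bqf) (X : int * int * int) (K : set bqf) (m : 'M[int]_2).

Lemma mul22 m1 m2 i j : (m1 *m m2) i j = m1 i 0 * m2 0 j + m1 i 1 * m2 1 j.
Proof.
rewrite mxE !big_ord_recl big_ord0 addr0; congr (_ + m1 i _ * m2 _ j); exact: val_inj.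
Qed.

Lemma det22 m : \det m = m 0 0 * m 1 1 - m 0 1 * m 1 0.
Proof.
rewrite (expand_det_row _ 0) !big_ord_recl big_ord0 addr0 /cofactor !det_mx11 !mxE /=.
rewrite expr0 expr1 mul1r mulN1r mulrN; congr (m _ _ * m _ _ - m _ _ * m _ _); exact: val_inj.
Qed.

Lemma qact_mul Q m1 m2 : qact (qact Q m1) m2 = qact Q (m1 *m m2).
Proof. by rewrite /qact /qeval /qa /qb /qc /= !mul22; apply: triple_eq; ring. Qed.

Lemma qact1 Q : qact Q 1%:M = Q.
Proof. by case: Q => -[a b] c; rewrite /qact /qeval /qa /qb /qc /= !mxE /=; apply: triple_eq; ring. Qed.

Lemma Gamma0P m : Gamma0 6 m <-> exists r, m 1 0 = 6 * r /\ m 0 0 * m 1 1 - 6 * m 0 1 * r = 1.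
Proof.
rewrite /Gamma0 /= det22; split.
  by move=> [h /dvdzP[r hr]]; exists r; split; [rewrite hr; ring|rewrite -[RHS]h hr; ring].
by move=> [r [h1 h2]]; split; [rewrite h1 -[RHS]h2; ring|rewrite h1; exact: dvdz_mulr].
Qed.

Definition mx22 p q r s : 'M[int]_2 :=
  \matrix_(i, j) (if i == 0 then if j == 0 then p else q else if j == 0 then r else s).

Lemma mx22E p q r s : (mx22 p q r s 0 0 = p) * (mx22 p q r s 0 1 = q) * (mx22 p q r s 1 0 = r)
  * (mx22 p q r s 1 1 = s).
Proof. by rewrite !mxE. Qed.

Lemma Gamma0_mul m1 m2 : Gamma0 6 m1 -> Gamma0 6 m2 -> Gamma0 6 (m1 *m m2).
Proof.
move=> [d1 /dvdzP[r1 h1]] [d2 /dvdzP[r2 h2]]; split; first by rewrite det_mulmx d1 d2.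
by rewrite mul22 h1 h2 rpredD //; [apply: dvdz_mulr|apply: dvdz_mull]; exact: dvdz_mull.
Qed.

Lemma Gamma0_inv m : Gamma0 6 m -> exists2 m', Gamma0 6 m' & m *m m' = 1%:M.
Proof.
move=> /Gamma0P [r [h1 h2]]; exists (mx22 (m 1 1) (- m 0 1) (- m 1 0) (m 0 0)).
  apply/Gamma0P; exists (- r); rewrite !mx22E h1; split; first by ring.
  by rewrite -[RHS]h2; ring.
apply/matrixP => i j; rewrite mul22; rewrite [RHS]mxE.
have [-> | ->] : i = 0 \/ i = 1.
- by case: i => -[|[|//]] ?; [left|right]; apply: val_inj.
- have [-> | ->] : j = 0 \/ j = 1 by case: j => -[|[|//]] ?; [left|right]; apply: val_inj.
    by rewrite !mx22E h1 /= -[RHS]h2; ring.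
  by rewrite !mx22E /=; ring.
- have [-> | ->] : j = 0 \/ j = 1 by case: j => -[|[|//]] ?; [left|right]; apply: val_inj.
    by rewrite !mx22E /=; ring.
  by rewrite !mx22E h1 /= -[RHS]h2; ring.
Qed.

Lemma qclass_act Q m : Gamma0 6 m -> qclass (qact Q m) = qclass Q.
Proof.
move=> hm; apply/seteqP; split => Q' /= [m' hm' <-].
  by exists (m *m m'); [exact: Gamma0_mul|rewrite qact_mul].
have [m2 hm2 e] := Gamma0_inv hm; exists (m2 *m m'); first exact: Gamma0_mul.
by rewrite qact_mul mulmxA e mul1mx.
Qed.

Lemma qclass_refl Q : qclass Q Q.
Proof.
exists 1%:M; last exact: qact1.
by split; [rewrite det1|rewrite mxE dvdz0].
Qed.

Lemma qact_al A b c p q r s : qact (6 * A, b, c) (mx22 p q (6 * r) s) =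
  let: (A', b', c') := al_act 1 6 p q r s (A, b, c) in (6 * A', b', c').
Proof. by rewrite /qact /qeval /qa /qb /qc /= !mx22E; apply: triple_eq; ring. Qed.

Lemma mx22_eta m : m = mx22 (m 0 0) (m 0 1) (m 1 0) (m 1 1).
Proof.
apply/matrixP => i j; rewrite mxE.
by case: i => -[|[|//]] ?; case: j => -[|[|//]] ? /=; congr (m _ _); apply: val_inj.
Qed.

Variable n : nat.
Hypothesis n_gt0 : (0 < n)%N.
Let D : int := 24 * n%:Z - 1.
Let D_gt0 : 0 < D. Proof. by rewrite /D; lia. Qed.

Lemma QsetP Q : Qset n Q <->
  exists A b c v, [/\ Q = (6 * A, b, c), b = 1 + 12 * v, disc (A, b, c) = - D & 0 < A].
Proof.
split.
  case: Q => -[a b] c [h1 h2 /dvdzP[A hA] h4]; rewrite /qa /qb /= in hA h4.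
  have /dvdzP[v hv] : (12 %| b - 1)%Z by rewrite -eqz_mod_dvd; apply/eqP.
  exists A, b, c, v; split; [by rewrite hA mulrC|lia| |].
    by move: h2; rewrite /qdisc /disc /qa /qb /qc /= hA /D => h2; apply: etrans (etrans h2 _); ring.
  have := h1 1 0 _; rewrite /qeval /qa /qb /qc /= hA => h; have := h ltac:(by []); lia.
move=> [A [b [c [v [-> hb hd A0]]]]]; split.
- move=> x y xy; rewrite /qeval /qa /qb /qc /=; apply: (value_pos D_gt0 hd A0).
  by case: eqVneq => //= x0; apply/eqP => y0; apply: xy; rewrite x0 y0.
- by move: hd; rewrite /qdisc /disc /qa /qb /qc /= /D => hd; apply: etrans (etrans hd _); ring.
- by rewrite /qa /=; exact: dvdz_mulr.
- apply/eqP; rewrite /qb /= eqz_mod_dvd hb addrAC subrr add0r; exact: dvdz_mulr.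
Qed.

Lemma Qset_act Q m : Qset n Q -> Gamma0 6 m -> Qset n (qact Q m).
Proof.
move=> /QsetP [A [b [c [v [-> hb hd A0]]]]] /Gamma0P [r [h1 h2]]; rewrite [m]mx22_eta h1.
move: (m 0 0) (m 0 1) (m 1 1) h2 => p q s h2; rewrite qact_al /=; apply/QsetP.
(* The last witness uses p s + 6 q r = 1 + 12 q r. *)
eexists _, _, _, (A * p * q + c * r * s + v * (p * s + 6 * q * r) + q * r); split; first by [].
- rewrite hb; have ps : p * s = 1 + 6 * q * r by apply/eqP; rewrite -subr_eq h2.
  transitivity (12 * (A * p * q + c * r * s + v * (p * s + 6 * q * r)) + (p * s + 6 * q * r)); first by ring.
  by rewrite ps; ring.
- rewrite -hd /disc /=.
  have -> : b ^+ 2 - 24 * A * c = (b ^+ 2 - 24 * A * c) * (p * s - 6 * q * r) ^+ 2 by rewrite h2; ring.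
  by ring.
have := @value_pos A b c D p (6 * r) D_gt0 hd A0.
have -> : 6 * A * p ^+ 2 + b * p * (6 * r) + c * (6 * r) ^+ 2 = 6 * (1 * A * p ^+ 2 + b * p * r + 6 * c * r ^+ 2).
  by ring.
rewrite pmulr_rgt0 //; apply; rewrite mulf_eq0 /= -negb_and; apply/negP => /andP[/eqP p0 /eqP r0].
by move: h2; rewrite p0 r0 mul0r mulr0.
Qed.

Lemma class_rep K : Qclasses n K -> exists A b c v,
  [/\ xget (0, 0, 0) K = (6 * A, b, c), b = 1 + 12 * v, disc (A, b, c) = - D, 0 < A
    & K = qclass (6 * A, b, c)].
Proof.
move=> [Q hQ <-]; have := @xgetI _ (0, 0, 0) (qclass Q) Q (qclass_refl Q).
set P := xget _ _ => hP; have {}hP : qclass Q P := hP.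
have [m hm mP] := hP.
have /QsetP [A [b [c [v [h1 h2 h3 h4]]]]] : Qset n P by rewrite -mP; exact: Qset_act.
by exists A, b, c, v; split => //; rewrite -h1 -mP qclass_act.
Qed.

Definition reduced X := [/\ 0 < X.1.1, `|X.1.2| <= 6 * X.1.1, 8 * X.1.1 ^+ 2 <= D & disc X = - D].

(** The chosen form [xget] is named because [traceS] evaluates f there. Since the link is by
    Atkin-Lehner steps, the middle coefficient of [X] need not be 1 mod 12. *)
Definition represents K X := exists A b c v,
  [/\ xget (0, 0, 0) K = (6 * A, b, c), b = 1 + 12 * v, K = qclass (6 * A, b, c),
      step_equiv (A, b, c) X & reduced X].

Lemma represents_exists K : Qclasses n K -> exists X, represents K X.
Proof.
move=> /class_rep [A [b [c [v [h1 h2 h3 h4 h5]]]]].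
have [A' [b' [c' [k1 k2 k3 k4]]]] := reduced_exists D_gt0 h3 h4.
exists (A', b', c'), A, b, c, v; split => //; split => //.
by rewrite (step_disc k1).
Qed.

(** Two classes with a common reduced triple are linked by some W_e, and [al_mod12] forces e = 1. *)
Lemma represents_inj K K' X : represents K X -> represents K' X -> K = K'.
Proof.
move=> [A [b [c [v [_ hb -> h1 _]]]]] [A' [b' [c' [v' [_ hb' -> h2 _]]]]].
have h : al_equiv (A, b, c) (A', b', c').
  by apply: al_step (step_trans h1 (step_sym h2)); exact: al_refl.
have [p [q [r [s [e1 e2]]]]] := al_mod12 h (ex_intro _ v hb) (ex_intro _ v' hb').
have := qact_al A b c p q r s; rewrite -e2 => <-; rewrite qclass_act //.
by apply/Gamma0P; exists r; rewrite !mx22E.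
Qed.

Lemma represents_main b c A1 c1 v1 X K : (4 <= n)%N -> `|b| <= 5 -> disc (1, b, c) = - D ->
  step_equiv (1, b, c) (A1, 1 + 12 * v1, c1) -> K = qclass (6 * A1, 1 + 12 * v1, c1) ->
  represents K X -> X = (1, b, c).
Proof.
move=> n4 hb hd hs -> [A [b' [c' [v [hx _ _ h1 [X0 X1 X2 _]]]]]].
have := @xgetI _ (0, 0, 0) _ _ (qclass_refl (6 * A1, 1 + 12 * v1, c1)).
rewrite hx => -[m /Gamma0P [r [e1 e2]]]; rewrite [m]mx22_eta e1 qact_al => -[eA eb ec].
have h : al_equiv (1, b, c) X.
  apply: al_step h1; have := al_Gamma0 (al_step (al_refl _) hs) e2.
  suff -> : (A, b', c') = (A1 * m 0 0 ^+ 2 + (1 + 12 * v1) * m 0 0 * r + 6 * c1 * r ^+ 2,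
    12 * A1 * m 0 0 * m 0 1 + (1 + 12 * v1) * (m 0 0 * m 1 1 + 6 * m 0 1 * r) + 12 * c1 * r * m 1 1,
    6 * A1 * m 0 1 ^+ 2 + (1 + 12 * v1) * m 0 1 * m 1 1 + c1 * m 1 1 ^+ 2) by [].
  apply: triple_eq; [|by rewrite -eb; ring|by rewrite -ec; ring].
  have i6 : injective (fun x : int => 6 * x) by exact: mulfI.
  by apply: i6; rewrite -eA; ring.
case: X X0 X1 X2 h {h1} => -[X Y] Z /= X0 X1 X2 h.
have D72 : 72 < D by rewrite /D; clear -n4; lia.
have hd' : b ^+ 2 - 24 * c = - D by rewrite -hd /disc /=; ring.
exact: (al_main D72 hd' hb X2 X0 X1 h).
Qed.

(** W_6 changes the sign of b and, on these triples, W_3 multiplies it by 5 modulo 12; so each of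
    the four values is carried to 1 mod 12, and [al_main] excludes any other reduced triple for that
    class. *)
Lemma main_class b : (4 <= n)%N -> b \in [:: 1; -1; 5; -5 : int] ->
  exists2 K, Qclasses n K & forall X, represents K X -> X.1 = (1, b).
Proof.
move=> n4 hb; pose N : int := n%:Z.
suff [A1 [c1 [v1 [c [h1 h2]]]]] : exists A1 c1 v1 c, disc (1, b, c) = - D /\
    step_equiv (1, b, c) (A1, 1 + 12 * v1, c1).
  exists (qclass (6 * A1, 1 + 12 * v1, c1)).
    exists (6 * A1, 1 + 12 * v1, c1) => //; apply/QsetP; exists A1, (1 + 12 * v1), c1, v1; split => //.
      by rewrite (step_disc h2).
    by have := step_pos D_gt0 h1 _ h2; apply.
  move=> X hX; rewrite (@represents_main b c A1 c1 v1 X _ n4 _ h1 h2 erefl hX) //.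
  by move: hb; rewrite !inE => /or4P[] /eqP ->.
have conv Z W W' : W = W' -> step_equiv Z W -> step_equiv Z W' by move=> ->.
(* c is n for b = 1, -1 and n + 1 for b = 5, -5; the moves are none, W_6, W_3, and W_6 followed by
   W_3. *)
move: hb; rewrite !inE => /or4P[] /eqP ->.
- exists 1, N, 0, N; split; first by rewrite /disc /= /D -/N; ring.
  by apply: conv (se_refl _); apply: triple_eq; ring.
- exists N, 1, 0, N; split; first by rewrite /disc /= /D -/N; ring.
  by apply: conv (se_W6 (se_refl _)); apply: triple_eq; ring.
- exists (2 * N + 10), (3 * N + 10), (N + 4), (N + 1); split; first by rewrite /disc /= /D -/N; ring.
  by apply: conv (se_W3 (se_refl _)); apply: triple_eq; ring.
- exists (3 * N + 10), (2 * N + 10), (N + 4), (N + 1); split; first by rewrite /disc /= /D -/N; ring.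
  by apply: conv (se_W3 (se_W6 (se_refl _))); apply: triple_eq; ring.
Qed.

End Classes.

From mathcomp Require Import finmap.

(** * Values of f at Heegner points *)

Section TauAlgebra.
Variable F : numFieldType.
Implicit Types a x y v : F.

(** In this section v stands for a square root of -D, so that 24 a y = x^2 - v^2 is the discriminant
    equation. *)
Lemma tau_alg_T a x v : a != 0 -> (v - (x + 12 * a)) / (12 * a) + 1 = (v - x) / (12 * a).
Proof. by move=> a0; field. Qed.

Lemma tau_alg_W6 a x y v : a != 0 -> y != 0 -> v - x != 0 -> 24 * a * y = x ^+ 2 - v ^+ 2 ->
  (v + x) / (12 * y) = - (6 * ((v - x) / (12 * a)))^-1.
Proof.
move=> a0 y0 v0 h.
have -> : - (6 * ((v - x) / (12 * a)))^-1 = - (2 * a / (v - x)) by field; rewrite v0 a0.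
apply/eqP; rewrite -mulNr eqr_div //; last by rewrite mulf_neq0 ?pnatr_eq0.
apply/eqP; transitivity (- (x ^+ 2 - v ^+ 2)); first by ring.
by rewrite -h; ring.
Qed.

Lemma tau_alg_W3 a x y v : a != 0 -> 3 * a + x + 2 * y != 0 -> v - (- (6 * a) - x) != 0 ->
  24 * a * y = x ^+ 2 - v ^+ 2 ->
  (3 * ((v - (12 * a + 5 * x + 12 * y)) / (12 * (3 * a + x + 2 * y))) + 1) /
  (6 * ((v - (12 * a + 5 * x + 12 * y)) / (12 * (3 * a + x + 2 * y))) + 3) = (v - x) / (12 * a).
Proof.
move=> a0 p0 v0 h.
have -> : 3 * ((v - (12 * a + 5 * x + 12 * y)) / (12 * (3 * a + x + 2 * y))) + 1 =
  (v - x - 4 * y) / (4 * (3 * a + x + 2 * y)) by field.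
have -> : 6 * ((v - (12 * a + 5 * x + 12 * y)) / (12 * (3 * a + x + 2 * y))) + 3 =
  2 * (v - (- (6 * a) - x)) / (4 * (3 * a + x + 2 * y)) by field.
have p4 : 4 * (3 * a + x + 2 * y) != 0 by rewrite mulf_neq0 ?pnatr_eq0.
move: (3 * a + _ + _) p4 v0 => p p4 v0; have p1 : p != 0 by move: p4; rewrite mulf_eq0 negb_or => /andP[].
have -> : (v - x - 4 * y) / (4 * p) / (2 * (v - (- (6 * a) - x)) / (4 * p)) =
  (v - x - 4 * y) / (2 * (v - (- (6 * a) - x))).
  by move: (v - (- (6 * a) - x)) v0 => u u0; field; rewrite p1 u0.
apply/eqP; rewrite eqr_div ?mulf_neq0 ?pnatr_eq0 //; apply/eqP.
transitivity (12 * a * (v - x) - 2 * (24 * a * y)); first by ring.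
by rewrite h; ring.
Qed.

End TauAlgebra.

(** * Heegner points, the sign character and the list of reduced pairs *)

Section HeegnerPoints.
Variable R : realType.
Local Notation C := R[i].
Implicit Types (A b c : int) (X Y : int * int * int).
Variable n : nat.
Hypothesis n_gt0 : (0 < n)%N.
Let D : int := 24 * n%:Z - 1.
Let sD : R := Num.sqrt (Dn R n).

Lemma Dn_ge23 : 23 <= Dn R n.
Proof.
by rewrite /Dn; have : (1 : R) <= n%:R by [rewrite ler1n]; lra.
Qed.

Lemma sD_gt0 : 0 < sD.
Proof. by rewrite sqrtr_gt0; have := Dn_ge23; lra. Qed.

Lemma D_Dn : D%:~R = Dn R n.
Proof. by rewrite /D /Dn rmorphB rmorphM. Qed.

Lemma sD_sqr : sD ^+ 2 = D%:~R.
Proof. by rewrite sqr_sqrtr ?D_Dn //; have := Dn_ge23; lra. Qed.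

(** Only A and b enter, c being determined by the discriminant; the lists below are therefore lists
    of pairs. *)
Definition tau (x : int * int) : C := ('i%C * sD%:C - x.2%:~R) / (12 * x.1%:~R).

Lemma tau_ReIm (x : int * int) : 0 < x.1 ->
  complex.Re (tau x) = - x.2%:~R / (12 * x.1%:~R) /\ complex.Im (tau x) = sD / (12 * x.1%:~R).
Proof.
move=> x0; have hx : (12 * x.1%:~R : R) != 0 by rewrite mulf_neq0 // ?pnatr_eq0 // intr_eq0 gt_eqF.
have -> : tau x = (- x.2%:~R / (12 * x.1%:~R) : R)%:C + 'i%C * (sD / (12 * x.1%:~R) : R)%:C.
  rewrite /tau !(rmorphM, rmorphN, fmorphV, rmorph_nat, rmorph_int) /=.
  by rewrite mulrBl addrC mulNr mulrA.
by rewrite !(raddfD, ReiNIm, ImiRe) /=; simpc.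
Qed.

Lemma tau_Im x : 0 < x.1 -> 0 < complex.Im (tau x).
Proof. by move=> x0; rewrite (tau_ReIm x0).2 divr_gt0 ?sD_gt0 // mulr_gt0 // ltr0z. Qed.

Let w : C := 'i%C * sD%:C.

Lemma w_sqr A b c : disc (A, b, c) = - D -> (24 * A%:~R * c%:~R : C) = b%:~R ^+ 2 - w ^+ 2.
Proof.
rewrite /disc /= => h.
have -> : w ^+ 2 = - D%:~R.
  rewrite exprMn sqr_i mulN1r; congr (- _).
  by rewrite -rmorphXn /= sD_sqr rmorph_int.
rewrite -rmorphN -h rmorphB rmorphXn !rmorphM /=; clear; ring.
Qed.

Lemma w_neq (x : int * int) : 0 < x.1 -> w - x.2%:~R != 0.
Proof.
move=> x0; apply/eqP => h; have := tau_Im x0; rewrite /tau -/w h mul0r ltxx //.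
Qed.

Lemma intr_neq0 (A : int) : 0 < A -> (A%:~R : C) != 0.
Proof. by move=> A0; rewrite intr_eq0 gt_eqF. Qed.

Lemma f_tau_T A b : 0 < A -> f (tau (A, b + 12 * A)) = f (tau (A, b)).
Proof.
move=> A0; rewrite -(f_add1 (tau_Im (A0 : 0 < (A, b + 12 * A).1))); congr f.
have a0 := intr_neq0 A0.
have -> : tau (A, b + 12 * A) = (w - (b%:~R + 12 * A%:~R)) / (12 * A%:~R).
  by rewrite /tau /= -/w; congr (_ / _); congr (_ - _); ring.
exact: tau_alg_T.
Qed.

Lemma f_tau_W6 A b c : disc (A, b, c) = - D -> 0 < A -> 0 < c ->
  f (tau (c, - b)) = f (tau (A, b)).
Proof.
move=> hd A0 c0; rewrite -(f_W6 (tau_Im (A0 : 0 < (A, b).1))); congr f.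
have a0 := intr_neq0 A0; have c1 := intr_neq0 c0; have h := w_sqr hd.
have w0 := w_neq (A0 : 0 < (A, b).1).
rewrite /= in w0; rewrite /tau /= -/w rmorphN opprK; exact (tau_alg_W6 a0 c1 w0 h).
Qed.

Lemma f_tau_W3 A b c : disc (A, b, c) = - D -> 0 < A -> 0 < 3 * A + b + 2 * c ->
  f (tau (3 * A + b + 2 * c, 12 * A + 5 * b + 12 * c)) = - f (tau (A, b)).
Proof.
move=> hd A0 A1; rewrite -[LHS]opprK; congr (- _).
rewrite -(f_W3 (tau_Im (A1 : 0 < (3 * A + b + 2 * c, 12 * A + 5 * b + 12 * c).1))); congr f.
have a0 := intr_neq0 A0; have a1 := intr_neq0 A1; have h := w_sqr hd.
have v0 := w_neq (A0 : 0 < (A, - 6 * A - b).1).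
have e1 : (3 * A + b + 2 * c)%:~R = 3 * A%:~R + b%:~R + 2 * c%:~R :> C by ring.
have e2 : (12 * A + 5 * b + 12 * c)%:~R = 12 * A%:~R + 5 * b%:~R + 12 * c%:~R :> C by ring.
have e3 : (- 6 * A - b)%:~R = - (6 * A%:~R) - b%:~R :> C by ring.
rewrite /= e3 in v0; rewrite e1 in a1.
by rewrite /tau [in LHS]/= e1 e2 -/w; exact (tau_alg_W3 a0 a1 v0 h).
Qed.

Definition chi b : C := if (12 %| b - 1)%Z || (12 %| b + 1)%Z then 1 else -1.

(** The discriminant is 1 mod 24, so b^2 = 1 mod 24 and b is a unit mod 12. *)
Lemma disc_mod12 A b c : disc (A, b, c) = - D ->
  exists v, [\/ b = 12 * v + 1, b = 12 * v - 1, b = 12 * v + 5 | b = 12 * v - 5].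
Proof.
rewrite /disc /= /D => hd; have := divz_eq b 12; have := modz_ge0 b (isT : (12 : int) != 0).
have := ltz_pmod b (isT : (0 : int) < 12).
move: (b %% 12)%Z (b %/ 12)%Z => u v u12 u0 bE.
have h : u * u = 1 + 24 * (A * c - n%:Z - 6 * v * v - v * u).
  rewrite bE in hd; have -> : u * u = (v * 12 + u) ^+ 2 - 144 * v * v - 24 * v * u by ring.
  have -> : (v * 12 + u) ^+ 2 = - (24 * n%:Z - 1) + 24 * A * c by rewrite -hd; ring.
  by ring.
move: (A * c - _ - _ - _) h => k h.
have [e|[e|[e|e]]] : u = 1 \/ (u = 11 \/ (u = 5 \/ u = 7)).
  have : u = 0 \/ u = 1 \/ u = 2 \/ u = 3 \/ u = 4 \/ u = 5 \/ u = 6 \/ u = 7 \/ u = 8 \/ u = 9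
      \/ u = 10 \/ u = 11 by clear -u12 u0; lia.
  by clear -h; do 11?[case=> [e|]]; try (rewrite e in h; lia); move=> e; rewrite e in h; lia.
- by exists v; constructor 1; clear -bE e; lia.
- by exists (v + 1); constructor 2; clear -bE e; lia.
- by exists v; constructor 3; clear -bE e; lia.
- by exists (v + 1); constructor 4; clear -bE e; lia.
Qed.

Lemma chi1 v : chi (12 * v + 1) = 1 /\ chi (12 * v - 1) = 1.
Proof. by rewrite /chi; split; case: ifP => //; clear; lia. Qed.

Lemma chi5 v : chi (12 * v + 5) = -1 /\ chi (12 * v - 5) = -1.
Proof. by rewrite /chi; split; case: ifP => //; clear; lia. Qed.

Lemma chi_cong b v : chi (b + 12 * v) = chi b.
Proof. by rewrite /chi; congr (if _ then _ else _); clear; lia. Qed.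

Lemma chiN b : chi (- b) = chi b.
Proof. by rewrite /chi; congr (if _ then _ else _); clear; lia. Qed.

Lemma chi_mul5 A b c : disc (A, b, c) = - D -> chi (5 * b) = - chi b.
Proof.
move=> /disc_mod12 [v [->|->|->|->]].
- by rewrite (chi1 v).1 -(chi5 (5 * v)).1; congr chi; ring.
- by rewrite (chi1 v).2 -(chi5 (5 * v)).2; congr chi; ring.
- by rewrite (chi5 v).1 opprK -(chi1 (5 * v + 2)).1; congr chi; ring.
- by rewrite (chi5 v).2 opprK -(chi1 (5 * v - 2)).2; congr chi; ring.
Qed.

Definition fchi (x : int * int) : C := chi x.2 * f (tau x).

Let D_gt0 : 0 < D. Proof. by rewrite /D; lia. Qed.

(** T and W_6 preserve both factors. W_3 changes the sign of f and takes b to 5b mod 12, which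
    changes the sign of [chi]. *)
Lemma fchi_step X Y : disc X = - D -> 0 < X.1.1 -> step_equiv X Y -> fchi Y.1 = fchi X.1.
Proof.
move=> hX X0; elim=> {Y} // A b c h <-; have A0 := step_pos D_gt0 hX X0 h.
- by rewrite /fchi /= chi_cong f_tau_T.
- rewrite /fchi /= -(chi_cong (b - 12 * A) A) -(f_tau_T (b - 12 * A) A0) subrK //.
- rewrite /fchi /= chiN; congr (_ * _).
  apply: (f_tau_W6 (c := c)) => //; first by rewrite (step_disc h).
  exact: (step_pos D_gt0 hX X0 (se_W6 h)).
- have hd : disc (A, b, c) = - D by rewrite (step_disc h).
  rewrite /fchi /= (f_tau_W3 hd A0 (step_pos D_gt0 hX X0 (se_W3 h))).
  have -> : 12 * A + 5 * b + 12 * c = 5 * b + 12 * (A + c) by ring.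
  by rewrite chi_cong (chi_mul5 hd) mulrNN.
- have h' := se_W3inv h; have A1 := step_pos D_gt0 hX X0 h'.
  have hd : disc (3 * A - b + 2 * c, 5 * b - 12 * A - 12 * c, 2 * A - b + 3 * c) = - D.
    by rewrite (step_disc h').
  rewrite /= in A0 A1.
  have e1 : 3 * (3 * A - b + 2 * c) + (5 * b - 12 * A - 12 * c) + 2 * (2 * A - b + 3 * c) = A by ring.
  have e2 : 12 * (3 * A - b + 2 * c) + 5 * (5 * b - 12 * A - 12 * c) + 12 * (2 * A - b + 3 * c) = b by ring.
  have := f_tau_W3 hd A1; rewrite e1 e2 => /(_ A0) e3.
  have := chi_mul5 hd; rewrite -(chi_cong (5 * _) (5 * (A + c) - 2 * b)).
  have -> : 5 * (5 * b - 12 * A - 12 * c) + 12 * (5 * (A + c) - 2 * b) = b by ring.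
  by move=> e4; rewrite /fchi /= e3 e4 mulrNN.
Qed.

Lemma heegner_tau A b c : heegner R n (6 * A, b, c) = tau (A, b).
Proof.
rewrite /heegner /tau /qa /qb /= addrC; congr (_ / _).
by rewrite rmorphM /= mulrA; congr (_ * _); rewrite -!natrM.
Qed.

Lemma f_heegner K X : represents n K X -> f (heegner R n (xget (0, 0, 0) K)) = fchi X.1.
Proof.
move=> [A [b [c [v [-> hb _ h [X0 _ _ hd]]]]]]; rewrite heegner_tau.
rewrite -(fchi_step hd X0 (step_sym h)) /fchi /= hb [1 + _]addrC (chi1 v).1 mul1r //.
Qed.

Let m := (24 * n - 1)%N.

(** The pairs with 1 <= A <= D and |b| <= 6D; this crude count already has the order D^2 permitted
    in the error term. *)
Definition box : seq (int * int) :=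
  [seq (i.+1%:Z, j%:Z - 6 * m%:Z) | i <- iota 0 m, j <- iota 0 (12 * m + 1)].

Lemma size_box : (size box <= 13 * m ^ 2)%N.
Proof. rewrite size_allpairs !size_iota; have : (0 < m)%N by rewrite /m; lia.
by move: m => k; nia. Qed.

Lemma reduced_box X : reduced n X -> X.1 \in box.
Proof.
case: X => -[A b] c [/= A0 hb hA _].
have AD : A <= m%:Z.
  have : A <= 8 * A ^+ 2 by rewrite expr2; clear -A0; nia.
  move/le_trans/(_ hA); rewrite /m; clear -n_gt0; lia.
apply/allpairsP; exists (`|A|.-1%N, absz (b + 6 * m%:Z)); split => /=.
- by rewrite mem_iota; clear -A0 AD; lia.
- by rewrite mem_iota; clear -A0 AD hb; lia.
- by congr (_, _); clear -A0 AD hb; lia.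
Qed.

Lemma reduced_inj X Y : reduced n X -> reduced n Y -> X.1 = Y.1 -> X = Y.
Proof.
case: X Y => -[A b] c [[A' b'] c'] [/= A0 _ _ h] [_ _ _ h'] [e1 e2].
rewrite -e1 -e2 in h' *; congr (_, _); rewrite /disc /= in h h'.
have i24 : injective (fun x : int => 24 * A * x) by apply: mulfI; rewrite mulf_neq0 // gt_eqF.
apply: i24; apply: oppr_inj; apply: (addrI (b ^+ 2)); by rewrite h h'.
Qed.

Theorem traceS_list : exists s : seq (int * int),
  [/\ uniq s, (size s <= 13 * m ^ 2)%N,
    forall x : int * int, x \in s -> exists c, reduced n (x, c),
    (4 <= n)%N -> {subset [:: (1, 1); (1, -1); (1, 5); (1, -5)] <= s} &
    traceS R n = \sum_(x <- s) fchi x].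
Proof.
pose r K := xget (0, 0, 0) (fun X => represents n K X).
have hr K : Qclasses n K -> represents n K (r K).
  by move=> hK; have [X hX] := represents_exists n_gt0 hK; exact: (xgetI (0, 0, 0) hX).
have red K : Qclasses n K -> reduced n (r K).
  by move=> /hr [A [b [c [v [_ _ _ _]]]]].
pose g K := (r K).1.
have ginj K K' : Qclasses n K -> Qclasses n K' -> g K = g K' -> K = K'.
  move=> hK hK' e; have h := hr _ hK; rewrite (reduced_inj (red _ hK) (red _ hK') e) in h.
  exact: (represents_inj h (hr _ hK')).
(* Finiteness follows from the injection of the classes into [box]; it lets the sum over a set be
   read as a sum over a list. *)
have fin : finite_set (Qclasses n).
  have gi : {in Qclasses n &, injective g} by move=> K K'; rewrite !in_setE; exact: ginj.
  rewrite -(eq_finite_set (inj_card_eq gi)); apply: sub_finite_set (finite_seq box).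
  by move=> _ [K hK <-] /=; exact: reduced_box (red _ hK).
have mem (K : set bqf) : (K \in fset_set (Qclasses n)) = (K \in Qclasses n) by rewrite in_fset_set.
pose s := [seq g K | K <- fset_set (Qclasses n)].
have su : uniq s.
  rewrite map_inj_in_uniq ?fset_uniq // => K K'; rewrite !mem !in_setE; exact: ginj.
have sred x : x \in s -> exists c, reduced n (x, c).
  by move=> /mapP[K]; rewrite mem in_setE => hK ->; exists (r K).2; rewrite /g -surjective_pairing; exact: red.
exists s; split => //.
- apply: leq_trans size_box; apply: uniq_leq_size su _ => x /sred [c] /reduced_box; exact.
- move=> n4 x hx.
  have [b hb ->] : exists2 b, b \in [:: 1; -1; 5; -5 : int] & x = (1, b).
    move: hx; rewrite !inE => /or4P[] /eqP ->; by [exists 1|exists (-1)|exists 5|exists (-5)].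
  have [K hK hX] := main_class n_gt0 n4 hb.
  by apply/mapP; exists K; [rewrite mem in_setE|rewrite /g (hX _ (hr _ hK))].
rewrite /traceS (fsbig_finite _ _ fin) /s big_map.
apply: eq_big_seq => K; rewrite mem in_setE => hK; exact: f_heegner (hr _ hK).
Qed.

End HeegnerPoints.

(** * The error term *)

Section Bounds.
Variable R : realType.
Local Notation C := R[i].

(** From cos 3x = 4 cos^3 x - 3 cos x at 3x = pi/2. *)
Lemma cos_pi_div6 : cos (pi / 6) = Num.sqrt 3 / 2 :> R.
Proof.
have p0 := @pi_gt0 R; set x := pi / 6 : R.
have h : cos (x + (x + x)) = 0 by have -> : x + (x + x) = pi / 2 by [rewrite /x; field]; exact: cos_pihalf.
have c0 : 0 < cos x by apply: cos_gt0_pihalf; rewrite /x; apply/andP; split; lra.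
have s2 := cos2Dsin2 x.
have e : cos x * (4 * cos x ^+ 2 - 3) = 0.
  rewrite -h !(cosD, sinD).
  have -> : cos x * (cos x * cos x - sin x * sin x) - sin x * (sin x * cos x + cos x * sin x) =
     cos x * (cos x ^+ 2 - 3 * sin x ^+ 2) by ring.
  by have -> : sin x ^+ 2 = 1 - cos x ^+ 2 by [rewrite -s2; ring]; ring.
have {}e : (cos x * 2) ^+ 2 = 3.
  move/eqP: e; rewrite mulf_eq0 gt_eqF //= subr_eq0 => /eqP e; rewrite exprMn -e; ring.
rewrite -e sqrtr_sqr ger0_norm ?mulfK // mulr_ge0 // ltW //.
Qed.

Lemma expR_le64 (x : R) : x <= 3 -> expR x <= 64.
Proof.
move=> x3; have -> : x = x / 6 * 6%:R by field.
rewrite expRM_natr; have h : expR (x / 6) <= 2 by apply: expR_le2; lra.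
have -> : (64 : R) = 2 ^+ 6 by rewrite !exprS; ring.
by rewrite lerXn2r ?nnegrE ?expR_ge0.
Qed.

(** The letters stand for d = D^2, q the power of 2, B = e^(lambda/2) and T = 10^17; every term on
    the left is at most a small multiple of P = T d B. *)
Lemma error_arith (d q B T : R) : 1 <= d -> 1 <= q -> 1 <= B -> 1 <= T ->
  13 * d * (B + T) + 4 * T < 4300 * 1000 * T * q * d * B.
Proof.
move=> d1 q1 B1 T1; pose P := T * d * B.
have Td : T <= T * d by rewrite ler_peMr //; lra.
have TdP : T * d <= P by rewrite ler_peMr //; lra.
have dBP : d * B <= P by rewrite /P -mulrA ler_peMl // mulr_ge0 //; lra.
have P1 : 1 <= P by lra.
have PqP : P <= P * q by rewrite ler_peMr //; lra.
have -> : 4300 * 1000 * T * q * d * B = 4300 * 1000 * (P * q) by rewrite /P; ring.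
have -> : 13 * d * (B + T) = 13 * (d * B) + 13 * (T * d) by ring.
by clearbody P; lra.
Qed.

(** The case n <= 3, where e^lambda = B B and one factor B is replaced by 64. *)
Lemma error_arith_small (d q B T : R) : 1 <= d -> 1 <= q -> 1 <= B -> B <= 64 -> 1 <= T ->
  13 * d * (B * B + T) + 4 * (B * B) < 4300 * 1000 * T * q * d * B.
Proof.
move=> d1 q1 B1 B64 T1; pose P := T * d * B.
have Td : T <= T * d by rewrite ler_peMr //; lra.
have TdP : T * d <= P by rewrite ler_peMr //; lra.
have dBP : d * B <= P by rewrite /P -mulrA ler_peMl // mulr_ge0 //; lra.
have BdB : B <= d * B by rewrite ler_peMl //; lra.
have P1 : 1 <= P by lra.
have PqP : P <= P * q by rewrite ler_peMr //; lra.
have BB : B * B <= 64 * B by rewrite ler_wpM2r //; lra.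
have dBB : d * B * B <= 64 * (d * B) by rewrite mulrC ler_wpM2r // mulr_ge0 //; lra.
have -> : 4300 * 1000 * T * q * d * B = 4300 * 1000 * (P * q) by rewrite /P; ring.
have -> : 13 * d * (B * B + T) = 13 * (d * B * B) + 13 * (T * d) by ring.
by clearbody P; lra.
Qed.

Variable n : nat.
Hypothesis n_gt0 : (0 < n)%N.
Let sD : R := Num.sqrt (Dn R n).
Let sD0 : 0 < sD := sD_gt0 R n_gt0.

Lemma qe_tau_inv b : (qe (tau R n (1, b)))^-1 =
  (expR (lambda R n))%:C * (cos (pi / 6 * b%:~R) +i* sin (pi / 6 * b%:~R)) :> C.
Proof.
rewrite qeE -cexpN; have [] := tau_ReIm R n (isT : 0 < (1 : int, b).1).
case: (tau R n (1, b)) => x y /= -> ->.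
rewrite /cexp; have -> : - ((2 * pi)%:C * 'i * (- b%:~R / (12 * 1%:~R) +i* (Num.sqrt (Dn R n) / (12 * 1%:~R)))) =
  (lambda R n +i* (pi / 6 * b%:~R)) :> C.
  by rewrite /lambda; simpc; apply/eqP; rewrite eq_complex /=; apply/andP; split; apply/eqP; field.
by [].
Qed.

Lemma main_sum : \sum_(x <- [:: (1, 1); (1, -1); (1, 5); (1, -5)]) chi R x.2 * (qe (tau R n x))^-1 =
  (2 * Num.sqrt 3 * expR (lambda R n))%:C.
Proof.
rewrite !big_cons big_nil !qe_tau_inv /=.
have -> : chi R 1 = 1 by [].
have -> : chi R (-1) = 1 by [].
have -> : chi R 5 = -1 by [].
have -> : chi R (-5) = -1 by [].
have e5 : pi / 6 * 5%:~R = pi - pi / 6 :> R by field.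
rewrite !rmorphN !mulrN !cosN !sinN e5 mulr1 cosB sinB cospi sinpi cos_pi_div6.
by simpc; apply/eqP; rewrite eq_complex /=; apply/andP; split; apply/eqP; field.
Qed.

Lemma nm_chi b : nm (chi R b) = 1.
Proof. by rewrite /chi; case: ifP; rewrite ?nmN nm1. Qed.

(** For a reduced triple (12 Im tau)^2 = D / A^2 >= 8, the hypothesis of [f_growth]. *)
Lemma fchi_approx x c : reduced n (x, c) ->
  nm (fchi R n x - chi R x.2 * (qe (tau R n x))^-1) <= 10 ^+ 17.
Proof.
move=> [/= A0 _ hA _]; have t0 := tau_Im R n_gt0 A0.
rewrite /fchi -mulrBr nmM nm_chi mul1r; apply: f_growth => //.
have a0 : 0 < x.1%:~R :> R by rewrite ltr0z.
rewrite (tau_ReIm R n A0).2; have -> : 12 * (sD / (12 * x.1%:~R)) = sD / x.1%:~R.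
  by field; rewrite gt_eqF.
rewrite exprMn exprVn ler_pdivlMr ?exprn_gt0 // (sD_sqr R n_gt0).
by rewrite -rmorphXn /= -[8]/(8%:~R) -rmorphM ler_int.
Qed.

Lemma lambda_ge0 : 0 <= lambda R n.
Proof. by rewrite /lambda divr_ge0 // mulr_ge0 ?pi_ge0 // ltW. Qed.

(** Applied with k = 2 off the four main pairs, and with k = 1 when no pair is singled out. *)
Lemma fchi_bound x c (k : nat) : reduced n (x, c) -> (0 < k)%N -> k%:Z <= x.1 ->
  nm (fchi R n x) <= expR (lambda R n / k%:R) + 10 ^+ 17.
Proof.
move=> hx k0 hk; have h := fchi_approx hx; have [/= A0 _ _ _] := hx.
rewrite -[fchi R n x](subrK (chi R x.2 * (qe (tau R n x))^-1)) addrC.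
apply: le_trans (nmD _ _) _; apply: lerD h.
rewrite nmM nm_chi mul1r nmV nm_qe -expRN opprK ler_expR (tau_ReIm R n A0).2.
have a0 : 0 < x.1%:~R :> R by rewrite ltr0z.
have -> : 2 * pi * (sD / (12 * x.1%:~R)) = lambda R n / x.1%:~R.
  by rewrite /lambda -/sD; field; rewrite gt_eqF.
rewrite ler_wpM2l ?lambda_ge0 // lef_pV2 ?posrE ?ltr0n //.
by rewrite -[k%:R]/(k%:Z%:~R) ler_int.
Qed.

Lemma sum_bound (I : eqType) (r : seq I) (P : pred I) (F : I -> C) (B : R) : 0 <= B ->
  (forall x, x \in r -> P x -> nm (F x) <= B) -> nm (\sum_(x <- r | P x) F x) <= (size r)%:R * B.
Proof.
move=> B0; elim: r => [|x r ih] h; first by rewrite big_nil nm0 mul0r.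
have ihr : nm (\sum_(x <- r | P x) F x) <= (size r)%:R * B.
  by apply: ih => y yr; apply: h; rewrite inE yr orbT.
rewrite big_cons /= -natr1 mulrDl mul1r; case: ifP => Px; last by rewrite -[leLHS]addr0 lerD.
apply: le_trans (nmD _ _) _; rewrite addrC lerD // h // inE eqxx //.
Qed.

Let mains : seq (int * int) := [:: (1, 1); (1, -1); (1, 5); (1, -5)].

Lemma reduced_main x c : reduced n (x, c) -> x.1 = 1 -> x \in mains.
Proof.
case: x => A b [/= _ hb _ hd] A1; have [v hv] := disc_mod12 hd; rewrite A1 in hb *.
have [->|[->|[->|->]]] : b = 1 \/ b = -1 \/ b = 5 \/ b = -5; rewrite ?inE ?eqxx ?orbT //.
by case: hv => hv; clear -hv hb; lia.
Qed.

Lemma size_bound (k : nat) : (k <= 13 * (24 * n - 1) ^ 2)%N -> k%:R <= 13 * Dn R n ^+ 2.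
Proof.
have -> : 13 * Dn R n ^+ 2 = (13 * (24 * n - 1) ^ 2)%:R.
  by rewrite natrM natrX natrB ?natrM //; lia.
by rewrite ler_nat.
Qed.

Lemma error_large : (4 <= n)%N ->
  nm (traceS R n - (2 * Num.sqrt 3 * expR (lambda R n))%:C) <=
    13 * Dn R n ^+ 2 * (expR (lambda R n / 2) + 10 ^+ 17) + 4 * 10 ^+ 17.
Proof.
move=> n4; have [s [su ss sr sm ->]] := traceS_list R n_gt0; have {}sm := sm n4.
rewrite (bigID (mem mains)) /= -main_sum.
have -> : \sum_(x <- s | x \in mains) fchi R n x = \sum_(x <- mains) fchi R n x.
  rewrite -big_filter; apply: perm_big; apply: uniq_perm; rewrite ?filter_uniq // => x.
  by rewrite mem_filter; case: (boolP (x \in mains)) => //= /sm ->.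
rewrite addrAC -sumrB addrC; apply: le_trans (nmD _ _) _; apply: lerD.
  have T0 : 0 <= expR (lambda R n / 2) + 10 ^+ 17 by rewrite addr_ge0 ?expR_ge0 ?exprn_ge0.
  apply: le_trans (sum_bound T0 _) (ler_wpM2r T0 (size_bound ss)).
  move=> x xs xm; have [c hc] := sr x xs; apply: (fchi_bound (k := 2) hc) => //.
  have [/= A0 _ _ _] := hc; have A1 : x.1 != 1 by apply: contra xm => /eqP; exact: reduced_main hc.
  by move: A0 A1; clear; case: x => y z /=; lia.
apply: (@sum_bound _ mains predT); first exact: exprn_ge0.
by move=> x /sm /sr [c hc] _; exact: fchi_approx hc.
Qed.

(** The sum and 2 sqrt 3 e^lambda are bounded separately, without cancellation; this serves for n <=
    3, where D <= 71 is out of reach of [al_main]. *)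
Lemma error_small :
  nm (traceS R n - (2 * Num.sqrt 3 * expR (lambda R n))%:C) <=
    13 * Dn R n ^+ 2 * (expR (lambda R n) + 10 ^+ 17) + 4 * expR (lambda R n).
Proof.
have [s [su ss sr sm ->]] := traceS_list R n_gt0.
apply: le_trans (nmD _ _) _; rewrite nmN; apply: lerD.
  have T0 : 0 <= expR (lambda R n) + 10 ^+ 17 by rewrite addr_ge0 ?expR_ge0 ?exprn_ge0.
  apply: le_trans (sum_bound T0 _) (ler_wpM2r T0 (size_bound ss)).
  move=> x xs _; have [c hc] := sr x xs; have := fchi_bound (k := 1) hc; rewrite divr1; apply=> //.
  by have [/= A0 _ _ _] := hc; clear -A0; lia.
rewrite nmR ger0_norm; last by rewrite !mulr_ge0 ?expR_ge0 ?sqrtr_ge0.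
rewrite ler_wpM2r ?expR_ge0 //.
have : Num.sqrt 3 <= Num.sqrt (2 ^+ 2) :> R by rewrite ler_sqrt ?exprn_gt0 // expr2; lra.
rewrite sqrtr_sqr ger0_norm //; lra.
Qed.

(** D <= 71 < 81 and pi < 4 give lambda / 2 <= 3, and e^3 <= 2^6. *)
Lemma expR_half_le64 : (n <= 3)%N -> expR (lambda R n / 2) <= 64.
Proof.
move=> n3; apply: expR_le64; rewrite /lambda -/sD.
have s9 : sD <= 9.
  have -> : (9 : R) = Num.sqrt (9 ^+ 2) by rewrite sqrtr_sqr ger0_norm.
  have : n%:R <= 3%:R :> R by rewrite ler_nat.
  by rewrite ler_sqrt ?exprn_gt0 // /Dn expr2 => h; lra.
have p4 := @pi_lt4 R; have p0 := @pi_gt0 R.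
have : pi * sD <= 4 * 9 by rewrite ler_pM // ltW.
lra.
Qed.

Theorem error_bound :
  nm (traceS R n - (2 * Num.sqrt 3 * expR (lambda R n))%:C) <
    430 * 10 ^+ 21 * 2 `^ (qn R n) * (Dn R n) ^+ 2 * expR (lambda R n / 2).
Proof.
have d0 : 1 <= Dn R n ^+ 2 by rewrite expr_ge1 //; have := Dn_ge23 R n_gt0; lra.
have q1 : 1 <= 2 `^ (qn R n).
  have := @ler_powR R 2 _ 0 (qn R n); rewrite powRr0; apply; first by lra.
  rewrite /qn divr_ge0 // ln_ge0 //; have := Dn_ge23 R n_gt0; lra.
have b1 : 1 <= expR (lambda R n / 2).
  by rewrite -expR0 ler_expR divr_ge0 ?lambda_ge0.
have bb : expR (lambda R n) = expR (lambda R n / 2) * expR (lambda R n / 2).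
  by rewrite -expRD; congr expR; field.
have T1 : 1 <= (10 : R) ^+ 17 by rewrite exprn_ege1 //; lra.
have -> : 430 * 10 ^+ 21 = 4300 * 1000 * (10 ^+ 17) :> R.
  by rewrite (_ : 21 = 4 + 17)%N // exprD; have -> : (10 : R) ^+ 4 = 100 * 100 by [rewrite !exprS; ring]; ring.
have [n3|n4] := leqP n 3.
  apply: le_lt_trans error_small _; have b64 := expR_half_le64 n3; rewrite bb.
  exact: error_arith_small.
apply: le_lt_trans (error_large n4) _.
exact: error_arith.
Qed.

End Bounds.

Unset Implicit Arguments.

Theorem theorem1p5 (R : realType) :
  exists E : nat -> R[i], forall n : nat, (1 <= n)%N ->
    traceS R n = (2 * Num.sqrt 3 * expR (lambda R n))%:C + E n /\
    `|E n| < (430 * 10 ^+ 21 * 2 `^ (qn R n) * (Dn R n) ^+ 2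
              * expR (lambda R n / 2))%:C.

Proof.
exists (fun n => traceS R n - (2 * Num.sqrt 3 * expR (lambda R n))%:C) => n n1.
by split; [rewrite addrC subrK|rewrite norm_nm ltcR; exact: error_bound].
Qed.
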